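(* Let $\mathbb{F}=\mathbb{C}$ or $\mathbb{R}$ and let $(\mathbf{x},\mathbf{y})\mapsto\mathbf{f}(\mathbf{x},\mathbf{y})$ be a smooth mapping defined in an open domain of $\mathbb{F}^m\times\mathbb{F}^n$ with values in some $\mathbb{F}^l$. Assume that, at a fixed $\mathbf{y}_*$, the point $\mathbf{x}_*$ is a semiregular zero of $\mathbf{x}\mapsto\mathbf{f}(\mathbf{x},\mathbf{y}_* )$ with $\mathrm{rank}(\mathbf{f}_{\mathbf{x}}(\mathbf{x}_*,\mathbf{y}_* ))=r>0$ and $\|\mathbf{f}_{\mathbf{y}}(\mathbf{x}_*,\mathbf{y}_* )\|_2>0$. Then there exist a neighborhood $\Omega_*\times\Sigma_*$ of $(\mathbf{x}_*,\mathbf{y}_* )$, a neighborhood $\Omega_0$ of $\mathbf{x}_*$ and a constant $h$ with $0<h<1$ such that, at every fixed $\tilde{\mathbf{y}}\in\Sigma_*$ and from any initial iterate $\mathbf{x}_0\in\Omega_0$, the iteration $$\mathbf{x}_{k+1}=\mathbf{x}_k-\mathbf{f}_{\mathbf{x}}(\mathbf{x}_k,\tilde{\mathbf{y}})_{\mathrm{rank}\text{-}r}^\dagger\,\mathbf{f}(\mathbf{x}_k,\tilde{\mathbf{y}}),\qquad k=0,1,\ldots$$ linearly converges to a stationary point $\tilde{\mathbf{x}}\in\Omega_*$, at which $$\mathbf{f}_{\mathbf{x}}(\tilde{\mathbf{x}},\tilde{\mathbf{y}})_{\mathrm{rank}\text{-}r}^\dagger\,\mathbf{f}(\tilde{\mathbf{x}},\tilde{\mathbf{y}})=\mathbf{0},$$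 with an error bound $$\|\tilde{\mathbf{x}}-\hat{\mathbf{x}}\|_2\le\frac{8}{1-h}\,\big\|\mathbf{f}_{\mathbf{x}}(\mathbf{x}_*,\mathbf{y}_* )^\dagger\big\|_2\,\big\|\mathbf{f}_{\mathbf{y}}(\mathbf{x}_*,\mathbf{y}_* )\big\|_2\,\|\tilde{\mathbf{y}}-\mathbf{y}_*\|_2+O\big(\|\tilde{\mathbf{y}}-\mathbf{y}_*\|_2^2\big)$$ toward a semiregular zero $\hat{\mathbf{x}}$ of $\mathbf{x}\mapsto\mathbf{f}(\mathbf{x},\mathbf{y}_* )$ in the same branch of $\mathbf{x}_*$ (where $\hat{\mathbf{x}}$ may depend on $\mathbf{x}_0$ and $\tilde{\mathbf{y}}$).
   Context: Smooth mapping: a mapping on an open domain is smooth if it has continuous derivatives of second order (case $\mathbb{F}=\mathbb{R}$) or is holomorphic (case $\mathbb{F}=\mathbb{C}$). $\mathbf{f}_{\mathbf{x}}$ and $\mathbf{f}_{\mathbf{y}}$ are the partial Jacobians with respect to $\mathbf{x}$ and $\mathbf{y}$. Rank-$r$ projection: for a matrix $A$ with singular values $\sigma_1(A)\ge\sigma_2(A)\ge\cdots$ and corresponding left and right singular vectors $\mathbf{u}_j,\mathbf{v}_j$, $A_{\mathrm{rank}\text{-}r}:=\sum_{j=1}^r\sigma_j(A)\,\mathbf{u}_j\mathbf{v}_j^{\mathsf H}$ (it does not depend on the choice of singular vectors when $\sigma_r(A)>\sigma_{r+1}(A)$). $\dagger$ denotes the Moore-Penrose inverse and $A_{\mathrm{rank}\text{-}r}^\dagger:=(A_{\mathrm{rank}\text{-}r})^\dagger$.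 The following apply to a smooth mapping $\mathbf{g}:\Omega\subset\mathbb{F}^m\to\mathbb{F}^l$ with Jacobian $\mathbf{g}_{\mathbf{x}}$, such as $\mathbf{g}(\mathbf{x})=\mathbf{f}(\mathbf{x},\mathbf{y}_* )$. A zero is a point $\mathbf{x}_*$ with $\mathbf{g}(\mathbf{x}_* )=\mathbf{0}$; $\mathbf{g}^{-1}(\mathbf{0})$ is the set of zeros; a zero is isolated if it is the only zero in some open neighborhood of it. Dimension of a zero: if there is an open neighborhood $\Delta\subset\Omega$ of the zero $\mathbf{x}_*$ in $\mathbb{F}^m$ such that $\Delta\cap\mathbf{g}^{-1}(\mathbf{0})=\phi(\Lambda)$, where $\phi$ is a differentiable injective mapping defined on a connected open set $\Lambda$ in $\mathbb{F}^k$ for a certain $k>0$, with $\phi(\mathbf{z}_* )=\mathbf{x}_*$ for some $\mathbf{z}_*\in\Lambda$ and Jacobian $\phi_{\mathbf{z}}(\mathbf{z}_* )$ of rank $k$, then $\dim_{\mathbf{g}}(\mathbf{x}_* ):=k$. An isolated zero has dimension $0$. Otherwise the dimension is not defined. Semiregular zero: $\mathbf{x}_*$ is a semiregular zero of $\mathbf{g}$ if $\dim_{\mathbf{g}}(\mathbf{x}_* )$ is well-defined and equal to the nullity of $\mathbf{g}_{\mathbf{x}}(\mathbf{x}_* )$, i.e. $\dim_{\mathbf{g}}(\mathbf{x}_* )+\mathrm{rank}(\mathbf{g}_{\mathbf{x}}(\mathbf{x}_* ))=m$. Same branch: with $\phi,\Lambda,\mathbf{z}_*,k$ as in the definition of the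 dimension of $\mathbf{x}_*$ and $\Lambda_*\subset\Lambda$ an open neighborhood of $\mathbf{z}_*$ on which $\mathrm{rank}(\phi_{\mathbf{z}}(\mathbf{z}))\equiv k$, every $\mathbf{x}\in\phi(\Lambda_* )$ is in the same branch of zeros as $\mathbf{x}_*$; and if $\tilde{\mathbf{x}}$ is in the same branch as $\mathbf{x}_*$, then every zero in the same branch as $\tilde{\mathbf{x}}$ is in the same branch as $\mathbf{x}_*$. An isolated zero is in the same branch only as itself. Linear convergence of $\{\mathbf{x}_k\}$ to $\tilde{\mathbf{x}}$ means (at least) linear rate: there are constants $C\ge 0$ and $0<\theta<1$ with $\|\mathbf{x}_k-\tilde{\mathbf{x}}\|_2\le C\,\theta^k$ for all $k\ge 0$. Convergence of the iteration includes that all iterates stay in the domain. The constant implied by $O(\|\tilde{\mathbf{y}}-\mathbf{y}_*\|_2^2)$ is independent of $\tilde{\mathbf{y}}\in\Sigma_*$ and $\mathbf{x}_0\in\Omega_0$. *)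

(* Defs.v *)
From HB Require Import structures.
From mathcomp Require Import all_boot all_order all_algebra.
From mathcomp Require Import complex.
From mathcomp Require Import all_classical all_reals all_analysis.

Set Implicit Arguments.
Unset Strict Implicit.
Unset Printing Implicit Defensive.

Import Order.TTheory GRing.Theory Num.Theory.
Import numFieldNormedType.Exports.

Local Open Scope classical_set_scope.
Local Open Scope ring_scope.

Inductive ground : Set := RealField | ComplexField.

Definition scalarField (R : realType) (F : ground) : numFieldType :=
  match F with RealField => R | ComplexField => R[i] end.

Definition cj (R : realType) (F : ground) : scalarField R F -> scalarField R F :=
  match F return scalarField R F -> scalarField R F with
  | RealField => id
  | ComplexField => @conjc R
  end.

(* The norm of [R[i]] takes its values in [R[i]]; [modulus] is valued in [R]. *)
Definition modulus (R : realType) (F : ground) : scalarField R F -> R :=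
  match F return scalarField R F -> R with
  | RealField => fun x => `|x|
  | ComplexField => fun z => complex.Re `|z|
  end.

Definition of_real (R : realType) (F : ground) : R -> scalarField R F :=
  match F return R -> scalarField R F with
  | RealField => id
  | ComplexField => fun x => x%:C%C
  end.

Definition adj (R : realType) (F : ground) (m n : nat)
    (A : 'M[scalarField R F]_(m, n)) : 'M[scalarField R F]_(n, m) :=
  (map_mx (@cj R F) A)^T.

(* The library norm of matrices is the max norm, hence the two norms below. *)
Definition norm2 (R : realType) (F : ground) (n : nat)
    (v : 'cV[scalarField R F]_n) : R :=
  Num.sqrt (\sum_i modulus (v i 0) ^+ 2).

Definition mxnorm2 (R : realType) (F : ground) (m n : nat)
    (A : 'M[scalarField R F]_(m, n)) : R :=
  sup [set norm2 (A *m v) | v in [set v : 'cV[scalarField R F]_n | norm2 v <= 1]].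

Definition orthonormal_family (R : realType) (F : ground) (n q : nat)
    (u : 'I_q -> 'cV[scalarField R F]_n) : Prop :=
  forall i j, adj (u i) *m u j = (i == j)%:R%:M.

Definition is_svd (R : realType) (F : ground) (l m : nat)
    (A : 'M[scalarField R F]_(l, m)) (s : 'I_(minn l m) -> R)
    (u : 'I_(minn l m) -> 'cV[scalarField R F]_l)
    (v : 'I_(minn l m) -> 'cV[scalarField R F]_m) : Prop :=
  [/\ forall j, 0 <= s j,
      forall i j : 'I_(minn l m), (i <= j)%N -> s j <= s i,
      orthonormal_family u,
      orthonormal_family v &
      A = \sum_j of_real F (s j) *: (u j *m adj (v j))].

(* Some choice of singular vectors is made; the value does not depend on it
   when the [r]-th and [r+1]-st singular values differ. *)
Definition rank_proj (R : realType) (F : ground) (l m r : nat)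
    (A : 'M[scalarField R F]_(l, m)) : 'M[scalarField R F]_(l, m) :=
  xget 0 [set B | exists s u v, is_svd A s u v /\
    B = \sum_(j : 'I_(minn l m) | (j < r)%N)
          of_real F (s j) *: (u j *m adj (v j))].

Definition is_moore_penrose (R : realType) (F : ground) (l m : nat)
    (A : 'M[scalarField R F]_(l, m)) (B : 'M[scalarField R F]_(m, l)) : Prop :=
  [/\ A *m B *m A = A,
      B *m A *m B = B,
      adj (A *m B) = A *m B &
      adj (B *m A) = B *m A].

(* Not [pinvmx], which is only some generalized inverse. *)
Definition mpinv (R : realType) (F : ground) (l m : nat)
    (A : 'M[scalarField R F]_(l, m)) : 'M[scalarField R F]_(m, l) :=
  xget 0 [set B | is_moore_penrose A B].

Definition C2_on (K : numFieldType) (V W : normedModType K)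
    (D : set V) (f : V -> W) : Prop :=
  [/\ forall p, D p -> differentiable f p,
      forall v p, D p -> differentiable ('D_v f) p &
      forall v w p, D p -> {for p, continuous ('D_w ('D_v f))}].

(* Over [R[i]], [differentiable] is complex Frechet differentiability. *)
Definition holomorphic_on (K : numFieldType) (V W : normedModType K)
    (D : set V) (f : V -> W) : Prop :=
  forall p, D p -> differentiable f p.

Definition smooth_on (R : realType) (F : ground)
    (V W : normedModType (scalarField R F)) (D : set V) (f : V -> W) : Prop :=
  match F with
  | RealField => C2_on D f
  | ComplexField => holomorphic_on D f
  end.

(* For column vectors; the library's [jacobian] is for row vectors and is
   the transpose. *)
Definition jac (K : numFieldType) (m l : nat) (g : 'cV[K]_m -> 'cV[K]_l)
    (x : 'cV[K]_m) : 'M[K]_(l, m) :=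
  \matrix_(i < l, j < m) ('D_(delta_mx j 0) g x) i 0.

Definition jac_x (K : numFieldType) (m n l : nat)
    (f : 'cV[K]_m * 'cV[K]_n -> 'cV[K]_l) (p : 'cV[K]_m * 'cV[K]_n) :
    'M[K]_(l, m) :=
  jac (fun x => f (x, p.2)) p.1.

Definition jac_y (K : numFieldType) (m n l : nat)
    (f : 'cV[K]_m * 'cV[K]_n -> 'cV[K]_l) (p : 'cV[K]_m * 'cV[K]_n) :
    'M[K]_(l, n) :=
  jac (fun y => f (p.1, y)) p.2.

(* In what follows [g] is a total function, meaningful on [Om] only. *)
Definition zeros (K : numFieldType) (m l : nat) (Om : set 'cV[K]_m)
    (g : 'cV[K]_m -> 'cV[K]_l) : set 'cV[K]_m :=
  Om `&` [set x | g x = 0].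

Definition isolated_zero (K : numFieldType) (m l : nat) (Om : set 'cV[K]_m)
    (g : 'cV[K]_m -> 'cV[K]_l) (x : 'cV[K]_m) : Prop :=
  exists U, open_nbhs x U /\ U `&` zeros Om g = [set x].

Definition zero_param (K : numFieldType) (m l : nat) (Om : set 'cV[K]_m)
    (g : 'cV[K]_m -> 'cV[K]_l) (x : 'cV[K]_m)
    (k : nat) (Lam : set 'cV[K]_k) (phi : 'cV[K]_k -> 'cV[K]_m)
    (z : 'cV[K]_k) : Prop :=
  [/\ open Lam /\ connected Lam,
      forall w, Lam w -> differentiable phi w,
      {in Lam &, injective phi},
      [/\ Lam z, phi z = x & \rank (jac phi z) = k] &
      exists Del, [/\ open_nbhs x Del, Del `<=` Om &
                      Del `&` zeros Om g = phi @` Lam]].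

Definition zero_dim (K : numFieldType) (m l : nat) (Om : set 'cV[K]_m)
    (g : 'cV[K]_m -> 'cV[K]_l) (x : 'cV[K]_m) (k : nat) : Prop :=
  (k = 0%N /\ isolated_zero Om g x) \/
  ((0 < k)%N /\
   exists (Lam : set 'cV[K]_k) (phi : 'cV[K]_k -> 'cV[K]_m) (z : 'cV[K]_k),
     zero_param Om g x Lam phi z).

Definition semiregular_zero (K : numFieldType) (m l : nat) (Om : set 'cV[K]_m)
    (g : 'cV[K]_m -> 'cV[K]_l) (x : 'cV[K]_m) : Prop :=
  exists k, zero_dim Om g x k /\ (k + \rank (jac g x) = m)%N.

(* [same_branch Om g x x'] : [x'] is in the same branch of zeros as [x]. *)
Inductive same_branch (K : numFieldType) (m l : nat) (Om : set 'cV[K]_m)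
    (g : 'cV[K]_m -> 'cV[K]_l) : 'cV[K]_m -> 'cV[K]_m -> Prop :=
| same_branch_isolated x : isolated_zero Om g x -> same_branch Om g x x
| same_branch_local (k : nat) (Lam Lams : set 'cV[K]_k)
    (phi : 'cV[K]_k -> 'cV[K]_m) (z w : 'cV[K]_k) (x : 'cV[K]_m) :
    (0 < k)%N ->
    zero_param Om g x Lam phi z ->
    open_nbhs z Lams -> Lams `<=` Lam ->
    (forall t, Lams t -> \rank (jac phi t) = k) ->
    Lams w -> same_branch Om g x (phi w)
| same_branch_trans x y x' :
    same_branch Om g x y -> same_branch Om g y x' -> same_branch Om g x x'.

Definition newton_step (R : realType) (F : ground) (m n l : nat)
    (f : 'cV[scalarField R F]_m * 'cV[scalarField R F]_n -> 'cV[scalarField R F]_l)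
    (r : nat) (y : 'cV[scalarField R F]_n) (x : 'cV[scalarField R F]_m) :
    'cV[scalarField R F]_m :=
  x - mpinv (rank_proj r (jac_x f (x, y))) *m f (x, y).

Definition linearly_converges (R : realType) (F : ground) (m : nat)
    (x : nat -> 'cV[scalarField R F]_m) (xt : 'cV[scalarField R F]_m) : Prop :=
  exists C theta : R, [/\ 0 <= C, 0 < theta < 1 &
    forall k, norm2 (x k - xt) <= C * theta ^+ k].

(* Main.v *)
Require Import Defs.
From HB Require Import structures.
From mathcomp Require Import all_boot all_order all_algebra.
From mathcomp Require Import perm spectral.
From mathcomp Require Import complex ring lra.
From mathcomp Require Import all_classical all_reals all_analysis.

Set Implicit Arguments.
Unset Strict Implicit.
Unset Printing Implicit Defensive.

Import Order.TTheory GRing.Theory Num.Theory.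
Import numFieldNormedType.Exports.

Local Open Scope classical_set_scope.
Local Open Scope ring_scope.

(* The iteration is a perturbed Gauss-Newton method. Let [A] be the Jacobian at
   [(xs, ys)], of rank [r]. For [J] near [A] the matrix [G = J_{rank-r}^+] is an
   outer inverse of [J] with [G J] and [J G] Hermitian; these identities alone
   make [G] Lipschitz in [J]. As [G (1 - J G) = 0], a step sends the residual to
   a second order quantity plus a change of [G] times the small residual, so
   consecutive steps shrink by a factor 2 and the iterates converge.

   For the error, straighten the zero set by
   [x |-> (1 - A^+ A) (x - xs) + A^+ f (x, ys)], whose derivative at [xs] is the
   identity. Semiregularity makes the dimension of the zero set that of the
   kernel of [A], so the zeros fill the whole fibre [A^+ f (x, ys) = 0], and near
   each limit [xt] there is a zero [xh] on the same branch with
   [(1 - A^+ A) (xt - xh) = 0]. Then [xt - xh = A^+ A (xt - xh)] is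
   [O(|yt - ys|)]. Since [h] may be chosen close to [1], the factor [8 / (1 - h)]
   absorbs the constant, the two operator norms being positive; so [M = 0] is
   enough.

   Over the complex numbers the second order estimates follow from a Cauchy
   estimate, proved with discrete contour sums and Goursat's subdivision. The
   parametrization of the zero set is only differentiable, with full rank at a
   point, so the local surjectivity comes from the Poincare-Miranda theorem,
   proved by a cup product of cochains over [F_2] on a cubical grid. *)

(** Three obstacles shape the details. The singular vectors behind [rank_proj] need not vary
    continuously with the matrix, so no argument follows them; only bounds on singular values and
    the products [G J] and [J G] are used. The parametrization in the definition of dimension is
    differentiable but perhaps not C^1, so its rank may drop arbitrarily close to the base point,
    and it cannot itself show that nearby zeros are semiregular or in the same branch. Once its
    image is known to be large enough, it is replaced by a second chart, the inverse of the
    straightening map on the kernel, whose derivative has full rank on its whole domain. Finally,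
    holomorphy provides only pointwise complex differentiability; both notions of smoothness are
    therefore reduced to Lipschitz continuity of the first partial derivatives near the base point,
    after which the two fields are treated alike. Since dimensional constants are harmless, all
    estimates use an entrywise norm, and the Euclidean norms enter only at the end. *)

(** * Scalars of both fields: modulus, conjugation, embedding of the reals *)

Section Scalars.
Variables (R : realType) (F : ground).
Local Notation K := (scalarField R F).
Local Notation md := (@modulus R F).
Local Notation ofr := (@of_real R F).
Local Notation cjF := (@cj R F).

Lemma normr_modulus (x : K) : `|x| = ofr (md x).
Proof. by case: F x => //= x; rewrite RRe_real // ger0_real. Qed.

Lemma of_realD : {morph ofr : a b / a + b}.
Proof. by case: F => //= a b; rewrite rmorphD. Qed.
Lemma of_realB : {morph ofr : a b / a - b}.
Proof. by case: F => //= a b; rewrite rmorphB. Qed.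
Lemma of_realM : {morph ofr : a b / a * b}.
Proof. by case: F => //= a b; rewrite rmorphM. Qed.
Lemma of_real1 : ofr 1 = 1.
Proof. by case: F. Qed.
Lemma of_real0 : ofr 0 = 0.
Proof. by case: F. Qed.

Lemma ler_of_real a b : (ofr a <= ofr b) = (a <= b).
Proof. by case: F => //=; rewrite lecR. Qed.
Lemma ltr_of_real a b : (ofr a < ofr b) = (a < b).
Proof. by case: F => //=; rewrite ltcR. Qed.
Lemma of_real_inj : injective ofr.
Proof. by case: F => //= a b []. Qed.

Lemma of_real_exists (e : K) : 0 <= e -> exists2 a : R, 0 <= a & e = ofr a.
Proof.
case: F e => /= e e0; first by exists e.
exists (complex.Re e); last by rewrite RRe_real // ger0_real.
by rewrite -lecR RRe_real // ger0_real.
Qed.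

Lemma modulus_ge0 x : 0 <= md x.
Proof. by rewrite -ler_of_real -normr_modulus of_real0. Qed.

Lemma modulus_eq0 x : (md x == 0) = (x == 0).
Proof. by rewrite -(inj_eq of_real_inj) -normr_modulus of_real0 normr_eq0. Qed.

Lemma modulusM x y : md (x * y) = md x * md y.
Proof. by apply: of_real_inj; rewrite of_realM -!normr_modulus normrM. Qed.

Lemma modulus_le_add x y : md (x + y) <= md x + md y.
Proof. by rewrite -ler_of_real of_realD -!normr_modulus ler_normD. Qed.

Lemma modulus0 : md 0 = 0.
Proof. by apply/eqP; rewrite modulus_eq0. Qed.
Lemma modulus1 : md 1 = 1.
Proof. by apply: of_real_inj; rewrite of_real1 -normr_modulus normr1. Qed.
Lemma modulusN x : md (- x) = md x.
Proof. by apply: of_real_inj; rewrite -!normr_modulus normrN. Qed.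
Lemma modulus_of_real a : md (ofr a) = `|a|.
Proof.
apply: of_real_inj; rewrite -normr_modulus.
have [a0|/ltW a0] := lerP 0 a.
  have b0 : 0 <= ofr a by rewrite -of_real0 ler_of_real.
  by rewrite (ger0_norm b0) (ger0_norm a0).
have b0 : ofr a <= 0 by rewrite -of_real0 ler_of_real.
by rewrite (ler0_norm b0) (ler0_norm a0) -[in RHS]sub0r of_realB of_real0 sub0r.
Qed.
Lemma modulus_sum I (r : seq I) (P : pred I) (f : I -> K) :
  md (\sum_(i <- r | P i) f i) <= \sum_(i <- r | P i) md (f i).
Proof.
elim/big_ind2 : _ => [|x a y b xa yb|//]; first by rewrite modulus0.
by apply: le_trans (modulus_le_add _ _) _; apply: lerD.
Qed.
Lemma modulusV x : md x^-1 = (md x)^-1.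
Proof.
have [->|x0] := eqVneq x 0; first by rewrite invr0 modulus0 invr0.
have mx0 : md x != 0 by rewrite modulus_eq0.
by apply: (mulfI mx0); rewrite -modulusM !divff // modulus1.
Qed.

Lemma cjM : {morph cjF : x y / x * y}.
Proof. by case: F => //= x y; rewrite rmorphM. Qed.
Lemma cjB : {morph cjF : x y / x - y}.
Proof. by case: F => //= x y; rewrite rmorphB. Qed.
Lemma cj1 : cjF 1 = 1.
Proof. by case: F => //=; rewrite /conjc /= oppr0. Qed.
HB.instance Definition _ := GRing.isZmodMorphism.Build K K cjF cjB.
HB.instance Definition _ := GRing.isMonoidMorphism.Build K K cjF (conj cj1 cjM).

Lemma cjK : involutive cjF.
Proof. by case: F => //= x; rewrite conjcK. Qed.

Lemma cj_of_real a : cjF (ofr a) = ofr a.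
Proof. by case: F => //=; rewrite /conjc /= oppr0. Qed.

Lemma modulus_sqr x : ofr (md x ^+ 2) = cjF x * x.
Proof.
case: F x => /= x; first by rewrite real_normK ?num_real // expr2.
rewrite mulrC -sqr_normc -[in RHS](RRe_real (ger0_real (normr_ge0 x))).
by rewrite -rmorphXn.
Qed.

Lemma modulus_cj x : md (cjF x) = md x.
Proof.
apply/eqP; rewrite -(@eqrXn2 _ 2) ?modulus_ge0 //.
by rewrite -(inj_eq of_real_inj) !modulus_sqr cjK mulrC.
Qed.

End Scalars.

(** * Entrywise norms and differentiability *)

Section Nrm.
Variables (R : realType) (F : ground).
Local Notation K := (scalarField R F).
Local Notation md := (@modulus R F).
Local Notation ofr := (@of_real R F).

(** The sum norm is submultiplicative with constant one for all sizes, invariant under [adj], and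
    valued in [R] over both fields. *)
Definition nrm (m n : nat) (A : 'M[K]_(m, n)) : R := \sum_i \sum_j md (A i j).

Lemma nrm_ge0 m n (A : 'M[K]_(m, n)) : 0 <= nrm A.
Proof. by do 2!apply: sumr_ge0 => ? _; apply: modulus_ge0. Qed.

Lemma nrm0 m n : nrm (0 : 'M[K]_(m, n)) = 0.
Proof. by rewrite /nrm big1 // => i _; rewrite big1 // => j _; rewrite mxE modulus0. Qed.

Lemma modulus_le_nrm m n (A : 'M[K]_(m, n)) i j : md (A i j) <= nrm A.
Proof.
rewrite /nrm (bigD1 i) //= (bigD1 j) //= -addrA lerDl addr_ge0 //.
  by apply: sumr_ge0 => ? _; apply: modulus_ge0.
by do 2!apply: sumr_ge0 => ? _; apply: modulus_ge0.
Qed.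

Lemma nrm_eq0 m n (A : 'M[K]_(m, n)) : nrm A <= 0 -> A = 0.
Proof.
move=> A0; apply/matrixP => i j; rewrite mxE; apply/eqP; rewrite -modulus_eq0.
by rewrite eq_le modulus_ge0 andbT (le_trans (modulus_le_nrm _ _ _)).
Qed.

Lemma nrm_gt0 m n (A : 'M[K]_(m, n)) : A != 0 -> 0 < nrm A.
Proof. by apply: contra_neqT; rewrite -leNgt; apply: nrm_eq0. Qed.

Lemma nrmN m n (A : 'M[K]_(m, n)) : nrm (- A) = nrm A.
Proof. by apply: eq_bigr => i _; apply: eq_bigr => j _; rewrite mxE modulusN. Qed.

Lemma nrmD m n (A B : 'M[K]_(m, n)) : nrm (A + B) <= nrm A + nrm B.
Proof.
rewrite -big_split; apply: ler_sum => i _; rewrite -big_split; apply: ler_sum => j _.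
by rewrite mxE modulus_le_add.
Qed.

Lemma nrmB m n (A B : 'M[K]_(m, n)) : nrm (A - B) <= nrm A + nrm B.
Proof. by rewrite -(nrmN B); apply: nrmD. Qed.

Lemma nrmC m n (A B : 'M[K]_(m, n)) : nrm (A - B) = nrm (B - A).
Proof. by rewrite -nrmN opprB. Qed.

Lemma nrm_tri m n (B A C : 'M[K]_(m, n)) : nrm (A - C) <= nrm (A - B) + nrm (B - C).
Proof. by apply: le_trans (nrmD _ _); rewrite addrA subrK. Qed.

Lemma nrmZ m n a (A : 'M[K]_(m, n)) : nrm (a *: A) = md a * nrm A.
Proof.
rewrite /nrm mulr_sumr; apply: eq_bigr => i _; rewrite mulr_sumr.
by apply: eq_bigr => j _; rewrite mxE modulusM.
Qed.

Lemma nrmM m n p (A : 'M[K]_(m, n)) (B : 'M[K]_(n, p)) : nrm (A *m B) <= nrm A * nrm B.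
Proof.
rewrite /nrm mulr_suml; apply: ler_sum => i _; rewrite mulr_suml.
apply: (@le_trans _ _ (\sum_k \sum_j md (A i j) * md (B j k))).
  apply: ler_sum => k _; rewrite mxE; apply: le_trans (modulus_sum _ _ _) _.
  by apply: ler_sum => j _; rewrite modulusM.
rewrite exchange_big; apply: ler_sum => j _; rewrite -mulr_sumr.
apply: ler_wpM2l; first exact: modulus_ge0.
rewrite [leRHS](bigD1 j) //= lerDl.
by do 2!apply: sumr_ge0 => ? _; apply: modulus_ge0.
Qed.

Lemma nrm_adj m n (A : 'M[K]_(m, n)) : nrm (adj A) = nrm A.
Proof.
rewrite /nrm exchange_big; apply: eq_bigr => i _; apply: eq_bigr => j _.
by rewrite !mxE modulus_cj.
Qed.

Lemma nrm_le_entries m n (A : 'M[K]_(m, n)) c :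
  (forall i j, md (A i j) <= c) -> nrm A <= (m * n)%:R * c.
Proof.
move=> Ac; apply: (@le_trans _ _ (\sum_(i < m) \sum_(j < n) c)).
  by do 2!apply: ler_sum => ? _.
by rewrite !sumr_const !card_ord mulr_natl -mulrnA mulnC.
Qed.

Lemma nrm_col m (v : 'cV[K]_m) : nrm v = \sum_i md (v i 0).
Proof. by apply: eq_bigr => i _; rewrite big_ord1. Qed.

(** The library norm lies in [K], hence in [R[i]] over the complex numbers. Comparison with an
    [R]-valued [N] lets neighborhoods, little-o and continuity be restated with real epsilons. *)
Definition norm_equiv (V : normedModType K) (N : V -> R) :=
  exists2 c : R, 0 < c & forall v, `|v| <= ofr (N v) /\ ofr (N v) <= ofr c * `|v|.

Lemma norm_equiv_modulus : norm_equiv (md : K^o -> R).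
Proof. by exists 1 => // v; rewrite of_real1 mul1r -normr_modulus. Qed.

Lemma norm_equiv_nrm m n : norm_equiv (@nrm m n : 'M[K]_(m, n) -> R).
Proof.
exists ((m * n)%:R + 1); first by rewrite ltr_wpDl.
move=> v; split.
  have := @mx_norm_neq0 K m n v.
  have [v0|v0] := eqVneq (mx_norm v) 0 => [_|/(_ isT) [[i j] /=]].
    rewrite [`|v|]v0 -[leLHS](of_real0 R F) ler_of_real; exact: nrm_ge0.
  move=> vE; have -> : `|v| = mx_norm v by [].
  by rewrite vE normr_modulus ler_of_real modulus_le_nrm.
have [b b0 vb] := of_real_exists (normr_ge0 v).
rewrite vb -of_realM ler_of_real mulrDl mul1r.
apply: le_trans (nrm_le_entries (c := b) _) _; last by rewrite lerDl.
move=> i j; rewrite -(ler_of_real F) -normr_modulus -vb.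
have -> : `|v| = mx_norm v by [].
rewrite mx_normE.
by rewrite -[leLHS]nngE num_le; apply: (@le_bigmax _ _ _ _ (fun k => `|v k.1 k.2|%:nng) (i, j)).
Qed.

Definition nrm2 (m n : nat) (p : 'cV[K]_m * 'cV[K]_n) : R := nrm p.1 + nrm p.2.

Lemma norm_equiv_nrm2 m n : norm_equiv (@nrm2 m n).
Proof.
have [c c0 cP] := norm_equiv_nrm m 1; have [d d0 dP] := norm_equiv_nrm n 1.
exists (c + d); first exact: addr_gt0.
move=> [x y]; rewrite /nrm2 /= prod_normE /=.
have [x1 x2] := cP x; have [y1 y2] := dP y.
have [a a0 xa] := of_real_exists (normr_ge0 x).
have [b b0 yb] := of_real_exists (normr_ge0 y).
move: x1 x2 y1 y2; rewrite xa yb -!of_realM !ler_of_real => x1 x2 y1 y2.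
have -> : Num.max (ofr a) (ofr b) = ofr (Num.max a b).
  by rewrite /Num.max /Order.max ltr_of_real; case: (a < b).
rewrite -of_realM !ler_of_real ge_max; split.
  by rewrite !(le_trans x1, le_trans y1) ?lerDl ?lerDr ?nrm_ge0.
rewrite mulrDl; apply: lerD.
  by apply: le_trans x2 _; rewrite ler_pM2l // le_max lexx.
by apply: le_trans y2 _; rewrite ler_pM2l // le_max lexx orbT.
Qed.

Section Equiv.
Variables (V W : normedModType K) (NV : V -> R) (NW : W -> R).
Hypotheses (eV : norm_equiv NV) (eW : norm_equiv NW).

Lemma nbhs_norm_equiv (x : V) (A : set V) :
  nbhs x A <-> exists2 e : R, 0 < e & forall y, NV (y - x) < e -> A y.
Proof.
have [c c0 cP] := eV; split.
  move=> /nbhs_normP[e /= e0 eA].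
  have [a a0 ea] := of_real_exists (ltW e0).
  move: e0; rewrite ea -[X in X < _](of_real0 R F) ltr_of_real => {}a0.
  exists a => // y ya; apply: eA => /=; rewrite ea distrC.
  by apply: le_lt_trans (cP _).1 _; rewrite ltr_of_real.
move=> [e e0 eA]; apply/nbhs_normP; exists (ofr (e / c)) => /=.
  by rewrite -[X in X < _](of_real0 R F) ltr_of_real divr_gt0.
move=> y /=; rewrite distrC => ye; apply: eA.
have [_ h] := cP (y - x); have [b b0 yb] := of_real_exists (normr_ge0 (y - x)).
move: h ye; rewrite yb -of_realM ler_of_real ltr_of_real => h.
by rewrite ltr_pdivlMr // mulrC; apply: le_lt_trans.
Qed.

Lemma littleo_norm_equiv (u : V -> W) :
  (forall eps : K, 0 < eps -> \forall h \near (0 : V), `|u h| <= eps * `|h|) <->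
  forall e : R, 0 < e -> exists2 d : R, 0 < d & forall h, NV h < d -> NW (u h) <= e * NV h.
Proof.
have [c c0 cP] := eV; have [k k0 kP] := eW; split=> [ou e e0|ou eps eps0].
  have /ou : 0 < ofr (e / k) by rewrite -[X in X < _](of_real0 R F) ltr_of_real divr_gt0.
  move=> /nbhs_norm_equiv[d d0 dP]; exists d => // h hd.
  have := dP h; rewrite subr0 => /(_ hd) => uh.
  have [_ h1] := kP (u h); have [h2 _] := cP h.
  have [a a0 ha] := of_real_exists (normr_ge0 h).
  have [b b0 ub] := of_real_exists (normr_ge0 (u h)).
  move: uh h1 h2; rewrite ub ha -!of_realM !ler_of_real => uh h1 h2.
  apply: le_trans h1 _; rewrite -ler_pdivlMl //; apply: le_trans uh _.
  rewrite mulrAC mulrC; apply: ler_wpM2l; first by rewrite invr_ge0 ltW.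
  by rewrite ler_pM2l.
have [e e0 ee] := of_real_exists (ltW eps0).
move: eps0; rewrite ee -[X in X < _](of_real0 R F) ltr_of_real => {}e0.
have /ou[d d0 dP] : 0 < e / c by rewrite divr_gt0.
apply/nbhs_norm_equiv; exists d => // h; rewrite subr0 => hd.
have := dP h hd => uh.
have [h1 _] := kP (u h); have [_ h2] := cP h.
have [a a0 ha] := of_real_exists (normr_ge0 h).
have [b b0 ub] := of_real_exists (normr_ge0 (u h)).
move: h1 h2; rewrite ub ha -!of_realM !ler_of_real => h1 h2.
apply: le_trans h1 _; apply: le_trans uh _.
by rewrite mulrAC -mulrA ler_pM2l // ler_pdivrMr // mulrC.
Qed.

Lemma differentiable_eps (f : V -> W) (p : V) : differentiable f p ->
  forall e : R, 0 < e -> exists2 d : R, 0 < d &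
    forall h, NV h < d -> NW (f (h + p) - f p - 'd f p h) <= e * NV h.
Proof.
move=> /diff_locally /eqaddoP fo.
apply/(littleo_norm_equiv (fun h => f (h + p) - f p - 'd f p h)) => eps eps0.
have /= := fo eps eps0; apply: filterS => h; congr (_ <= _).
by rewrite opprD addrA.
Qed.

Lemma eps_differentiable (f : V -> W) (p : V) (df : {linear V -> W}) :
  continuous df ->
  (forall e : R, 0 < e -> exists2 d : R, 0 < d &
    forall h, NV h < d -> NW (f (h + p) - f p - df h) <= e * NV h) ->
  differentiable f p /\ 'd f p = df :> (V -> W).
Proof.
move=> dfc /(littleo_norm_equiv (fun h => f (h + p) - f p - df h)) fo.
have fE : f \o shift p = cst (f p) + df +o_ 0 id.
  apply/eqaddoP => eps eps0; have := fo eps eps0.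
  by apply: filterS => h; congr (_ <= _); rewrite opprD addrA.
have dE := diff_unique dfc fE; split=> //.
apply/diff_locallyP; split; first by rewrite dE.
by rewrite dE.
Qed.

End Equiv.

Lemma continuous_norm_equiv (V W : normedModType K) (NV : V -> R) (NW : W -> R)
    (f : V -> W) (p : V) : norm_equiv NV -> norm_equiv NW ->
  {for p, continuous f} <->
  forall e : R, 0 < e -> exists2 d : R, 0 < d &
    forall q, NV (q - p) < d -> NW (f q - f p) < e.
Proof.
move=> eV eW; split=> [fc e e0|fc A /(nbhs_norm_equiv eW)[e e0 eA]].
  have /fc/(nbhs_norm_equiv eV)[d d0 dP] : nbhs (f p) [set w | NW (w - f p) < e].
    by apply/(nbhs_norm_equiv eW); exists e.
  by exists d.
have [d d0 dP] := fc e e0.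
by apply/(nbhs_norm_equiv eV); exists d => // q /dP; apply: eA.
Qed.

End Nrm.

(** * Real analysis: nested intervals, geometric convergence, a mean value inequality *)

Section RealFacts.
Variable R : realType.

Lemma nested_intervals (lo hi : nat -> R) : (forall i j, lo i <= hi j) ->
  exists l, forall k, lo k <= l <= hi k.
Proof.
move=> lohi; exists (sup [set lo k | k in setT]) => k; apply/andP; split.
  apply: ub_le_sup; last by exists k.
  by exists (hi 0%N) => _ [i _ <-].
apply: ge_sup; first by exists (lo 0%N), 0%N.
by move=> _ [i _ <-].
Qed.

Lemma expr_small (q C e : R) : 0 <= q < 1 -> 0 < e -> exists n, C * q ^+ n < e.
Proof.
move=> /andP[q0 q1] e0.
have /cvgrPdist_lt /= : (GRing.exp q : R ^nat) @ \oo --> 0.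
  by apply: cvg_expr; rewrite ger0_norm.
have c0 : 0 < `|C| + 1 by rewrite ltr_wpDl.
move=> /(_ (e / (`|C| + 1))) /(_ (divr_gt0 e0 c0))[N _ /(_ N (leqnn N))].
rewrite /= sub0r normrN ger0_norm ?exprn_ge0 // ltr_pdivlMr // => qe.
exists N; apply: le_lt_trans qe; rewrite mulrC; apply: ler_wpM2l; first exact: exprn_ge0.
by apply: le_trans (ler_norm _) _; rewrite lerDl.
Qed.

(** The radius [r k] is the tail of the geometric series, so the intervals of radius [r k] around
    [a k] are nested, and their common point is the limit. *)
Lemma geometric_cvg_real (a : nat -> R) (C q : R) : 0 <= q < 1 ->
  (forall k, `|a k.+1 - a k| <= C * q ^+ k) ->
  exists l, forall k, `|a k - l| <= C * q ^+ k / (1 - q).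
Proof.
move=> /andP[q0 q1] aC.
have q1' : 0 < 1 - q by rewrite subr_gt0.
have C0 : 0 <= C by have := aC 0%N; rewrite expr0 mulr1; apply: le_trans.
pose r k := C * q ^+ k / (1 - q).
have rS k : r k - r k.+1 = C * q ^+ k by rewrite /r exprS; field; rewrite lt0r_neq0.
have r0 k : 0 <= r k by rewrite /r divr_ge0 ?mulr_ge0 ?exprn_ge0 // ltW.
have lo_le i j : (i <= j)%N -> a i - r i <= a j - r j.
  elim: j => [|j IH]; first by rewrite leqn0 => /eqP ->.
  rewrite leq_eqVlt => /predU1P[-> //|/IH ij]; apply: le_trans ij _.
  have := aC j; rewrite -rS ler_norml => /andP[+ _]; lra.
have hi_le i j : (i <= j)%N -> a j + r j <= a i + r i.
  elim: j => [|j IH]; first by rewrite leqn0 => /eqP ->.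
  rewrite leq_eqVlt => /predU1P[-> //|/IH]; apply: le_trans.
  have := aC j; rewrite -rS ler_norml => /andP[_ +]; lra.
have lohi i j : a i - r i <= a j + r j.
  have [ij|/ltnW ij] := leqP i j.
    by apply: le_trans (lo_le _ _ ij) _; have := r0 j; lra.
  by apply: le_trans (hi_le _ _ ij); have := r0 i; lra.
have [l lP] := nested_intervals lohi.
by exists l => k; rewrite ler_norml; have := lP k; rewrite -/(r k); lra.
Qed.

Lemma eps_is_derive (f : R -> R) (x d : R) :
  (forall e : R, 0 < e -> exists2 t : R, 0 < t &
     forall h : R, `|h| < t -> `|f (x + h) - f x - h * d| <= e * `|h|) ->
  is_derive x 1 f d.
Proof.
move=> fP.
suff H : (fun h => h^-1 *: ((f \o shift x) (h *: (1 : R)) - f x)) @ 0^' --> d.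
  by split; [apply/cvg_ex; exists d|apply: (cvg_lim _ H)].
apply/cvgrPdist_le => e e0; have [t t0 tP] := fP e e0.
near=> h.
have h0 : h != 0 by near: h; apply: nbhs_dnbhs_neq.
have ht : `|h| < t.
  near: h; apply: nbhs_dnbhs; apply/nbhs_normP; exists t => //= y /=.
  by rewrite sub0r normrN.
have := tP h ht; rewrite /= /GRing.scale /= mulr1 [h + x]addrC => fh.
rewrite -[d](mulKf h0) -mulrBr normrM normfV mulrC ler_pdivrMr ?normr_gt0 //.
by rewrite distrC.
Unshelve. all: by end_near. Qed.

Lemma mvt_real (f df : R -> R) (d B : R) :
  (forall t : R, 0 <= t <= 1 -> forall e : R, 0 < e -> exists2 s : R, 0 < s &
     forall h : R, `|h| < s -> `|f (t + h) - f t - h * df t| <= e * `|h|) ->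
  (forall t : R, 0 <= t <= 1 -> `|df t - d| <= B) ->
  `|f 1 - f 0 - d| <= B.
Proof.
move=> fd dB.
have fder (t : R) : 0 <= t <= 1 -> is_derive t 1 f (df t).
  by move=> t01; apply: eps_is_derive; apply: fd.
have [||c c01 ->] := @MVT_segment R f df 0 1 ler01.
- by move=> t; rewrite in_itv /= => /andP[/ltW t0 /ltW t1]; apply: fder; rewrite t0 t1.
- apply: derivable_within_continuous => t; rewrite in_itv /= => t01.
  by have [] := fder t t01.
by rewrite subr0 mulr1; apply: dB; rewrite in_itv /= in c01.
Qed.

End RealFacts.

(** * Componentwise convergence and derivatives over either field *)

Section Fder.
Variables (R : realType) (F : ground).
Local Notation K := (scalarField R F).
Local Notation md := (@modulus R F).
Local Notation ofr := (@of_real R F).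
Local Notation nrm := (@nrm R F _ _).

(* The projections [Re] and [Im] of [K], both equal to the identity over the reals. *)
Definition reim (b : bool) : K -> R :=
  match F return scalarField R F -> R with
  | RealField => id
  | ComplexField => if b then @complex.Re R else @complex.Im R
  end.

Lemma reimB b : {morph reim b : x y / x - y}.
Proof. by rewrite /reim; case: F => //= -[x1 x2] [y1 y2]; case: b. Qed.

Lemma reim_ofrM b a x : reim b (ofr a * x) = a * reim b x.
Proof. 
rewrite /reim; case: F x => //= -[x1 x2]; case: b => /=; rewrite mul0r.
  by rewrite subr0.
by rewrite addr0.
Qed.

Lemma reim_le b x : `|reim b x| <= md x.
Proof.
have := @modulus_sqr R F x; have := @modulus_ge0 R F x; move: (md x) => r.
rewrite /reim; case: F x => /= [x|[x1 x2]] r0.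
  by move/eqP; rewrite -expr2 eqf_sqr => /orP[] /eqP rx; [|rewrite -normrN]; rewrite -rx ger0_norm.
move=> [rE _].
rewrite -(@ler_pXn2r _ 2) ?nnegrE // real_normK ?num_real // rE.
case: b => /=; rewrite mulNr opprK -!expr2 ?lerDl ?lerDr; exact: sqr_ge0.
Qed.

Lemma modulus_le_reim x : md x <= `|reim true x| + `|reim false x|.
Proof.
have := @modulus_sqr R F x; have := @modulus_ge0 R F x; move: (md x) => r.
rewrite /reim; case: F x => /= [x|[x1 x2]] r0.
  move/eqP; rewrite -expr2 eqf_sqr => /orP[] /eqP rx; [|rewrite -normrN]; by rewrite -rx ger0_norm // lerDl.
move=> [rE _].
rewrite -(@ler_pXn2r _ 2) ?nnegrE ?addr_ge0 // rE mulNr opprK sqrrD !real_normK ?num_real //.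
by rewrite -!expr2 addrAC lerDl mulrn_wge0 // mulr_ge0.
Qed.

Lemma geometric_cvg_scalar (x : nat -> K) (C q : R) : 0 <= q < 1 ->
  (forall k, md (x k.+1 - x k) <= C * q ^+ k) ->
  exists l, forall k, md (x k - l) <= 2 * (C * q ^+ k / (1 - q)).
Proof.
move=> q01 xC.
have cvg b : exists l, forall k, `|reim b (x k) - l| <= C * q ^+ k / (1 - q).
  apply: geometric_cvg_real => // k; rewrite -reimB.
  exact: le_trans (reim_le _ _) (xC k).
have [l1 l1P] := cvg true; have [l2 l2P] := cvg false.
suff [l [lE1 lE2]] : exists l, reim true l = l1 /\ reim false l = l2.
  exists l => k; apply: le_trans (modulus_le_reim _) _.
  by rewrite !reimB lE1 lE2 mulr2n mulrDl mul1r lerD.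
move: {cvg xC} x l1P l2P; rewrite /reim; case: F => /= x l1P l2P; last by exists (l1 +i* l2)%C.
(* Over the reals [reim true] and [reim false] coincide, so [l1] and [l2], obtained independently,
   must be shown equal as limits of one sequence. *)
exists l1; split=> //; apply/eqP; rewrite -subr_eq0 -normr_le0 leNgt; apply/negP => e0.
have [n] := expr_small (2 * (C / (1 - q))) q01 e0.
have := l1P n; have := l2P n => h1 h2.
have : `|l1 - l2| <= `|x n - l2| + `|x n - l1|.
  by rewrite [X in _ <= _ + X]distrC [leRHS]addrC -{1}(subrK (x n) l1) -addrA ler_normD.
move: h1 h2; rewrite !mulrA; lra.
Qed.

Lemma geometric_cvg m n (x : nat -> 'M[K]_(m, n)) (C q : R) : 0 <= q < 1 ->
  (forall k, nrm (x k.+1 - x k) <= C * q ^+ k) ->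
  exists l, forall k, nrm (x k - l) <= C * q ^+ k / (1 - q).
Proof.
move=> q01 xC; have /andP[q0 q1] := q01.
have q1' : 0 < 1 - q by rewrite subr_gt0.
have C0 : 0 <= C by have := xC 0%N; rewrite expr0 mulr1; apply: le_trans; apply: nrm_ge0.
have {}cvg i j : exists l, forall k, md (x k i j - l) <= 2 * (C * q ^+ k / (1 - q)).
  apply: geometric_cvg_scalar => // k; apply: le_trans (xC k).
  by have := modulus_le_nrm (x k.+1 - x k) i j; rewrite !mxE.
pose l := \matrix_(i, j) xget 0 [set l | forall k, md (x k i j - l) <= 2 * (C * q ^+ k / (1 - q))].
exists l => k.
(* Entrywise limits give a bound with a dimensional factor. It is removed by passing through a far
   term [x N]: telescoping gives the sharp bound on [x k - x N], and the crude bound on [x N - l] is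
   arbitrarily small. *)
have xl N : nrm (x N - l) <= (m * n)%:R * (2 * (C / (1 - q))) * q ^+ N.
  rewrite -mulrA; have -> : 2 * (C / (1 - q)) * q ^+ N = 2 * (C * q ^+ N / (1 - q)) by ring.
  apply: nrm_le_entries => i j; rewrite !mxE.
  by case: xgetP => [c -> /=|/(_ _) nex]; [|have [c cP] := cvg i j; case: (nex c)].
have xx N : (k <= N)%N -> nrm (x k - x N) <= C * q ^+ k / (1 - q) - C * q ^+ N / (1 - q).
  elim: N => [|N IH]; first by rewrite leqn0 => /eqP ->; rewrite !subrr nrm0.
  rewrite leq_eqVlt => /predU1P[->|/IH kN]; first by rewrite !subrr nrm0.
  apply: le_trans (nrm_tri (x N) _ _) _.
  have := xC N; rewrite nrmC => xN; apply: le_trans (lerD kN xN) _.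
  by rewrite exprS le_eqVlt; apply/orP; left; apply/eqP; field; rewrite lt0r_neq0.
apply/ler_addgt0Pr => e e0.
have [N xNe] := expr_small ((m * n)%:R * (2 * (C / (1 - q)))) q01 e0.
have [N' kN NN'] : exists2 N', (k <= N')%N & (N <= N')%N by exists (maxn k N); rewrite ?leq_maxl ?leq_maxr.
apply: le_trans (nrm_tri (x N') _ _) _; apply: lerD.
  apply: le_trans (xx _ kN) _; rewrite gerBl divr_ge0 ?mulr_ge0 ?exprn_ge0 //; exact: ltW.
apply: le_trans (xl N') _; apply: le_trans (ltW xNe).
apply: ler_wpM2l; last by rewrite ler_wiXn2l // ltW.
by rewrite !mulr_ge0 // ?invr_ge0 ltW.
Qed.

Definition cder (g : K -> K) (z d : K) := forall e : R, 0 < e -> exists2 t : R, 0 < t &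
  forall h, md h < t -> md (g (z + h) - g z - h * d) <= e * md h.

(** The mean value theorem fails for complex values; it is applied to the real and the imaginary
    part separately, which costs the factor 2. *)
Lemma mvt_scalar (g dg : K -> K) (d : K) (B : R) :
  (forall t : R, 0 <= t <= 1 -> cder g (ofr t) (dg (ofr t))) ->
  (forall t : R, 0 <= t <= 1 -> md (dg (ofr t) - d) <= B) ->
  md (g 1 - g 0 - d) <= 2 * B.
Proof.
move=> gd dB.
have H b : `|reim b (g 1 - g 0 - d)| <= B.
  rewrite !reimB -(of_real1 R F) -(of_real0 R F).
  apply: (@mvt_real R (fun t => reim b (g (ofr t))) (fun t => reim b (dg (ofr t)))).
    move=> t t01 e e0; have [s s0 sP] := gd t t01 e e0; exists s => // h hs.
    rewrite -reim_ofrM -!reimB of_realD; apply: le_trans (reim_le _ _) _.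
    by have := sP (ofr h); rewrite modulus_of_real; apply.
  by move=> t t01; rewrite -reimB; apply: le_trans (reim_le _ _) (dB t t01).
apply: le_trans (modulus_le_reim _) _.
by rewrite mulr2n mulrDl mul1r lerD.
Qed.

Definition fder m l (g : 'cV[K]_m -> 'cV[K]_l) (x : 'cV[K]_m) (M : 'M[K]_(l, m)) :=
  forall e : R, 0 < e -> exists2 t : R, 0 < t &
  forall h, nrm h < t -> nrm (g (x + h) - g x - M *m h) <= e * nrm h.

Lemma mulmx_continuous m l (M : 'M[K]_(l, m)) :
  continuous (mulmx M : 'cV[K]_m -> 'cV[K]_l).
Proof.
move=> x; apply/(continuous_norm_equiv _ _ (norm_equiv_nrm R F _ _) (norm_equiv_nrm R F _ _)).
move=> e e0; have M0 : 0 < nrm M + 1 by rewrite ltr_wpDl // nrm_ge0.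
exists (e / (nrm M + 1)) => [|q]; first exact: divr_gt0.
rewrite ltr_pdivlMr // -mulmxBr mulrC => qx; apply: le_lt_trans (nrmM _ _) _.
by apply: le_lt_trans qx; apply: ler_wpM2r; rewrite ?nrm_ge0 // lerDl.
Qed.

Lemma fder_differentiable m l (g : 'cV[K]_m -> 'cV[K]_l) x M :
  fder g x M -> differentiable g x /\ jac g x = M.
Proof.
move=> gM.
have [||dg dgE] :=
  @eps_differentiable R F _ _ _ _ (norm_equiv_nrm R F _ _) (norm_equiv_nrm R F _ _) g x (mulmx M).
- exact: mulmx_continuous.
- by move=> e e0; have [t t0 tP] := gM e e0; exists t => // h ht; rewrite [h + x]addrC; exact: tP.
split=> //; apply/matrixP => i j; rewrite mxE deriveE //.
have -> : 'd g x (delta_mx j 0) = M *m delta_mx j (0 : 'I_1) by rewrite dgE.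
by rewrite -colE mxE.
Qed.

Lemma col_sum_delta m (h : 'cV[K]_m) : h = \sum_j h j 0 *: delta_mx j 0.
Proof. by rewrite [LHS]matrix_sum_delta; apply: eq_bigr => i _; rewrite big_ord1. Qed.

Lemma differentiable_fder m l (g : 'cV[K]_m -> 'cV[K]_l) x :
  differentiable g x -> fder g x (jac g x).
Proof.
move=> dg e e0.
have [t t0 tP] := differentiable_eps (norm_equiv_nrm R F _ _) (norm_equiv_nrm R F _ _) dg e0.
exists t => // h ht; rewrite [x + h]addrC.
suff -> : jac g x *m h = 'd g x h by exact: tP.
rewrite [in RHS](col_sum_delta h) linear_sum; apply/matrixP => i k.
rewrite ord1 mxE summxE; apply: eq_bigr => j _.
by rewrite linearZ !mxE deriveE // mulrC.
Qed.

Lemma line_cder (V : normedModType K) (N : V -> R) l (f : V -> 'cV[K]_l) (p w : V) z i :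
  norm_equiv N -> differentiable f (p + z *: w) ->
  cder (fun t => f (p + t *: w) i 0) z ('D_w f (p + z *: w) i 0).
Proof.
move=> eN df e e0; have [c c0 cP] := eN.
have [a a0 wa] := of_real_exists (normr_ge0 w).
have b0 : 0 < c * a + 1 by rewrite ltr_wpDl // mulr_ge0 // ltW.
have [t t0 tP] := differentiable_eps eN (norm_equiv_nrm R F _ _) df (divr_gt0 e0 b0).
have Nh h : N (h *: w) <= (c * a + 1) * md h.
  have [_] := cP (h *: w); rewrite normrZ wa normr_modulus -!of_realM ler_of_real.
  move/le_trans; apply; rewrite mulrDl mul1r mulrAC mulrA lerDl; exact: modulus_ge0.
exists (t / (c * a + 1)) => [|h]; first exact: divr_gt0.
rewrite ltr_pdivlMr // mulrC => ht.
have := tP (h *: w) (le_lt_trans (Nh h) ht).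
have -> : h *: w + (p + z *: w) = p + (z + h) *: w by rewrite scalerDl addrCA [h *: w + _]addrC.
move=> H; have := le_trans (modulus_le_nrm _ i 0) H.
rewrite linearZ -deriveE // !mxE => /le_trans; apply.
by rewrite -mulrA ler_pM2l // ler_pdivrMl.
Qed.

End Fder.

(** * A Cauchy estimate without integrals *)

Section Cauchy.
Variables (R : realType) (F : ground).
Local Notation C := (scalarField R F).
Local Notation md := (@modulus R F).
Local Notation ofr := (@of_real R F).
Local Notation cder := (@cder R F).
Variable I : C.
Hypothesis imu_sqr : I * I = -1.

Definition avg (n : nat) (u : R -> C) (s : R) : C :=
  ofr (s / n%:R) * \sum_(a < n) u (a%:R * (s / n%:R)).

(* A Riemann sum for the integral of [h] along the boundary of the square with
   lower left corner [z] and side [s]; opposite sides are sampled at opposite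
   points, so that it vanishes exactly on affine functions. *)
Definition contour (n : nat) (h : C -> C) (z : C) (s : R) : C :=
  avg n (fun x => h (z + ofr x) - h (z + I * ofr s + ofr x)
                  + I * (h (z + ofr s + I * ofr x) - h (z + I * ofr x))) s.

Lemma modulus_imu : md I = 1.
Proof.
apply/eqP; rewrite -(@eqrXn2 _ 2) ?modulus_ge0 // ?ler01 // expr2 -modulusM imu_sqr.
by rewrite modulusN modulus1 expr1n.
Qed.

Lemma grid_bounds n (a : 'I_n) (s : R) : 0 <= s -> 0 <= a%:R * (s / n%:R) <= s.
Proof.
move=> s0; have n0 : (0 : R) < n%:R by rewrite ltr0n (leq_ltn_trans _ (ltn_ord a)).
apply/andP; split; first by rewrite mulr_ge0 // divr_ge0.
rewrite mulrA ler_pdivrMr // mulrC ler_wpM2l // ler_nat ltnW //.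
Qed.

Lemma avgD n u v s : avg n (fun x => u x + v x) s = avg n u s + avg n v s.
Proof. by rewrite /avg big_split mulrDr. Qed.

Lemma avgMl n c u s : avg n (fun x => c * u x) s = c * avg n u s.
Proof. by rewrite /avg -mulr_sumr mulrCA. Qed.

Lemma avg_sum n m (u : 'I_m -> R -> C) s :
  avg n (fun x => \sum_(i < m) u i x) s = \sum_(i < m) avg n (u i) s.
Proof. by rewrite /avg -mulr_sumr exchange_big. Qed.

Lemma avg_le n u s B : 0 <= s -> (0 < n)%N -> (forall x, 0 <= x <= s -> md (u x) <= B) ->
  md (avg n u s) <= s * B.
Proof.
move=> s0 n0 uB; have n0' : (0 : R) < n%:R by rewrite ltr0n.
rewrite modulusM modulus_of_real ger0_norm ?divr_ge0 //.
apply: (@le_trans _ _ (s / n%:R * \sum_(a < n) B)).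
  apply: ler_wpM2l; first by rewrite divr_ge0 // ltW.
  apply: le_trans (modulus_sum _ _ _) _; apply: ler_sum => a _; apply: uB.
  exact: grid_bounds.
by rewrite sumr_const card_ord -[B *+ n]mulr_natl mulrA divfK // gt_eqF.
Qed.

Lemma avg_triple n u s : (0 < n)%N ->
  avg (3 * n) u s = avg n (fun x => \sum_(c < 3) u (c%:R * (s / 3) + x)) (s / 3).
Proof.
move=> n0; have n0' : (n%:R : R) != 0 by rewrite pnatr_eq0 -lt0n.
have dE : s / (3 * n)%:R = s / 3 / n%:R by rewrite natrM; field.
rewrite /avg dE; congr (_ * _).
rewrite exchange_big /= -(big_mkord xpredT (fun a => u (a%:R * (s / 3 / n%:R)))).
rewrite !big_ord_recl big_ord0 addr0 !mulSn mul0n addn0.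
rewrite (big_cat_nat (n := n)) ?leq_addr //=; congr (_ + _).
  by rewrite big_mkord; apply: eq_bigr => a _; rewrite mul0r add0r.
rewrite (big_cat_nat (n := (n + n)%N)) ?leq_add2l ?leq_addr //=; congr (_ + _).
  rewrite -{1}(add0n n) big_addn addnK big_mkord; apply: eq_bigr => a _; congr u.
  by rewrite natrD /bump /=; field.
rewrite -{1}(add0n (n + n)%N) big_addn addnA -addnA addnK big_mkord; apply: eq_bigr => a _; congr u.
by rewrite !natrD /bump /=; field.
Qed.

(** The [3 * n] sample points of an edge are exactly the [n] sample points of its three thirds, and
    every inner edge occurs twice with opposite signs. Nine parts rather than four: a singularity at
    the centre of the square then lies in the interior of the middle part. *)
Lemma contour_triple n h z s : (0 < n)%N ->
  contour (3 * n) h z s =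
  \sum_(a < 3) \sum_(b < 3)
    contour n h (z + ofr (a%:R * (s / 3)) + I * ofr (b%:R * (s / 3))) (s / 3).
Proof.
move=> n0; rewrite /contour avg_triple //.
set t := s / 3; have sE : s = t + t + t by rewrite /t; field.
clearbody t.
transitivity (avg n (fun x => \sum_(a < 3) \sum_(b < 3)
   (h (z + ofr (a%:R * t) + I * ofr (b%:R * t) + ofr x) -
    h (z + ofr (a%:R * t) + I * ofr (b%:R * t) + I * ofr t + ofr x)
    + I * (h (z + ofr (a%:R * t) + I * ofr (b%:R * t) + ofr t + I * ofr x) -
    h (z + ofr (a%:R * t) + I * ofr (b%:R * t) + I * ofr x)))) t).
  congr (_ * _); apply: eq_bigr => i _; move: (_ * (t / _)) => x.
  pose p a b := z + ofr (a%:R * t) + I * ofr (b%:R * t).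
  pose H a b := h (p a b + ofr x); pose V a b := h (p a b + I * ofr x).
  transitivity (\sum_(c < 3) (H c 0%N - H c 3%N + I * (V 3%N c - V 0%N c))).
    apply: eq_bigr => c _; rewrite /H /V /p !of_realD !of_realM sE !of_realD.
    rewrite of_real0 of_real1.
    congr (h _ - h _ + I * (h _ - h _)); ring.
  transitivity (\sum_(a < 3) \sum_(b < 3) (H a b - H a b.+1 + I * (V a.+1 b - V a b))).
    by rewrite !big_ord_recl !big_ord0 /= /bump /= !add1n; ring.
  apply: eq_bigr => a _; apply: eq_bigr => b _; rewrite /H /V /p.
  have S k : ofr (k.+1%:R * t) = ofr (k%:R * t) + ofr t.
    by rewrite -natr1 mulrDl mul1r of_realD.
  rewrite !S; congr (h _ - h _ + I * (h _ - h _)); ring.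
transitivity (\sum_(a < 3) avg n (fun x => \sum_(b < 3)
   (h (z + ofr (a%:R * t) + I * ofr (b%:R * t) + ofr x) -
    h (z + ofr (a%:R * t) + I * ofr (b%:R * t) + I * ofr t + ofr x)
    + I * (h (z + ofr (a%:R * t) + I * ofr (b%:R * t) + ofr t + I * ofr x) -
    h (z + ofr (a%:R * t) + I * ofr (b%:R * t) + I * ofr x)))) t).
  by rewrite -avg_sum.
by apply: eq_bigr => a _; rewrite -avg_sum.
Qed.

Lemma contourD n h k z s : contour n (fun w => h w + k w) z s = contour n h z s + contour n k z s.
Proof. by rewrite /contour -avgD; congr avg; apply/funext => x; ring. Qed.

Lemma contourMl n c h z s : contour n (fun w => c * h w) z s = c * contour n h z s.
Proof. by rewrite /contour -avgMl; congr avg; apply/funext => x; ring. Qed.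

Lemma contour_affine n a b z s : contour n (fun w => a + b * w) z s = 0.
Proof.
rewrite /contour (_ : (fun x => _) = fun=> b * (ofr s * (- I - (- I)))).
  by rewrite subrr !mulr0 /avg big1 ?mulr0.
by apply/funext => x; ring.
Qed.

Lemma contour_le n h z s B : 0 <= s -> (0 < n)%N ->
  (forall x, 0 <= x <= s -> [/\ md (h (z + ofr x)) <= B, md (h (z + I * ofr s + ofr x)) <= B,
     md (h (z + ofr s + I * ofr x)) <= B & md (h (z + I * ofr x)) <= B]) ->
  md (contour n h z s) <= s * (4 * B).
Proof.
move=> s0 n0 hB; apply: avg_le => // x /hB[h1 h2 h3 h4].
apply: le_trans (modulus_le_add _ _) _; rewrite modulusM modulus_imu mul1r.
have mB u v : md u <= B -> md v <= B -> md (u - v) <= B + B.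
  by move=> uB vB; apply: le_trans (modulus_le_add _ _) _; rewrite modulusN lerD.
have := mB _ _ h1 h2; have := mB _ _ h3 h4; lra.
Qed.

Definition square (z : C) (s : R) : set C :=
  [set w | exists x y, [/\ 0 <= x <= s, 0 <= y <= s & w = z + ofr x + I * ofr y]].

(** Subtracting the affine approximation of [h] at [w], whose contour sum vanishes, leaves a
    remainder of at most [e * (2 * s)] on a boundary of length [4 * s]. *)
Lemma contour_small (h : C -> C) (w d : C) (e : R) : cder h w d -> 0 < e ->
  exists2 t : R, 0 < t & forall n z s, (0 < n)%N -> 0 <= s -> 2 * s < t -> square z s w ->
    md (contour n h z s) <= 8 * e * s ^+ 2.
Proof.
move=> hd e0; have [t t0 tP] := hd e e0; exists t => // n z s n0 s0 st zw.
pose r v := h v - (h w - w * d + d * v).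
have -> : contour n h z s = contour n r z s.
  rewrite -[LHS]subr0 -(contour_affine n (h w - w * d) d z s) -mulN1r -contourMl -contourD.
  by congr contour; apply/funext => v; rewrite mulN1r.
have rB v : square z s v -> md (r v) <= e * (2 * s).
  move=> [x [y [x01 y01 vE]]]; have [x' [y' [x01' y01' wE]]] := zw.
  have vw : md (v - w) <= 2 * s.
    have -> : v - w = ofr (x - x') + I * ofr (y - y').
      by rewrite vE wE !of_realB; ring.
    apply: le_trans (modulus_le_add _ _) _.
    rewrite modulusM modulus_imu mul1r !modulus_of_real mulr2n mulrDl mul1r; apply: lerD.
      by rewrite ler_norml; apply/andP; split; lra.
    by rewrite ler_norml; apply/andP; split; lra.
  have := tP (v - w) (le_lt_trans vw st).
  have -> : h (w + (v - w)) - h w - (v - w) * d = r v by rewrite addrCA subrr addr0 /r; ring.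
  by move/le_trans; apply; rewrite ler_pM2l.
apply: le_trans (contour_le (B := e * (2 * s)) s0 n0 _) _ => [x x01|]; last by rewrite le_eqVlt;
  apply/predU1P; left; ring.
have s00 : (0 : R) <= 0 <= s by rewrite lexx.
have sss : (0 : R) <= s <= s by rewrite s0 lexx.
split; apply: rB.
- by exists x, 0; split=> //; rewrite of_real0 mulr0 addr0.
- by exists x, s; split=> //; rewrite addrAC.
- by exists s, x.
- by exists 0, x; split=> //; rewrite of_real0 addr0.
Qed.

(** A tolerance replaces the limit 0, and only powers of 3 are taken as numbers of samples, so that
    the grids are compatible with repeated trisection. *)
Definition vanishing (h : C -> C) (z : C) (s eta : R) :=
  exists N0, forall N, (N0 <= N)%N -> md (contour (3 ^ N) h z s) <= eta.

Lemma vanishing_triple h z s (eta : 'I_3 -> 'I_3 -> R) :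
  (forall a b : 'I_3,
    vanishing h (z + ofr (a%:R * (s / 3)) + I * ofr (b%:R * (s / 3))) (s / 3) (eta a b)) ->
  vanishing h z s (\sum_a \sum_b eta a b).
Proof.
move=> hv.
have /choice[N0 N0P] : forall ab : 'I_3 * 'I_3, exists N0, forall N, (N0 <= N)%N ->
    md (contour (3 ^ N) h (z + ofr (ab.1%:R * (s / 3)) + I * ofr (ab.2%:R * (s / 3))) (s / 3)) <= eta ab.1 ab.2.
  by move=> [a b]; apply: hv.
exists (\max_ab N0 ab).+1 => -[//|N] NN; rewrite expnS contour_triple ?expn_gt0 //.
apply: le_trans (modulus_sum _ _ _) _; apply: ler_sum => a _.
apply: le_trans (modulus_sum _ _ _) _; apply: ler_sum => b _.
exact: (N0P (a, b) _ (leq_trans (leq_bigmax _) (NN : (_ <= N)%N))).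
Qed.

(* Goursat's argument: a square on which the contour sums do not tend to [0]
   has such a square among its nine parts, and so on; a point common to these
   nested squares contradicts [contour_small]. *)
Lemma goursat h z s eta : 0 < s -> 0 < eta ->
  (forall w, square z s w -> exists d, cder h w d) -> vanishing h z s eta.
Proof.
move=> s0 eta0 hd; apply: contrapT => nv.
(* The tolerance shrinks with the area, so failure on a square forces failure on one of its nine
   parts. *)
pose sj j : R := s / 3 ^+ j; pose ej j : R := eta / 9 ^+ j.
pose bad (p : R * R) j := ~ vanishing h (z + ofr p.1 + I * ofr p.2) (sj j) (ej j).
have sjS j : sj j / 3 = sj j.+1 by rewrite /sj exprS; field; rewrite expf_neq0.
have sj0 j : 0 < sj j by rewrite divr_gt0 ?exprn_gt0.
have step (q : (R * R) * nat) : exists p' : R * R, bad q.1 q.2 -> bad p' q.2.+1 /\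
    exists a b : 'I_3, p' = (q.1.1 + a%:R * sj q.2.+1, q.1.2 + b%:R * sj q.2.+1).
  case: q => [p j] /=; have [pbad|/contrapT pgood] := pselect (bad p j); last by exists p.
  suff [a [b ab]] : exists a b : 'I_3, bad (p.1 + a%:R * sj j.+1, p.2 + b%:R * sj j.+1) j.+1.
    by exists (p.1 + a%:R * sj j.+1, p.2 + b%:R * sj j.+1) => _; split=> //; exists a, b.
  apply: contrapT => nbad; apply: pbad.
  have -> : ej j = \sum_(a < 3) \sum_(b < 3) ej j.+1.
    by rewrite !sumr_const !card_ord /ej exprS; field; rewrite expf_neq0.
  apply: vanishing_triple => a b; apply: contrapT => ab; apply: nbad; exists a, b.
  move: ab; rewrite /bad /= -sjS; congr (~ vanishing h _ _ _).
  by rewrite !of_realD; ring.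
have [next nextP] := choice step.
pose ps := fix ps j := if j is j'.+1 then next (ps j', j') else (0 : R, 0 : R).
have psbad j : bad (ps j) j.
  elim: j => [|j IH]; last by have [] := nextP (ps j, j) IH.
  by rewrite /bad /= of_real0 mulr0 !addr0 /sj /ej !expr0 !divr1; exact: nv.
have psS j : exists a b : 'I_3, ps j.+1 = ((ps j).1 + a%:R * sj j.+1, (ps j).2 + b%:R * sj j.+1).
  by have [_] := nextP (ps j, j) (psbad j).
have nest (X : nat -> R) : (forall j, exists a : 'I_3, X j.+1 = X j + a%:R * sj j.+1) ->
    exists x, forall j, X j <= x <= X j + sj j.
  move=> XS; apply: nested_intervals => i j.
  have XS' k : X k <= X k.+1 /\ X k.+1 + sj k.+1 <= X k + sj k.
    have [a ->] := XS k; split; first by rewrite lerDl mulr_ge0 // ltW.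
    rewrite -addrA lerD2l -sjS; have : (a%:R : R) <= 2 by rewrite ler_nat -ltnS.
    have := sj0 k => sk a2;
      have : a%:R * (sj k / 3) <= 2 * (sj k / 3) by rewrite ler_wpM2r // divr_ge0 // ltW.
    by lra.
  have lo i' j' : (i' <= j')%N -> X i' <= X j'.
    by apply: (@homo_leq _ X (fun x y => x <= y)) => // [y x w|k]; [apply: le_trans|have [] := XS' k].
  have hi i' j' : (i' <= j')%N -> X j' + sj j' <= X i' + sj i'.
    by apply: (@homo_leq _ (fun k => X k + sj k) (fun x y => y <= x)) => // [y x w xy yw|k];
      [apply: le_trans yw xy|have [] := XS' k].
  have [ij|/ltnW ij] := leqP i j.
    by apply: le_trans (lo _ _ ij) _; rewrite lerDl ltW.
  by apply: le_trans (hi _ _ ij); rewrite lerDl ltW.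
have [|x xP] := nest (fun j => (ps j).1); first by move=> j; have [a [b ->]] := psS j; exists a.
have [|y yP] := nest (fun j => (ps j).2); first by move=> j; have [a [b ->]] := psS j; exists b.
pose w := z + ofr x + I * ofr y.
have wj j : square (z + ofr (ps j).1 + I * ofr (ps j).2) (sj j) w.
  have := xP j; have := yP j => yj xj.
  exists (x - (ps j).1), (y - (ps j).2); split; try by apply/andP; split; lra.
  by rewrite /w !of_realB; ring.
have [|d wd] := hd w.
  by have := wj 0%N; rewrite /= of_real0 mulr0 !addr0 /sj expr0 divr1.
have s20 : 0 < s ^+ 2 by rewrite exprn_gt0.
(* With this error rate [contour_small] bounds the sum over the [j]-th square by half of [ej j]. *)
have e0 : 0 < eta / (16 * s ^+ 2) by rewrite divr_gt0 // mulr_gt0.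
have [t t0 tP] := contour_small wd e0.
have q01 : 0 <= (3^-1 : R) < 1 by rewrite invr_ge0 ler0n invf_lt1 // ltr1n.
have [j jt] := expr_small (2 * s) q01 t0.
apply: (psbad j); exists 0%N => N _.
have := tP (3 ^ N)%N _ (sj j) _ (ltW (sj0 j)) _ (wj j).
rewrite expn_gt0 => /(_ isT) H; apply: le_trans (H _) _.
  by rewrite /sj mulrA -exprVn.
have -> : 8 * (eta / (16 * s ^+ 2)) * sj j ^+ 2 = ej j / 2.
  have E9 : (9 : R) = 3 ^+ 2 by ring.
  have -> : ej j = eta / (3 ^+ j) ^+ 2 by rewrite /ej E9 -!exprM mulnC.
  by rewrite /sj; field; rewrite expf_neq0 //= gt_eqF.
have : 0 < ej j by rewrite divr_gt0 // exprn_gt0.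
lra.
Qed.

Lemma cder_derivable (g : C -> C) w :
  (exists d, cder g w d) <-> derivable (g : C^o -> C^o) w 1.
Proof.
split=> [[d gd]|/derivable1_diffP dg].
  apply/derivable1_diffP.
  pose sc (h : C^o) : C^o := h *: (d : C^o).
  have sc_lin : linear sc by move=> ? ? ?; rewrite /sc scalerDl scalerA.
  pose scM := GRing.isLinear.Build _ _ _ _ _ sc_lin.
  pose scL : {linear C^o -> C^o} := HB.pack sc scM.
  have [||//] :=
    @eps_differentiable R F C^o C^o _ _ (norm_equiv_modulus R F) (norm_equiv_modulus R F) g w scL.
    exact: scalel_continuous.
  by move=> e e0; have [t t0 tP] := gd e e0; exists t => // h ht; rewrite [h + w]addrC; exact: tP.
exists ('d (g : C^o -> C^o) w 1) => e e0.
have [t t0 tP] := differentiable_eps (norm_equiv_modulus R F) (norm_equiv_modulus R F) dg e0.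
exists t => // h ht; have := tP h ht; rewrite [h + w]addrC.
by have -> : 'd (g : C^o -> C^o) w h = h * 'd (g : C^o -> C^o) w 1
  by rewrite -[in LHS](mulr1 h) -[h * 1]/(h *: (1 : C^o)) linearZ.
Qed.

Lemma norm_sq_inv (a b : R) : 0 < a ^+ 2 + b ^+ 2 ->
  (ofr a + I * ofr b)^-1 = (ofr a - I * ofr b) * ofr (a ^+ 2 + b ^+ 2)^-1.
Proof.
move=> ab; apply: mulr1_eq.
have -> : (ofr a + I * ofr b) * ((ofr a - I * ofr b) * ofr (a ^+ 2 + b ^+ 2)^-1) =
  (ofr a * ofr a - (I * I) * (ofr b * ofr b)) * ofr (a ^+ 2 + b ^+ 2)^-1 by ring.
rewrite imu_sqr mulN1r opprK -!of_realM -of_realD -!expr2 -of_realM divff ?of_real1 //.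
by rewrite gt_eqF.
Qed.

(** The four edge terms add up to [I] times a real number of at least [2 / rho], averaged over a
    side of length [2 * rho]. The exact integral has modulus 2 pi; the bound 4 holds for every
    number of samples. *)
Lemma contour_inv n (rho : R) : (0 < n)%N -> 0 < rho ->
  4 <= md (contour n GRing.inv (- (ofr rho + I * ofr rho)) (2 * rho)).
Proof.
move=> n0 r0; pose u x := 4 * rho / ((x - rho) ^+ 2 + rho ^+ 2).
have p0 (x : R) : 0 < x ^+ 2 + rho ^+ 2 by rewrite ltr_wpDl ?sqr_ge0 // exprn_gt0.
have -> : contour n GRing.inv (- (ofr rho + I * ofr rho)) (2 * rho) =
    I * ofr (2 * rho / n%:R * \sum_(a < n) u (a%:R * (2 * rho / n%:R))).
  rewrite of_realM mulrCA; congr (_ * _).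
  have -> : ofr (\sum_(a < n) u (a%:R * (2 * rho / n%:R))) = \sum_(a < n) ofr (u (a%:R * (2 * rho / n%:R))).
    by apply: (big_morph ofr (@of_realD R F) (@of_real0 R F)).
  rewrite mulr_sumr; apply: eq_bigr => a _; move: (_ * (2 * rho / _)) => x.
  have E2 : 2 * rho = rho + rho by ring.
  have N (y : R) : ofr (- y) = - ofr y by rewrite -sub0r of_realB of_real0 sub0r.
  have -> : - (ofr rho + I * ofr rho) + ofr x = ofr (x - rho) + I * ofr (- rho).
    by rewrite of_realB N; ring.
  have -> : - (ofr rho + I * ofr rho) + I * ofr (2 * rho) + ofr x = ofr (x - rho) + I * ofr rho.
    by rewrite E2 of_realB of_realD; ring.
  have -> : - (ofr rho + I * ofr rho) + ofr (2 * rho) + I * ofr x = ofr rho + I * ofr (x - rho).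
    by rewrite E2 of_realB of_realD; ring.
  have -> : - (ofr rho + I * ofr rho) + I * ofr x = ofr (- rho) + I * ofr (x - rho).
    by rewrite of_realB N; ring.
  rewrite !norm_sq_inv ?sqrrN ?[rho ^+ 2 + _]addrC // /u !N.
  have -> : ofr (4 * rho / ((x - rho) ^+ 2 + rho ^+ 2)) =
     (ofr rho + ofr rho + ofr rho + ofr rho) * ofr ((x - rho) ^+ 2 + rho ^+ 2)^-1.
    by rewrite of_realM -!of_realD; congr (ofr _ * _); ring.
  by ring.
rewrite modulusM modulus_imu mul1r modulus_of_real; apply: le_trans (ler_norm _).
have n0' : (0 : R) < n%:R by rewrite ltr0n.
apply: (@le_trans _ _ (2 * rho / n%:R * \sum_(a < n) (2 / rho))).
  rewrite sumr_const card_ord -[(2 / rho) *+ n]mulr_natl le_eqVlt; apply/predU1P; left.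
  by field; rewrite !gt_eqF.
apply: ler_wpM2l; first by rewrite divr_ge0 ?mulr_ge0 // ltW.
apply: ler_sum => a _; have /grid_bounds := @mulr_ge0 _ 2 rho (ler0n _ 2) (ltW r0).
move=> /(_ n a); move: (_ * (2 * rho / _)) => x /andP[x0 x2].
rewrite /u ler_pdivlMr //.
have D : (x - rho) ^+ 2 + rho ^+ 2 <= 2 * rho ^+ 2.
  have X : 0 <= x * (2 * rho - x) by rewrite mulr_ge0 // subr_ge0.
  by rewrite -subr_ge0; suff -> : 2 * rho ^+ 2 - ((x - rho) ^+ 2 + rho ^+ 2) = x * (2 * rho - x) by [];
    ring.
apply: (@le_trans _ _ (2 / rho * (2 * rho ^+ 2))).
  by rewrite ler_wpM2l // divr_ge0 // ltW.
by rewrite le_eqVlt; apply/predU1P; left; field; rewrite gt_eqF.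
Qed.

Section Estimate.
Variables (g : C -> C) (d0 : C) (rho M : R).
Hypotheses (rho0 : 0 < rho) (g0 : cder g 0 d0).
Local Notation centred r := (square (- (ofr r + I * ofr r)) (2 * r)).
Hypothesis gd : forall w, centred rho w -> exists d, cder g w d.
Hypothesis gM : forall w, centred rho w -> md (g w - g 0) <= M.

(** The numerator is [o(w)] at 0, so the contour sum of [h] over the square of half-side [r] centred
    at 0 tends to 0 with [r]. *)
Let h w := (g w - g 0 - d0 * w) / w ^+ 2.

(** Serves as a lower bound for the modulus: on the boundary of a centred square [md w] is at least
    half of the half-side, and a point with a nonzero coordinate is nonzero. *)
Lemma norm_sq_le (a b : R) : a ^+ 2 + b ^+ 2 <= md (ofr a + I * ofr b) * (`|a| + `|b|).
Proof.
apply: (@le_trans _ _ (md ((ofr a + I * ofr b) * (ofr a - I * ofr b)))).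
  have -> : (ofr a + I * ofr b) * (ofr a - I * ofr b) = ofr (a ^+ 2 + b ^+ 2).
    rewrite of_realD !expr2 !of_realM.
    have -> : ofr b * ofr b = - (I * I) * (ofr b * ofr b) by rewrite imu_sqr opprK mul1r.
    by ring.
  by rewrite modulus_of_real ler_norm.
rewrite modulusM; apply: ler_wpM2l; first exact: modulus_ge0.
apply: le_trans (modulus_le_add _ _) _.
by rewrite modulusN modulusM modulus_imu mul1r !modulus_of_real.
Qed.

Lemma centredP r w : centred r w ->
  exists x y, [/\ -r <= x <= r, -r <= y <= r & w = ofr x + I * ofr y].
Proof.
move=> [x [y [/andP[x0 x2] /andP[y0 y2] ->]]]; exists (x - r), (y - r).
split; try (apply/andP; split; lra).
by rewrite !of_realB; ring.
Qed.

Lemma centred_intro r x y : -r <= x <= r -> -r <= y <= r -> centred r (ofr x + I * ofr y).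
Proof.
move=> /andP[x0 x2] /andP[y0 y2]; exists (x + r), (y + r).
split; try (apply/andP; split; lra).
by rewrite !of_realD; ring.
Qed.

Lemma centred_edge r x : 0 < r -> 0 <= x <= 2 * r ->
  let c := - (ofr r + I * ofr r) in let s := 2 * r in
  forall w, [\/ w = c + ofr x, w = c + I * ofr s + ofr x, w = c + ofr s + I * ofr x | w = c + I * ofr x] ->
  centred r w /\ r <= 2 * md w.
Proof.
move=> r0 /andP[x0 x2] c s w wE.
have E2 : ofr s = ofr r + ofr r by rewrite -of_realD /s; congr ofr; ring.
have N (y : R) : ofr (- y) = - ofr y by rewrite -sub0r of_realB of_real0 sub0r.
suff [a [b [ar br ab wab]]] : exists a b, [/\ -r <= a <= r, -r <= b <= r,
    r ^+ 2 <= a ^+ 2 + b ^+ 2 & w = ofr a + I * ofr b].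
  split; first by rewrite wab; apply: centred_intro.
  have := norm_sq_le a b; rewrite -wab => /(le_trans ab) H.
  rewrite -(ler_pM2l r0) -expr2; apply: le_trans H _.
  rewrite mulrC mulrA; apply: ler_wpM2r; first exact: modulus_ge0.
  by rewrite mulr2n mulrDr !mulr1 lerD // ler_norml.
have rr : -r <= r <= r by apply/andP; split; lra.
have rNr : -r <= -r <= r by apply/andP; split; lra.
have xr : -r <= x - r <= r by apply/andP; split; lra.
case: wE => ->; [exists (x - r), (- r)|exists (x - r), r|exists r, (x - r)|exists (- r), (x - r)];
  split; try exact: xr; rewrite ?sqrrN ?lerDl ?lerDr ?sqr_ge0 //; rewrite /c ?E2 ?of_realB ?N; ring.
Qed.

Lemma contour_centred_le n (k : C -> C) r B : (0 < n)%N -> 0 < r ->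
  (forall w, centred r w -> r <= 2 * md w -> md (k w) <= B) ->
  md (contour n k (- (ofr r + I * ofr r)) (2 * r)) <= 8 * r * B.
Proof.
move=> n0 r0 kB; have s0 : 0 <= 2 * r by rewrite mulr_ge0 // ltW.
apply: le_trans (contour_le (B := B) s0 n0 _) _; last by rewrite le_eqVlt; apply/predU1P; left; ring.
move=> x x2; have E := centred_edge r0 x2.
by split; apply: kB; apply: (E _ _).1 || apply: (E _ _).2;
  do ?[by constructor 1|by constructor 2|by constructor 3|by constructor 4].
Qed.

Lemma kernel_derivable w : centred rho w -> w != 0 -> exists d, cder h w d.
Proof.
move=> /gd/cder_derivable gw w0; apply/cder_derivable.
have idw : derivable (id : C^o -> C^o) w 1 by apply: derivable_id.
have cstw (c : C^o) : derivable (cst c : C^o -> C^o) w 1 by apply: derivable_cst.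
have num : derivable ((g : C^o -> C^o) - cst (g 0) - cst d0 * id) w 1.
  exact: (derivableB (derivableB gw (cstw (g 0))) (derivableM (cstw d0) idw)).
have w20 : (id ^+ 2 : C^o -> C^o) w != 0 by rewrite /GRing.exp /= mulf_neq0.
have den := derivableV w20 (derivableX (n := 2) idw).
exact: derivableM num den.
Qed.

(** The eight parts that avoid 0 are handled by [goursat], each within [eta / 9]; only the middle
    part, again centred at 0, remains. *)
Lemma contour_shrink r eta : 0 < r -> r <= rho -> 0 < eta ->
  exists N0, forall N, (N0 <= N)%N ->
    md (contour (3 ^ N.+1) h (- (ofr r + I * ofr r)) (2 * r)) <=
    eta + md (contour (3 ^ N) h (- (ofr (r / 3) + I * ofr (r / 3))) (2 * (r / 3))).
Proof.
move=> r0 rrho eta0; pose t := 2 * r / 3; have t0 : 0 < t by rewrite divr_gt0 // mulr_gt0.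
have tE : t = 2 * (r / 3) by rewrite /t mulrA.
have t3 : 3 * t = 2 * r by rewrite /t; field.
pose c (ab : 'I_3 * 'I_3) := - (ofr r + I * ofr r) + ofr (ab.1%:R * t) + I * ofr (ab.2%:R * t).
pose i1 : 'I_3 := @Ordinal 3 1 isT.
have N (y : R) : ofr (- y) = - ofr y by rewrite -sub0r of_realB of_real0 sub0r.
have /choice[N0 N0P] : forall ab : 'I_3 * 'I_3, exists N0, ab != (i1, i1) ->
    forall N, (N0 <= N)%N -> md (contour (3 ^ N) h (c ab) t) <= eta / 9.
  move=> ab; have [->|ab1] := eqVneq ab (i1, i1); first by exists 0%N.
  suff [N0 N0P] : vanishing h (c ab) t (eta / 9) by exists N0.
  apply: goursat => //; first by rewrite divr_gt0.
  move=> w [x [y [/andP[x0 xt] /andP[y0 yt] wE]]].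
  have {}wE : w = ofr (- r + ab.1%:R * t + x) + I * ofr (- r + ab.2%:R * t + y).
    by rewrite wE /c !of_realD !N; ring.
  have bnd (i : 'I_3) (u : R) : 0 <= u -> u <= t -> -r <= - r + i%:R * t + u <= r.
    move=> u0 ut; have i2 : (i%:R : R) <= 2 by rewrite ler_nat -ltnS.
    have it0 : 0 <= i%:R * t by rewrite mulr_ge0 // ltW.
    have it2 : i%:R * t <= 2 * t by rewrite ler_wpM2r // ltW.
    by apply/andP; split; lra.
  have nz (i : 'I_3) (u : R) : i != i1 -> 0 <= u -> u <= t -> - r + i%:R * t + u != 0.
    case: i => -[|[|[|//]]] //= ilt _ u0 ut.
      by rewrite lt_eqF // mul0r; lra.
    by rewrite gt_eqF //; lra.
  apply: kernel_derivable.
    rewrite wE; apply: centred_intro.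
      by have /andP[h1 h2] := bnd ab.1 x x0 xt; apply/andP; split; lra.
    by have /andP[h1 h2] := bnd ab.2 y y0 yt; apply/andP; split; lra.
  apply/eqP => w0; have := norm_sq_le (- r + ab.1%:R * t + x) (- r + ab.2%:R * t + y).
  rewrite -wE w0 modulus0 mul0r; apply/negP; rewrite -ltNge.
  case: ab ab1 {c wE} => a b /=; rewrite xpair_eqE negb_and => /orP[ai|bi].
    by rewrite ltr_pwDl ?sqr_ge0 // exprn_even_gt0 //= nz.
  by rewrite ltr_wpDl ?sqr_ge0 // exprn_even_gt0 //= nz.
exists (\max_ab N0 ab) => n Nn; rewrite expnS contour_triple ?expn_gt0 // -/t.
rewrite pair_big /= (bigD1 (i1, i1)) //= addrC.
apply: le_trans (modulus_le_add _ _) _; apply: lerD.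
  apply: le_trans (modulus_sum _ _ _) _.
  have -> : eta = \sum_(ab : 'I_3 * 'I_3) eta / 9.
    rewrite sumr_const card_prod card_ord -[(eta / 9) *+ _]mulr_natr.
    by rewrite -[(3 * 3)%N]/9%N; field.
  rewrite [leRHS](bigD1 (i1, i1)) //=; apply: le_trans (_ : _ <= \sum_(ab | ab != (i1, i1)) eta / 9) _.
    apply: ler_sum => ab ab1; apply: (N0P ab ab1).
    by apply: leq_trans Nn; apply: leq_bigmax.
  by rewrite lerDr divr_ge0 // ltW.
rewrite -tE le_eqVlt; apply/predU1P; left; congr (md (contour _ _ _ _)).
have rE : ofr r = ofr (r / 3) + ofr t by rewrite -of_realD; congr ofr; rewrite /t; field.
by rewrite mul1r rE; ring.
Qed.

(** Repeated shrinking, at a total cost of [eta / 2], leads to a square of half-side [rj j] so small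
    that [md (h w) <= eta / 16 / rj j] on its boundary; the boundary has length [8 * rj j], which
    gives the other [eta / 2]. *)
Lemma contour_kernel_small eta : 0 < eta ->
  exists N, md (contour (3 ^ N) h (- (ofr rho + I * ofr rho)) (2 * rho)) <= eta.
Proof.
move=> eta0.
have e0 : 0 < eta / 2 by rewrite divr_gt0.
pose rj j := rho / 3 ^+ j.
have rj0 j : 0 < rj j by rewrite divr_gt0 // exprn_gt0.
have rjS j : rj j / 3 = rj j.+1 by rewrite /rj exprS; field; rewrite expf_neq0.
have shrink j : forall e, 0 < e -> exists N0, forall N, (N0 <= N)%N ->
    md (contour (3 ^ (N + j)) h (- (ofr rho + I * ofr rho)) (2 * rho)) <=
    e + md (contour (3 ^ N) h (- (ofr (rj j) + I * ofr (rj j))) (2 * rj j)).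
  elim: j => [|j IH] e e1.
    by exists 0%N => N _; rewrite addn0 /rj expr0 divr1 lerDr ltW.
  have e2 : 0 < e / 2 by rewrite divr_gt0.
  have [N1 N1P] := IH _ e2.
  have rjrho : rj j <= rho.
    by rewrite /rj ler_pdivrMr ?exprn_gt0 // ler_peMr ?exprn_ege1 // ?ler1n // ltW.
  have [N2 N2P] := contour_shrink (rj0 j) rjrho e2.
  exists (maxn N1 N2) => N; rewrite geq_max => /andP[NN1 NN2].
  rewrite addnS -addSn; apply: le_trans (N1P _ (leqW NN1)) _.
  by have := N2P N NN2; rewrite rjS; lra.
have e16 : 0 < eta / 32 by rewrite divr_gt0.
have [t t0 tP] := g0 e16.
have q01 : 0 <= (3^-1 : R) < 1 by rewrite invr_ge0 ler0n invf_lt1 // ltr1n.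
have [j jt] := expr_small (2 * rho) q01 t0.
have [N0 N0P] := shrink j _ e0; exists (N0 + j)%N.
apply: le_trans (N0P _ (leqnn _)) _.
suff : md (contour (3 ^ N0) h (- (ofr (rj j) + I * ofr (rj j))) (2 * rj j)) <= eta / 2 by lra.
apply: le_trans (contour_centred_le (B := eta / 16 / rj j) _ (rj0 j) _) _.
- by rewrite expn_gt0.
- move=> w wj wr; have w0 : 0 < md w by have := rj0 j; lra.
  have wt : md w < t.
    apply: le_lt_trans jt; have [x [y [/andP[x0 x1] /andP[y0 y1] ->]]] := centredP wj.
    apply: le_trans (modulus_le_add _ _) _.
    rewrite modulusM modulus_imu mul1r !modulus_of_real exprVn -mulrA -/(rj j) mulr2n mulrDl mul1r.
    by rewrite lerD // ler_norml; apply/andP; split; lra.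
  have := tP w wt; rewrite add0r => gw.
  rewrite /h modulusM modulusV expr2 modulusM [d0 * w]mulrC ler_pdivrMr ?mulr_gt0 //.
  apply: le_trans gw _; rewrite mulrA; apply: ler_wpM2r; first exact: ltW.
  rewrite mulrAC ler_pdivlMr //; rewrite -subr_ge0.
  have -> : eta / 16 * md w - eta / 32 * rj j = eta / 32 * (2 * md w - rj j) by field.
  by rewrite mulr_ge0 ?subr_ge0 // ltW.
by rewrite le_eqVlt; apply/predU1P; left; field; rewrite gt_eqF.
Qed.

(** On the boundary [rho <= 2 * md w], so the contour sum of [(g w - g 0) / w ^+ 2] is at most
    [8 * rho * (4 * M / rho ^+ 2)]. Up to the small sum of [h] it equals [d0] times the sum of
    [1 / w], which has modulus at least 4. *)
Lemma cauchy_estimate : md d0 <= 8 * M / rho.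
Proof.
apply/ler_addgt0Pr => eta eta0; have eta4 : 0 < 4 * eta by rewrite mulr_gt0.
have [N NP] := contour_kernel_small eta4.
have n0 : (0 < 3 ^ N)%N by rewrite expn_gt0.
pose k w := (g w - g 0) / w ^+ 2.
have hE : contour (3 ^ N) h (- (ofr rho + I * ofr rho)) (2 * rho) =
  contour (3 ^ N) k (- (ofr rho + I * ofr rho)) (2 * rho) -
  d0 * contour (3 ^ N) GRing.inv (- (ofr rho + I * ofr rho)) (2 * rho).
  rewrite -mulNr -contourMl -contourD; congr contour; apply/funext => w; rewrite /h /k.
  rewrite mulrBl mulNr -mulrA; congr (_ - d0 * _).
  by have [->|w0] := eqVneq w 0; [rewrite mul0r invr0|rewrite expr2 invfM mulrA divff // mul1r].
have kB : md (contour (3 ^ N) k (- (ofr rho + I * ofr rho)) (2 * rho)) <= 32 * M / rho.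
  apply: le_trans (contour_centred_le (B := M * 4 / rho ^+ 2) n0 rho0 _) _.
    move=> w wr wrho; have w0 : 0 < md w by have := rho0; lra.
    rewrite /k modulusM modulusV; apply: (@le_trans _ _ (M / md (w ^+ 2))).
      by apply: ler_wpM2r; rewrite ?invr_ge0 ?modulus_ge0 // gM.
    have M0 : 0 <= M by apply: le_trans (modulus_ge0 _) (gM wr).
    rewrite -mulrA; apply: ler_wpM2l => //.
    rewrite expr2 modulusM -[leLHS]mul1r ler_pdivrMr ?mulr_gt0 // mulrAC ler_pdivlMr ?exprn_gt0 // mul1r.
    have := ler_pM (ltW rho0) (ltW rho0) wrho wrho; rewrite -expr2 => /le_trans; apply.
    by rewrite le_eqVlt; apply/predU1P; left; ring.
  by rewrite le_eqVlt; apply/predU1P; left; field; rewrite gt_eqF.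
have inv4 := contour_inv n0 rho0.
have dB : md d0 * 4 <= 32 * M / rho + 4 * eta.
  apply: le_trans (ler_wpM2l (modulus_ge0 _) inv4) _; rewrite -modulusM.
  have -> : d0 * contour (3 ^ N) GRing.inv (- (ofr rho + I * ofr rho)) (2 * rho) =
    contour (3 ^ N) k (- (ofr rho + I * ofr rho)) (2 * rho) -
    contour (3 ^ N) h (- (ofr rho + I * ofr rho)) (2 * rho) by rewrite hE subKr.
  by apply: le_trans (modulus_le_add _ _) _; rewrite modulusN lerD.
have -> : 8 * M / rho = 32 * M / rho / 4 by field; rewrite gt_eqF.
lra.
Qed.

End Estimate.
End Cauchy.

(** * Second order estimates for smooth mappings *)

Lemma cderB (R : realType) (F : ground) (g k : scalarField R F -> scalarField R F) z a b :
  cder g z a -> cder k z b -> cder (fun w => g w - k w) z (a - b).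
Proof.
move=> ga kb e e0; have e2 : 0 < e / 2 by rewrite divr_gt0.
have [s s0 sP] := ga _ e2; have [t t0 tP] := kb _ e2.
exists (Num.min s t) => [|h]; rewrite lt_min ?s0 // => /andP[/sP h1 /tP h2].
have -> : g (z + h) - k (z + h) - (g z - k z) - h * (a - b) =
  (g (z + h) - g z - h * a) - (k (z + h) - k z - h * b) by ring.
by apply: le_trans (modulus_le_add _ _) _; rewrite modulusN; lra.
Qed.

Lemma finite_radius (R : realType) (I : finType) (P : I -> R -> Prop) :
  (forall i r s, s <= r -> P i r -> P i s) ->
  (forall i, exists2 r : R, 0 < r & P i r) -> exists2 r : R, 0 < r & forall i, P i r.
Proof.
move=> Pm /(_ _)/cid2-/all_sig2[r r0 rP].
exists (\big[Num.min/1]_i r i); first by apply/lt_bigmin.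
by move=> i; apply: Pm (rP i); apply: bigmin_le_cond.
Qed.

Lemma term_le_sum (R : realType) (I J : finType) (a : I -> J -> R) :
  (forall i j, 0 <= a i j) -> forall i j, a i j <= \sum_i \sum_j a i j.
Proof.
move=> a0 i j; rewrite (bigD1 i) //= (bigD1 j) //= -addrA lerDl addr_ge0 //.
  by apply: sumr_ge0.
by do 2!apply: sumr_ge0 => ? _.
Qed.

Section Local.
Variables (R : realType) (F : ground).
Local Notation K := (scalarField R F).
Local Notation md := (@modulus R F).
Local Notation ofr := (@of_real R F).
Local Notation nrm := (@nrm R F _ _).
Variables (m n l : nat).
Local Notation V := ('cV[K]_m * 'cV[K]_n)%type.
Local Notation N := (@nrm2 R F m n).
Variables (D : set V) (f : V -> 'cV[K]_l) (p0 : V).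
Hypothesis D_open : open D.
Hypothesis Dp0 : D p0.

Definition unitv (b : 'I_m + 'I_n) : V :=
  match b with inl j => (delta_mx j 0, 0) | inr j => (0, delta_mx j 0) end.
Definition coefv (v : V) (b : 'I_m + 'I_n) : K :=
  match b with inl j => v.1 j 0 | inr j => v.2 j 0 end.

Lemma nrm2_ge0 v : 0 <= N v. Proof. by rewrite addr_ge0 ?nrm_ge0. Qed.
Lemma nrm2D v w : N (v + w) <= N v + N w.
Proof. by rewrite /nrm2 addrACA lerD ?nrmD. Qed.
Lemma nrm2Z c v : N (c *: v) = md c * N v.
Proof. by rewrite /nrm2 !nrmZ mulrDr. Qed.
Lemma vec_unitv v : v = \sum_b coefv v b *: unitv b.
Proof.
rewrite big_sumType /=; case: v => x y /=.
rewrite [LHS](_ : _ = (x, 0) + (0, y)); last by congr pair; rewrite ?addr0 ?add0r.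
congr (_ + _).
  rewrite [in LHS](col_sum_delta x).
  elim/big_ind2 : _ => [//|u1 [v1 v2] u2 [w1 w2] [<- <-] [<- <-]|i _] //=.
    by congr pair; rewrite addr0.
  by congr pair; rewrite scaler0.
rewrite [in LHS](col_sum_delta y).
elim/big_ind2 : _ => [//|u1 [v1 v2] u2 [w1 w2] [<- <-] [<- <-]|i _] //=.
  by congr pair; rewrite addr0.
by congr pair; rewrite scaler0.
Qed.

Lemma nrm2_coefv v : N v = \sum_b md (coefv v b).
Proof. by rewrite big_sumType /nrm2 !nrm_col. Qed.

Lemma nrm2_unitv b : N (unitv b) = 1.
Proof.
rewrite nrm2_coefv; case: b => j /=; rewrite big_sumType /=.
  rewrite [X in _ + X]big1 ?addr0 => [|i _]; last by rewrite mxE modulus0.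
  rewrite (bigD1 j) //= big1 ?addr0 => [|i ij]; first by rewrite mxE !eqxx modulus1.
  by rewrite mxE (negPf ij) modulus0.
rewrite big1 ?add0r => [|i _]; last by rewrite mxE modulus0.
rewrite (bigD1 j) //= big1 ?addr0 => [|i ij]; first by rewrite mxE !eqxx modulus1.
by rewrite mxE (negPf ij) modulus0.
Qed.

Lemma derive_unitv k (G : V -> 'cV[K]_k) p v i : differentiable G p ->
  'D_v G p i 0 = \sum_b coefv v b * 'D_(unitv b) G p i 0.
Proof.
move=> dG; rewrite deriveE // [in LHS](vec_unitv v) linear_sum summxE.
by apply: eq_bigr => b _; rewrite linearZ mxE deriveE.
Qed.

Lemma derive_unitv_le k (G : V -> 'cV[K]_k) p v i B : differentiable G p ->
  (forall b, md ('D_(unitv b) G p i 0) <= B) -> md ('D_v G p i 0) <= N v * B.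
Proof.
move=> dG GB; rewrite derive_unitv // nrm2_coefv mulr_suml.
apply: le_trans (modulus_sum _ _ _) _; apply: ler_sum => b _.
by rewrite modulusM; apply: ler_wpM2l => //; apply: modulus_ge0.
Qed.

Lemma segment_ball r p q t : N (p - p0) < r -> N (q - p0) < r -> 0 <= t <= 1 ->
  N (p + ofr t *: (q - p) - p0) < r.
Proof.
move=> pr qr /andP[t0 t1].
have -> : p + ofr t *: (q - p) - p0 = ofr (1 - t) *: (p - p0) + ofr t *: (q - p0).
  rewrite of_realB of_real1 scalerBl scale1r addrAC [RHS]addrAC -[RHS]addrA -scalerBr.
  by rewrite opprB addrA subrK addrAC.
apply: le_lt_trans (nrm2D _ _) _; rewrite !nrm2Z !modulus_of_real !ger0_norm ?subr_ge0 //.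
have [->|t_neq0] := eqVneq t 0; first by rewrite subr0 mul1r mul0r addr0.
have tp : 0 < t by rewrite lt0r t_neq0.
have h1 : t * N (q - p0) < t * r by rewrite ltr_pM2l.
have h2 : (1 - t) * N (p - p0) <= (1 - t) * r by rewrite ler_wpM2l ?subr_ge0 // ltW.
lra.
Qed.

Lemma nbhs_nrm2 (A : set V) (p : V) : nbhs p A <-> exists2 r : R, 0 < r & forall q, N (q - p) < r -> A q.
Proof. exact: nbhs_norm_equiv (norm_equiv_nrm2 R F m n) p A. Qed.

Lemma open_ball : exists2 r : R, 0 < r & forall q, N (q - p0) < r -> D q.
Proof. by apply/nbhs_nrm2; apply: open_nbhs_nbhs. Qed.

Lemma mvt_vector k (G : V -> 'cV[K]_k) (p q : V) i d B :
  (forall t : R, 0 <= t <= 1 -> differentiable G (p + ofr t *: (q - p))) ->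
  (forall t : R, 0 <= t <= 1 -> md ('D_(q - p) G (p + ofr t *: (q - p)) i 0 - d) <= B) ->
  md (G q i 0 - G p i 0 - d) <= 2 * B.
Proof.
move=> dG GB.
have -> : G q i 0 - G p i 0 - d = G (p + (1 : K) *: (q - p)) i 0 - G (p + (0 : K) *: (q - p)) i 0 - d.
  by rewrite scale1r scale0r addr0 (addrC p (q - p)) subrK.
apply: (mvt_scalar (g := fun z => G (p + z *: (q - p)) i 0)
  (dg := fun z => 'D_(q - p) G (p + z *: (q - p)) i 0)) => // t t01.
exact: line_cder (norm_equiv_nrm2 R F m n) (dG t t01).
Qed.

Definition derivative_lipschitz (r L : R) := forall (p q : V) b i,
  N (p - p0) < r -> N (q - p0) < r ->
  md ('D_(unitv b) f p i 0 - 'D_(unitv b) f q i 0) <= L * N (p - q).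

Lemma C2_derivative_lipschitz : C2_on D f ->
  exists r L, [/\ 0 < r, 0 <= L & derivative_lipschitz r L].
Proof.
move=> [df ddf cf]; have [r1 r10 r1D] := open_ball.
pose H b c i p := 'D_(unitv c) ('D_(unitv b) f) p i 0.
pose P (x : ('I_m + 'I_n) * ('I_m + 'I_n) * 'I_l) r :=
  forall p, N (p - p0) < r -> md (H x.1.1 x.1.2 x.2 p) <= md (H x.1.1 x.1.2 x.2 p0) + 1.
have [||r2 r20 r2P] := @finite_radius R _ P.
- by move=> x r s sr Pr p ps; apply: Pr; apply: lt_le_trans ps sr.
- move=> [[b c] i]; have /(continuous_norm_equiv _ _ (norm_equiv_nrm2 R F m n) (norm_equiv_nrm R F l 1)) := cf (unitv b) (unitv c) p0 Dp0.
  move=> /(_ 1 ltr01)[r r0 rP]; exists r => // p /rP pr; rewrite /H /=.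
  have := le_trans (modulus_le_nrm _ i 0) (ltW pr); rewrite !mxE => h1.
  by rewrite -[X in md X <= _](subrK ('D_(unitv c) ('D_(unitv b) f) p0 i 0)) addrC (le_trans (modulus_le_add _ _)) // lerD2l.
pose S := \sum_(x : ('I_m + 'I_n) * ('I_m + 'I_n) * 'I_l) (md (H x.1.1 x.1.2 x.2 p0) + 1).
have SH b c i : md (H b c i p0) + 1 <= S.
  rewrite /S (bigD1 (b, c, i)) //= lerDl; apply: sumr_ge0 => x _.
  by rewrite addr_ge0 // modulus_ge0.
have S0 : 0 <= S by apply: sumr_ge0 => x _; rewrite addr_ge0 // modulus_ge0.
exists (Num.min r1 r2), (2 * S); split; first by rewrite lt_min r10.
  by rewrite mulr_ge0.
move=> p q b i pr qr.
rewrite -[X in md X]subr0; have -> : 2 * S * N (p - q) = 2 * (N (p - q) * S) by ring.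
apply: (mvt_vector (G := 'D_(unitv b) f) (p := q) (q := p)) => t t01; have tr := segment_ball qr pr t01.
  by apply: ddf; apply: r1D; rewrite (lt_le_trans tr) // ge_min lexx.
rewrite subr0; apply: derive_unitv_le => [|c].
  by apply: ddf; apply: r1D; rewrite (lt_le_trans tr) // ge_min lexx.
apply: le_trans (SH b c i); apply: (r2P (b, c, i)).
by rewrite (lt_le_trans tr) // ge_min lexx orbT.
Qed.

(** The Cauchy estimate is used twice. First it bounds the partial derivatives, which makes [f]
    Lipschitz. Then it is applied to [t |-> f (p + t *: u) - f (q + t *: u)], whose variation is
    therefore of order [N (p - q)], and bounds the difference of the derivatives at [p] and [q]. *)
Lemma holomorphic_derivative_lipschitz (I : K) : I * I = -1 -> holomorphic_on D f ->
  exists r L, [/\ 0 < r, 0 <= L & derivative_lipschitz r L].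
Proof.
move=> I2 df; have [r1 r10 r1D] := open_ball.
have fc : {for p0, continuous f} by apply: differentiable_continuous; apply: df.
have := fc => /(continuous_norm_equiv _ _ (norm_equiv_nrm2 R F m n) (norm_equiv_nrm R F l 1)).
move=> /(_ 1 ltr01)[r2 r20 r2P].
(* The quarter leaves room: points of the [2 * r] ball, moved by at most [r] in a coordinate
   direction, stay in the [4 * r] ball, where [f] differs from [f p0] by at most 1. *)
pose r := Num.min r1 r2 / 4; have r0 : 0 < r by rewrite divr_gt0 // lt_min r10.
have r4 p : N (p - p0) < 4 * r -> D p /\ forall i, md (f p i 0 - f p0 i 0) <= 1.
  rewrite /r mulrC divfK // lt_min => /andP[p1 p2]; split; first exact: r1D.
  by move=> i; have := le_trans (modulus_le_nrm _ i 0) (ltW (r2P _ p2)); rewrite !mxE.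
have md_square w : square I (- (ofr (r / 2) + I * ofr (r / 2))) (2 * (r / 2)) w -> md w <= r.
  move=> /centredP[x [y [xr yr ->]]]; apply: le_trans (modulus_le_add _ _) _.
  rewrite modulusM (modulus_imu I2) mul1r !modulus_of_real.
  have -> : r = r / 2 + r / 2 by field.
  by rewrite lerD // ler_norml.
have mv p b w s : N (p - p0) < s -> md w <= r -> N (p + w *: unitv b - p0) < s + r.
  move=> ps wr; rewrite addrAC; apply: le_lt_trans (nrm2D _ _) _.
  by rewrite nrm2Z nrm2_unitv mulr1 ltr_leD.
have r2' : 0 < r / 2 by rewrite divr_gt0.
have line p b i w : N (p - p0) < 2 * r -> md w <= r ->
    cder (fun t => f (p + t *: unitv b) i 0) w ('D_(unitv b) f (p + w *: unitv b) i 0).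
  move=> pr wr; apply: line_cder (norm_equiv_nrm2 R F m n) _; apply: df.
  by have [] := r4 (p + w *: unitv b); first by have := mv p b w _ pr wr; lra.
have m0 : md 0 <= r by rewrite modulus0 ltW.
have dB p b i : N (p - p0) < 2 * r -> md ('D_(unitv b) f p i 0) <= 32 / r.
  move=> pr; have -> : 32 / r = 8 * 2 / (r / 2) by field; rewrite gt_eqF.
  apply: (cauchy_estimate I2 (g := fun t => f (p + t *: unitv b) i 0)) => //.
  - by have := line p b i 0 pr m0; rewrite scale0r addr0.
  - by move=> w /md_square wr; exists ('D_(unitv b) f (p + w *: unitv b) i 0); apply: line.
  move=> w /md_square wr; rewrite scale0r addr0.
  have [|_ /(_ i) h1] := r4 (p + w *: unitv b); first by have := mv p b w _ pr wr; lra.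
  have [|_ /(_ i) h2] := r4 p; first by have := nrm2_ge0 (p - p0); lra.
  have -> : f (p + w *: unitv b) i 0 - f p i 0 = f (p + w *: unitv b) i 0 - f p0 i 0 - (f p i 0 - f p0 i 0) by ring.
  by apply: le_trans (modulus_le_add _ _) _; rewrite modulusN; lra.
have Lip p q i : N (p - p0) < 2 * r -> N (q - p0) < 2 * r ->
    md (f p i 0 - f q i 0) <= 64 / r * N (p - q).
  move=> pr qr; rewrite -[X in md X]subr0.
  have -> : 64 / r * N (p - q) = 2 * (N (p - q) * (32 / r)) by field; rewrite gt_eqF.
  have dt t : 0 <= t <= 1 -> differentiable f (q + ofr t *: (p - q)).
    move=> t01; apply: df; have tr := segment_ball qr pr t01.
    by have [] := r4 _ (lt_trans tr _); first by lra.
  apply: (mvt_vector (G := f) (p := q) (q := p)) => t t01; first exact: dt.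
  rewrite subr0; apply: derive_unitv_le => [|c]; first exact: dt.
  by apply: dB; apply: segment_ball.
exists r, (8 * (128 / r) / (r / 2)); split=> //.
  by apply: divr_ge0; [apply: mulr_ge0 => //; apply: divr_ge0 => //|]; apply: ltW.
move=> p q b i pr qr.
have pr2 : N (p - p0) < 2 * r by lra.
have qr2 : N (q - p0) < 2 * r by lra.
have -> : 8 * (128 / r) / (r / 2) * N (p - q) = 8 * (128 / r * N (p - q)) / (r / 2) by field;
  rewrite gt_eqF.
apply: (cauchy_estimate I2 (g := fun t => f (p + t *: unitv b) i 0 - f (q + t *: unitv b) i 0)) => //.
- by have := cderB (line p b i 0 pr2 m0) (line q b i 0 qr2 m0); rewrite !scale0r !addr0.
- by move=> w /md_square wr; eexists; apply: cderB; apply: line.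
move=> w /md_square wr; rewrite !scale0r !addr0.
apply: le_trans (modulus_le_add _ _) _; rewrite modulusN.
have h1 := Lip p q i pr2 qr2; have rr : r + r <= 2 * r by lra.
have h2 := Lip (p + w *: unitv b) (q + w *: unitv b) i
  (lt_le_trans (mv p b w _ pr wr) rr) (lt_le_trans (mv q b w _ qr wr) rr).
rewrite opprD addrACA subrr addr0 in h2.
have -> : 128 / r * N (p - q) = 64 / r * N (p - q) + 64 / r * N (p - q) by field; rewrite gt_eqF.
exact: lerD.
Qed.

Lemma jac_xE p i j : jac_x f p i j = 'D_(unitv (inl j)) f p i 0.
Proof.
rewrite /jac_x mxE /derive.
suff -> : (fun h : K => h^-1 *: (((fun x => f (x, p.2)) \o shift p.1) (h *: delta_mx j 0) - f (p.1, p.2))) =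
  (fun h : K => h^-1 *: ((f \o shift p) (h *: unitv (inl j)) - f p)) by [].
apply/funext => h; case: p => x y /=; congr (_ *: (f _ - _)).
have -> : h *: (delta_mx j 0 : 'cV[K]_m, 0 : 'cV[K]_n) + (x, y) =
  (h *: delta_mx j 0 + x, h *: 0 + y) by [].
by rewrite scaler0 add0r.
Qed.

Lemma C1_estimates r L : 0 < r -> 0 <= L -> derivative_lipschitz r L ->
  (forall p, N (p - p0) < r -> D p) -> (forall p, D p -> differentiable f p) ->
  exists2 C : R, 0 <= C & forall x x' y y',
    N ((x, y) - p0) < r -> N ((x', y) - p0) < r ->  N ((x, y') - p0) < r -> N ((x', y') - p0) < r ->
    [/\ nrm (f (x', y) - f (x, y) - jac_x f (x, y) *m (x' - x)) <= C * nrm (x' - x) ^+ 2,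
        nrm (jac_x f (x, y) - jac_x f (x', y')) <= C * (nrm (x - x') + nrm (y - y')) &
        nrm (f (x, y) - f (x, y')) <= C * nrm (y - y')].
Proof.
move=> r0 L0 fL rD df.
pose B := \sum_(b : 'I_m + 'I_n) \sum_(i < l) md ('D_(unitv b) f p0 i 0) + L * r.
have DB b i p : N (p - p0) < r -> md ('D_(unitv b) f p i 0) <= B.
  move=> pr; have N0 : N (p0 - p0) < r by rewrite subrr /nrm2 !nrm0 addr0.
  have h1 := fL p p0 b i pr N0.
  have h2 : md ('D_(unitv b) f p0 i 0) <= \sum_(b : 'I_m + 'I_n) \sum_(i < l) md ('D_(unitv b) f p0 i 0).
    exact: (term_le_sum (a := fun b i => md ('D_(unitv b) f p0 i 0)) (fun b i => modulus_ge0 _)).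
  have h3 : L * N (p - p0) <= L * r by rewrite ler_wpM2l // ltW.
  rewrite -[X in md X <= _](subrK ('D_(unitv b) f p0 i 0)).
  by apply: le_trans (modulus_le_add _ _) _; rewrite addrC lerD // (le_trans h1).
have B0 : 0 <= B.
  rewrite addr_ge0 //; last by rewrite mulr_ge0 // ltW.
  by do 2!apply: sumr_ge0 => ? _; apply: modulus_ge0.
pose C := (l * 1)%:R * (2 * L) + (l * m)%:R * L + (l * 1)%:R * (2 * B).
have [C1 C2 C3] : [/\ (l * 1)%:R * (2 * L) <= C, (l * m)%:R * L <= C & (l * 1)%:R * (2 * B) <= C].
  have h1 : 0 <= (l * 1)%:R * (2 * L) by rewrite !mulr_ge0.
  have h2 : 0 <= (l * m)%:R * L by rewrite !mulr_ge0.
  have h3 : 0 <= (l * 1)%:R * (2 * B) by rewrite !mulr_ge0.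
  by rewrite /C; split; lra.
exists C => [|x x' y y' xy x'y xy' x'y']; first by apply: le_trans C1; rewrite !mulr_ge0.
have dseg p q (t : R) : N (p - p0) < r -> N (q - p0) < r -> 0 <= t <= 1 -> differentiable f (p + ofr t *: (q - p)).
  by move=> pr qr t01; apply: df; apply: rD; apply: segment_ball.
split.
- apply: le_trans (ler_wpM2r _ C1); last by rewrite exprn_ge0 // nrm_ge0.
  rewrite -mulrA; apply: nrm_le_entries => i j; rewrite ord1 {j}.
  pose p : V := (x, y); pose q : V := (x', y).
  have Nqp : N (q - p) = nrm (x' - x) by rewrite /nrm2 /= subrr nrm0 addr0.
  have DE : 'D_(q - p) f p i 0 = (jac_x f (x, y) *m (x' - x)) i 0.
    rewrite derive_unitv; last by apply: df; apply: rD.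
    rewrite big_sumType /= [X in _ + X = _]big1 ?addr0 => [|k _]; last by rewrite subrr mxE mul0r.
    by rewrite [RHS]mxE; apply: eq_bigr => k _; rewrite jac_xE mulrC.
  have -> : (f (x', y) - f (x, y) - jac_x f (x, y) *m (x' - x)) i 0 =
      f q i 0 - f p i 0 - 'D_(q - p) f p i 0 by rewrite DE !mxE.
  rewrite -mulrA; apply: (mvt_vector (G := f) (p := p) (q := q)) => t t01; first exact: dseg.
  have dp : differentiable f p by apply: df; apply: rD.
  rewrite (derive_unitv _ _ dp) (derive_unitv _ _ (dseg p q t xy x'y t01)).
  rewrite -sumrB -Nqp expr2 mulrA {2}nrm2_coefv mulr_sumr.
  apply: le_trans (modulus_sum _ _ _) _; apply: ler_sum => b _.
  rewrite -mulrBr modulusM mulrC; apply: ler_wpM2r; first exact: modulus_ge0.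
  have := fL (p + ofr t *: (q - p)) p b i (segment_ball xy x'y t01) xy.
  move/le_trans; apply; apply: ler_wpM2l => //.
  rewrite addrC addKr nrm2Z modulus_of_real; have /andP[t0 t1] := t01.
  by rewrite ger0_norm // ler_piMl ?nrm2_ge0.
- apply: le_trans (ler_wpM2r _ C2); last by rewrite addr_ge0 ?nrm_ge0.
  rewrite -mulrA; apply: nrm_le_entries => i j.
  have -> : (jac_x f (x, y) - jac_x f (x', y')) i j =
      'D_(unitv (inl j)) f (x, y) i 0 - 'D_(unitv (inl j)) f (x', y') i 0.
    by rewrite -!jac_xE [LHS]mxE [X in _ + X = _]mxE.
  exact: fL.
apply: le_trans (ler_wpM2r _ C3); last exact: nrm_ge0.
rewrite -mulrA; apply: nrm_le_entries => i j; rewrite ord1 {j} !mxE.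
have -> : 2 * B * nrm (y - y') = 2 * (N ((x, y) - (x, y')) * B).
  by rewrite /nrm2 /= subrr nrm0 add0r; ring.
rewrite -[X in md X]subr0; apply: (mvt_vector (G := f) (p := (x, y')) (q := (x, y))) => t t01;
  first exact: dseg.
rewrite subr0; apply: derive_unitv_le => [|b]; first exact: dseg.
by apply: DB; apply: segment_ball.
Qed.

End Local.

Lemma smooth_estimates (R : realType) (F : ground) (m n l : nat)
    (D : set ('cV[scalarField R F]_m * 'cV[scalarField R F]_n))
    (f : 'cV[scalarField R F]_m * 'cV[scalarField R F]_n -> 'cV[scalarField R F]_l) x0 y0 :
  open D -> D (x0, y0) -> smooth_on D f ->
  exists rho C : R, [/\ 0 < rho, 0 <= C,
    forall x y, nrm (x - x0) < rho -> nrm (y - y0) < rho -> D (x, y) /\ differentiable f (x, y) &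
    forall x x' y y', nrm (x - x0) < rho -> nrm (x' - x0) < rho ->
      nrm (y - y0) < rho -> nrm (y' - y0) < rho ->
    [/\ nrm (f (x', y) - f (x, y) - jac_x f (x, y) *m (x' - x)) <= C * nrm (x' - x) ^+ 2,
        nrm (jac_x f (x, y) - jac_x f (x', y')) <= C * (nrm (x - x') + nrm (y - y')) &
        nrm (f (x, y) - f (x, y')) <= C * nrm (y - y')]].
Proof.
move=> oD Dp sf.
have [df [r [L [r0 L0 fL]]]] : (forall p, D p -> differentiable f p) /\
    exists r L, [/\ 0 < r, 0 <= L & derivative_lipschitz f (x0, y0) r L].
  case: F D f x0 y0 oD Dp sf => D f x0 y0 oD Dp sf.
    split; first by case: sf.
    exact: C2_derivative_lipschitz sf.
  split=> //; apply: (holomorphic_derivative_lipschitz (I := 'i%C) oD Dp _ sf).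
  by rewrite -expr2 sqr_i.
have [s s0 sD] := open_ball oD Dp.
pose t := Num.min r s; have t0 : 0 < t by rewrite lt_min r0.
have fLt : derivative_lipschitz f (x0, y0) t L.
  by move=> p q b i pr qr; apply: fL; [apply: lt_le_trans pr _|apply: lt_le_trans qr _];
    rewrite ge_min lexx.
have tD p : nrm2 (p - (x0, y0)) < t -> D p.
  by move=> pt; apply: sD; apply: lt_le_trans pt _; rewrite ge_min lexx orbT.
have [C C0 CP] := C1_estimates t0 L0 fLt tD df.
have small x y : nrm (x - x0) < t / 2 -> nrm (y - y0) < t / 2 -> nrm2 ((x, y) - (x0, y0)) < t.
  by rewrite /nrm2 /=; lra.
exists (t / 2), C; split=> //; first by rewrite divr_gt0.
  move=> x y xt yt; have xy := small x y xt yt.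
  have Dxy : D (x, y) by apply: sD; apply: lt_le_trans xy _; rewrite ge_min lexx orbT.
  by split=> //; apply: df.
by move=> x x' y y' *; apply: CP; apply: small.
Qed.

(** * Singular values and the Moore-Penrose inverse *)

Section Adjoint.
Variables (R : realType) (F : ground).
Local Notation K := (scalarField R F).
Local Notation md := (@modulus R F).
Local Notation ofr := (@of_real R F).
Local Notation nrm := (@nrm R F _ _).

Lemma adj_mulmx m n p (A : 'M[K]_(m, n)) (B : 'M[K]_(n, p)) : adj (A *m B) = adj B *m adj A.
Proof. by rewrite /adj map_mxM trmx_mul. Qed.
Lemma adj_adj m n (A : 'M[K]_(m, n)) : adj (adj A) = A.
Proof. by apply/matrixP => i j; rewrite !mxE cjK. Qed.
Lemma adj_sub m n (A B : 'M[K]_(m, n)) : adj (A - B) = adj A - adj B.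
Proof. by apply/matrixP => i j; rewrite !mxE rmorphB. Qed.
Lemma adj_scale m n a (A : 'M[K]_(m, n)) : adj (a *: A) = cj a *: adj A.
Proof. by apply/matrixP => i j; rewrite !mxE rmorphM. Qed.
Lemma adj_0mx m n : adj (0 : 'M[K]_(m, n)) = 0.
Proof. by apply/matrixP => i j; rewrite !mxE rmorph0. Qed.
Lemma adj_1mx m : adj (1%:M : 'M[K]_m) = 1%:M.
Proof. by rewrite /adj map_mx1 trmx1. Qed.
Lemma adj_row_mx m n p (A : 'M[K]_(m, n)) (B : 'M[K]_(m, p)) :
  adj (row_mx A B) = col_mx (adj A) (adj B).
Proof. by rewrite /adj map_row_mx tr_row_mx. Qed.
Lemma adj_real_diag n (s : 'I_n -> R) :
  adj (diag_mx (\row_j ofr (s j))) = diag_mx (\row_j ofr (s j)).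
Proof.
apply/matrixP => i j; rewrite !mxE eq_sym; case: eqVneq => [->|_].
  by rewrite !mulr1n cj_of_real.
by rewrite !mulr0n rmorph0.
Qed.

Lemma adj_dot m (w : 'cV[K]_m) : adj w *m w = (ofr (\sum_i md (w i 0) ^+ 2))%:M.
Proof.
apply/matrixP => i j; rewrite !ord1 !mxE eqxx mulr1n.
rewrite (big_morph ofr (@of_realD R F) (@of_real0 R F)).
by apply: eq_bigr => k _; rewrite modulus_sqr !mxE.
Qed.

Lemma sum_sqr_gt0 m (w : 'cV[K]_m) : w != 0 -> 0 < \sum_i md (w i 0) ^+ 2.
Proof.
move=> w0; rewrite lt0r sumr_ge0 ?andbT => [|i _]; last exact: sqr_ge0.
apply: contraNneq w0 => /psumr_eq0P w0; apply/eqP/matrixP => i j; rewrite ord1 mxE.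
apply/eqP; rewrite -modulus_eq0 -sqrf_eq0; apply/eqP; apply: w0 => // k _; exact: sqr_ge0.
Qed.

Lemma unit_multiple m (w : 'cV[K]_m) : w != 0 ->
  exists2 c : R, 0 < c & adj (ofr c *: w) *m (ofr c *: w) = 1%:M.
Proof.
move=> /sum_sqr_gt0 w0; exists (Num.sqrt (\sum_i md (w i 0) ^+ 2))^-1.
  by rewrite invr_gt0 sqrtr_gt0.
rewrite adj_scale -scalemxAl -scalemxAr adj_dot scalerA cj_of_real -of_realM.
rewrite scale_scalar_mx -of_realM -expr2 exprVn sqr_sqrtr ?ltW // mulVf ?gt_eqF //.
by rewrite of_real1.
Qed.

Lemma adj_mul_eq0 m n (E : 'M[K]_(m, n)) : adj E *m E = 0 -> E = 0.
Proof.
move=> E0; apply/matrixP => i j; rewrite mxE.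
have /matrixP/(_ j j) := E0; rewrite mxE mxE.
have -> : \sum_k (adj E) j k * E k j = ofr (\sum_k md (E k j) ^+ 2).
  rewrite (big_morph ofr (@of_realD R F) (@of_real0 R F)).
  by apply: eq_bigr => k _; rewrite modulus_sqr !mxE.
rewrite -[X in _ = X](of_real0 R F) => /of_real_inj /psumr_eq0P E00.
apply/eqP; rewrite -modulus_eq0 -sqrf_eq0; apply/eqP; apply: E00 => // k _; exact: sqr_ge0.
Qed.

(** The dimension count that replaces min-max characterizations of singular values below; with [A]
    the identity it produces nonzero kernel vectors. *)
Lemma ker_witness l1 l2 m (B : 'M[K]_(l1, m)) (A : 'M[K]_(l2, m)) :
  (\rank B < \rank A)%N -> exists w : 'cV[K]_m, B *m w = 0 /\ A *m w != 0.
Proof.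
move=> BA; have /negP AB : ~~ (A <= B)%MS.
  by apply: contraL BA => /mxrankS; rewrite -leqNgt.
have : A *m cokermx B != 0 by apply: contra_notN AB; rewrite submxE.
move=> /matrix0Pn[i [j Aij]]; exists (col j (cokermx B)); split.
  by rewrite colE mulmxA mulmx_coker mul0mx.
by apply: contraNneq Aij => /matrixP/(_ i 0); rewrite colE mulmxA -colE !mxE => ->.
Qed.

End Adjoint.

Lemma complex_hermitian_eigen (R : realType) m (H : 'M[R[i]]_m) :
  (map_mx (@conjc R) H)^T = H -> H != 0 ->
  exists a (w : 'rV[R[i]]_m), [/\ a != 0, w != 0 & w *m H = a *: w].
Proof.
move=> Hh H0; have Hn : H \is normalmx.
  apply/normalmxP; have -> // : map_mx Num.conj H^T = H.
  by rewrite -[RHS]Hh; apply/matrixP => i j; rewrite !mxE.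
have /orthomx_spectralP HE := Hn.
have [i Hi] : exists i, spectral_diag H 0 i != 0.
  apply/existsP; apply: contraNT H0 => /existsPn Hd; apply/eqP.
  have sp0 : spectral_diag H = 0.
    by apply/rowP => j; rewrite [RHS]mxE; apply/eqP/negPn/Hd.
  have d0 : diag_mx (0 : 'rV[R[i]]_m) = 0 by apply/matrixP => k j; rewrite !mxE mul0rn.
  by rewrite [LHS]HE sp0 d0 mulmx0 mul0mx.
have Pu := spectral_unit H.
exists (spectral_diag H 0 i), (row i (spectralmx H)); split=> //.
  apply: contraTneq Pu => r0; rewrite unitmxE unitfE negbK.
  rewrite (expand_det_row _ i) big1 // => j _.
  by have /matrixP/(_ 0 j) := r0; rewrite !mxE => ->; rewrite mul0r.
rewrite -row_mul {2}HE !mulmxA mulmxV // mul1mx row_mul.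
by rewrite row_diag_mx -scalemxAl -rowE.
Qed.

(** Over [R[i]] there is a nonzero eigenvalue [a]; it is real because [w H w^*] is its own adjoint.
    A real eigenvalue is a root of the characteristic polynomial over [R], hence has a real
    eigenvector. *)
Lemma real_hermitian_eigen (R : realType) m (H : 'M[R]_m) :
  H^T = H -> H != 0 ->
  exists a (w : 'rV[R]_m), [/\ a != 0, w != 0 & w *m H = a *: w].
Proof.
move=> Hs H0; pose HC := map_mx (real_complex R) H.
have HCh : (map_mx (@conjc R) HC)^T = HC.
  by apply/matrixP => i j; rewrite !mxE /= /conjc /= oppr0 -[in RHS]Hs mxE.
have HC0 : HC != 0.
  apply: contraNneq H0 => /matrixP HC0; apply/eqP/matrixP => i j.
  by have := HC0 i j; rewrite !mxE => -[].
have [a [w [a0 w0 wa]]] := complex_hermitian_eigen HCh HC0.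
pose u : 'cV[scalarField R ComplexField]_m := adj (w : 'M[scalarField R ComplexField]_(1, m)).
have u0 : u != 0.
  by apply: contraNneq w0 => u0;
    rewrite -(adj_adj (w : 'M[scalarField R ComplexField]_(1, m))) -/u u0 adj_0mx.
pose t := \sum_i modulus (u i 0) ^+ 2; have t0 : 0 < t := sum_sqr_gt0 u0.
have ww : (w : 'M[scalarField R ComplexField]_(1, m)) *m u = (of_real ComplexField t)%:M.
  by rewrite -adj_dot adj_adj.
have aR : cj (a : scalarField R ComplexField) = a.
  have t0' : of_real ComplexField t != 0 by rewrite -(of_real0 R ComplexField) (inj_eq (@of_real_inj _ _)) gt_eqF.
  have E1 : w *m HC *m u = (a * of_real ComplexField t)%:M.
    by rewrite wa -scalemxAl [w *m u]ww scale_scalar_mx.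
  have : adj (w *m HC *m u : 'M[scalarField R ComplexField]_1) = w *m HC *m u.
    rewrite 2!adj_mulmx (HCh : adj (HC : 'M[scalarField R ComplexField]_m) = HC) mulmxA.
    by congr (_ *m _ *m _); rewrite adj_adj.
  rewrite E1 => /matrixP/(_ 0 0); rewrite !mxE eqxx !mulr1n cjM cj_of_real.
  exact: mulIf.
have aE : a = (complex.Re a)%:C%C.
  by move: aR; case: (a) => a1 a2 /= [/eqP];
    rewrite -subr_eq0 -opprD oppr_eq0 -mulr2n mulrn_eq0 /= => /eqP ->.
have : eigenvalue HC a by apply/eigenvalueP; exists w.
rewrite eigenvalue_root_char aE /HC -map_char_poly fmorph_root -eigenvalue_root_char.
move=> /eigenvalueP[v vH v0]; exists (complex.Re a), v; split=> //.
by apply: contraNneq a0 => a0; rewrite aE a0.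
Qed.

Lemma hermitian_eigen (R : realType) (F : ground) m (H : 'M[scalarField R F]_m) :
  adj H = H -> H != 0 ->
  exists a (w : 'cV[scalarField R F]_m), [/\ a != 0, w != 0 & H *m w = a *: w].
Proof.
move=> Hh H0.
have [a [w [a0 w0 wH]]] : exists a (w : 'rV[scalarField R F]_m), [/\ a != 0, w != 0 & w *m H = a *: w].
  case: F H Hh H0 => H Hh H0; last exact: complex_hermitian_eigen.
  apply: real_hermitian_eigen => //; rewrite -[RHS]Hh.
  by apply/matrixP => i j; rewrite !mxE.
exists (cj a), (adj w); split.
- by apply: contraNneq a0 => a0; rewrite -(cjK a) a0 rmorph0.
- by apply: contraNneq w0 => w0; rewrite -(adj_adj w) w0 adj_0mx.
by rewrite -adj_scale -wH adj_mulmx Hh.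
Qed.

Lemma sort_decreasing (R : realType) q (s : 'I_q -> R) :
  exists p : 'S_q, forall i j : 'I_q, (i <= j)%N -> s (p j) <= s (p i).
Proof.
pose leS : rel 'I_q := fun i j => s j <= s i.
have leSt : total leS by move=> i j; rewrite /leS; apply: le_total.
have leStr : transitive leS by move=> y x z xy yz; apply: le_trans yz xy.
pose e := sort leS (enum 'I_q).
have sz : size e == q by rewrite size_sort size_enum_ord.
have ue : uniq e by rewrite sort_uniq enum_uniq.
have injt : injective (tnth (Tuple sz)).
  by apply/tuple_uniqP.
exists (perm injt) => i j ij; rewrite !permE.
have so : sorted leS e by apply: sort_sorted.
have i0 := i; rewrite !(tnth_nth i0) /=.
apply: (sorted_leq_nth leStr _ _ so) => //.
- by move=> x; rewrite /leS lexx.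
- by rewrite inE (eqP sz) ltn_ord.
- by rewrite inE (eqP sz) ltn_ord.
Qed.

Section Svd.
Variables (R : realType) (F : ground).
Local Notation K := (scalarField R F).
Local Notation md := (@modulus R F).
Local Notation ofr := (@of_real R F).
Local Notation nrm := (@nrm R F _ _).

Definition rdiag q (s : 'I_q -> R) : 'M[K]_q := diag_mx (\row_j ofr (s j)).

Lemma rdiagM q (s t : 'I_q -> R) : rdiag s *m rdiag t = rdiag (fun j => s j * t j).
Proof.
rewrite /rdiag mulmx_diag; congr diag_mx; apply/rowP => j.
by rewrite !mxE of_realM.
Qed.

Lemma adj_rdiag q (s : 'I_q -> R) : adj (rdiag s) = rdiag s.
Proof. exact: adj_real_diag. Qed.

Lemma rdiagB q (s t : 'I_q -> R) : rdiag s - rdiag t = rdiag (fun j => s j - t j).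
Proof. by apply/matrixP => i j; rewrite !mxE of_realB mulrnBl. Qed.

Lemma orthogonal_sum l m q (U : 'M[K]_(l, q)) (s : 'I_q -> R) (V : 'M[K]_(m, q)) (P : pred 'I_q) :
  \sum_(j | P j) ofr (s j) *: (col j U *m adj (col j V)) =
  U *m rdiag (fun j => if P j then s j else 0) *m adj V.
Proof.
apply/matrixP => i k; rewrite summxE !mxE big_mkcond; apply: eq_bigr => j _.
rewrite /rdiag mul_mx_diag !mxE; case: (P j).
    by rewrite big_ord1 !mxE mulrCA mulrA.
by rewrite of_real0 mulr0 mul0r.
Qed.

Lemma orthonormal_family_col n q (U : 'M[K]_(n, q)) :
  adj U *m U = 1%:M <-> orthonormal_family (fun j => col j U).
Proof.
have colU i j : (adj (col i U) *m col j U) 0 0 = (adj U *m U) i j.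
  by rewrite !mxE; apply: eq_bigr => k _; rewrite !mxE.
split=> [UU i j|UU].
  by apply/matrixP => a b; rewrite !ord1 colU UU !mxE eqxx mulr1n.
by apply/matrixP => i j; rewrite -colU UU !mxE eqxx mulr1n.
Qed.

(** One more singular triple, taken from the residual [E]. An eigenvector [v] of [adj E *m E] for a
    nonzero eigenvalue lies in the range of [adj E], and is therefore orthogonal to [V] because
    [E *m V = 0]. If [E = 0], any unit vectors orthogonal to [U] and [V] serve, with singular value
    0. *)
Lemma orthonormal_step l m (E : 'M[K]_(l, m)) q (U : 'M[K]_(l, q)) (V : 'M[K]_(m, q)) :
  (q < l)%N -> (q < m)%N -> E *m V = 0 -> adj U *m E = 0 ->
  exists (s : R) (u : 'cV[K]_l) (v : 'cV[K]_m),
  [/\ 0 <= s, adj u *m u = 1%:M /\ adj v *m v = 1%:M,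
      adj U *m u = 0 /\ adj V *m v = 0,
      E *m v = ofr s *: u & adj u *m E = ofr s *: adj v].
Proof.
move=> ql qm EV UE; have [E0|E0] := eqVneq E 0.
  have ex k (W : 'M[K]_(k, q)) : (q < k)%N -> exists w : 'cV[K]_k, adj w *m w = 1%:M /\ adj W *m w = 0.
    move=> qk; have [|w [Ww w0]] := @ker_witness R F q k k (adj W) 1%:M.
      by rewrite mxrank1; apply: leq_ltn_trans qk; apply: rank_leq_row.
    rewrite mul1mx in w0; have [c _ cw] := unit_multiple w0.
    by exists (ofr c *: w); split=> //; rewrite -scalemxAr Ww scaler0.
  have [u [u1 Uu]] := ex _ U ql; have [v [v1 Vv]] := ex _ V qm.
  by exists 0, u, v; split=> //; rewrite E0 ?mul0mx ?mulmx0 of_real0 scale0r.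
have EE0 : adj E *m E != 0 by apply: contraNneq E0 => /adj_mul_eq0 ->.
have [a [w [a0 w0 Ew]]] : exists a (w : 'cV[K]_m), [/\ a != 0, w != 0 & (adj E *m E) *m w = a *: w].
  by apply: hermitian_eigen => //; rewrite adj_mulmx adj_adj.
have [c c0 cw] := unit_multiple w0; pose v := ofr c *: w.
have Ev : adj E *m E *m v = a *: v by rewrite /v -scalemxAr Ew !scalerA mulrC.
have aE : (ofr (\sum_i md ((E *m v) i 0) ^+ 2)) = a.
  have : adj (E *m v) *m (E *m v) = a%:M.
    by rewrite adj_mulmx mulmxA -(mulmxA (adj v)) -mulmxA Ev -scalemxAr cw scalemx1.
  by rewrite adj_dot => /matrixP/(_ 0 0); rewrite !mxE eqxx !mulr1n.
set t := \sum_i _ in aE.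
have t0 : 0 < t.
  rewrite lt0r; apply/andP; split; last by apply: sumr_ge0 => i _; apply: sqr_ge0.
  by apply: contraNneq a0 => t0; rewrite -aE t0 of_real0.
have [r s0 ss] : exists2 r : R, 0 < r & r * r = t.
  by exists (Num.sqrt t); rewrite ?sqrtr_gt0 // -expr2 sqr_sqrtr // ltW.
exists r, (ofr r^-1 *: (E *m v)), v; split.
- exact: ltW.
- split=> //; rewrite adj_scale -scalemxAl -scalemxAr adj_dot -/t scalerA cj_of_real -of_realM.
  by rewrite scale_scalar_mx -of_realM -ss -invfM mulVf ?of_real1 // mulf_neq0 // gt_eqF.
- split; first by rewrite -scalemxAr mulmxA UE mul0mx scaler0.
  have -> : v = a^-1 *: (adj E *m E *m v) by rewrite Ev scalerA mulVf // scale1r.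
  by rewrite -scalemxAr !mulmxA -adj_mulmx EV adj_0mx !mul0mx scaler0.
- by rewrite scalerA -of_realM divff ?of_real1 ?scale1r // gt_eqF.
rewrite adj_scale cj_of_real -scalemxAl adj_mulmx -mulmxA.
have -> : adj v *m (adj E *m E) = adj (adj E *m E *m v) by rewrite !adj_mulmx adj_adj.
rewrite Ev adj_scale -aE cj_of_real scalerA -of_realM; congr (ofr _ *: _).
by rewrite -ss mulrA mulVf ?mul1r // gt_eqF.
Qed.

Lemma partial_svd l m (A : 'M[K]_(l, m)) q : (q <= minn l m)%N ->
  exists (U : 'M[K]_(l, q)) (s : 'rV[R]_q) (V : 'M[K]_(m, q)),
  [/\ forall j, 0 <= s 0 j, adj U *m U = 1%:M, adj V *m V = 1%:M &
      let E := A - U *m diag_mx (map_mx ofr s) *m adj V in E *m V = 0 /\ adj U *m E = 0].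
Proof.
elim: q => [_|q IH ql].
  exists 0, 0, 0; split=> [[]//|||]; try by apply/matrixP => -[].
  by split; apply/matrixP => i; [move=> []|case: i].
have [U [s [V [s0 UU VV]]]] := IH (ltnW ql).
move: ql; rewrite leq_min => /andP[ql qm].
set E := A - _ => /= -[EV UE].
have [t [u [v [t0 [uu vv] [Uu Vv] Ev uE]]]] := orthonormal_step ql qm EV UE.
rewrite -addn1; exists (row_mx U u), (row_mx s (const_mx t)), (row_mx V v).
have uU : adj u *m U = 0 by rewrite -(adj_adj U) -adj_mulmx Uu adj_0mx.
have vV : adj v *m V = 0 by rewrite -(adj_adj V) -adj_mulmx Vv adj_0mx.
have EE : A - row_mx U u *m diag_mx (map_mx ofr (row_mx s (const_mx t))) *m adj (row_mx V v) =
   E - ofr t *: (u *m adj v).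
  rewrite /E map_row_mx diag_mx_row mul_row_block !mulmx0 addr0 add0r adj_row_mx mul_row_col.
  rewrite opprD addrA; congr (_ - _).
  have -> : diag_mx (map_mx ofr (const_mx t)) = (ofr t)%:M :> 'M[K]_1.
    by apply/matrixP => i j; rewrite !ord1 !mxE.
  by rewrite mul_mx_scalar -scalemxAl.
clearbody E; split.
- move=> j; rewrite mxE; case: splitP => k _; rewrite ?mxE //.
- by rewrite adj_row_mx mul_col_row UU Uu uU uu -scalar_mx_block.
- by rewrite adj_row_mx mul_col_row VV Vv vV vv -scalar_mx_block.
rewrite EE; split.
  rewrite mul_mx_row !mulmxBl EV Ev -!scalemxAl -!mulmxA vV vv mulmx0 mulmx1 scaler0 !subrr.
  by rewrite row_mx0.
rewrite adj_row_mx mul_col_mx !mulmxBr UE uE -!scalemxAr !mulmxA Uu uu mul0mx mul1mx scaler0 !subrr.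
by rewrite col_mx0.
Qed.

Lemma square_orthonormal_eq0 l m q (U : 'M[K]_(l, q)) (E : 'M[K]_(l, m)) :
  q = l -> adj U *m U = 1%:M -> adj U *m E = 0 -> E = 0.
Proof.
move=> ql; subst q => /mulmx1C UU UE.
by rewrite -(mul1mx E) -UU -mulmxA UE mulmx0.
Qed.

(** At [q = minn l m] one of [U] and [V] is square, hence unitary, so the residual vanishes. The
    triples of [partial_svd] come in no particular order and are sorted only here. *)
Lemma svd_exists l m (A : 'M[K]_(l, m)) : exists s u v, is_svd A s u v.
Proof.
have [U [s [V [s0 UU VV /= [EV UE]]]]] := partial_svd A (leqnn _).
have AE : A = U *m diag_mx (map_mx ofr s) *m adj V.
  apply/eqP; rewrite -subr_eq0; apply/eqP.
  have [lm|ml] : (l <= m)%N \/ (m <= l)%N by apply/orP/leq_total.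
    by apply: square_orthonormal_eq0 UU UE; apply/minn_idPl.
  rewrite -[LHS]adj_adj -[RHS]adj_adj adj_0mx; congr adj.
  apply: square_orthonormal_eq0 VV _; first exact/minn_idPr.
  by rewrite -adj_mulmx EV adj_0mx.
have [p pP] := sort_decreasing (s 0).
exists (fun j => s 0 (p j)), (fun j => col (p j) U), (fun j => col (p j) V); split=> //.
- by move=> i j; rewrite ((orthonormal_family_col U).1 UU) (inj_eq perm_inj).
- by move=> i j; rewrite ((orthonormal_family_col V).1 VV) (inj_eq perm_inj).
rewrite [LHS]AE (reindex_inj (@perm_inj _ p^-1%g)) /=.
under eq_bigr do rewrite permKV.
rewrite (orthogonal_sum U (s 0) V xpredT); congr (_ *m diag_mx _ *m _).
by apply/rowP => j; rewrite !mxE.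
Qed.

Lemma svd_matrix l m (A : 'M[K]_(l, m)) s u v : is_svd A s u v ->
  exists (U : 'M[K]_(l, minn l m)) (V : 'M[K]_(m, minn l m)),
  [/\ adj U *m U = 1%:M, adj V *m V = 1%:M, A = U *m rdiag s *m adj V &
    forall r, \sum_(j : 'I_(minn l m) | (j < r)%N) ofr (s j) *: (u j *m adj (v j)) =
       U *m rdiag (fun j => if (j < r)%N then s j else 0) *m adj V].
Proof.
move=> [s0 sm uu vv AE].
pose U := \matrix_(i, j) u j i 0; pose V := \matrix_(i, j) v j i 0.
have cU j : col j U = u j by apply/matrixP => i k; rewrite ord1 !mxE.
have cV j : col j V = v j by apply/matrixP => i k; rewrite ord1 !mxE.
have sumE (P : pred 'I_(minn l m)) : \sum_(j | P j) ofr (s j) *: (u j *m adj (v j)) =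
       U *m rdiag (fun j => if P j then s j else 0) *m adj V.
  by rewrite -orthogonal_sum; apply: eq_bigr => j _; rewrite cU cV.
exists U, V; split.
- by apply/orthonormal_family_col => i j; rewrite !cU.
- by apply/orthonormal_family_col => i j; rewrite !cV.
- by rewrite AE sumE.
- by move=> r; rewrite sumE.
Qed.

(** Exposes the decomposition that [rank_proj] happens to choose; later arguments hold for any
    decomposition with these properties. *)
Lemma rank_proj_svd l m r (A : 'M[K]_(l, m)) :
  exists (U : 'M[K]_(l, minn l m)) (s : 'I_(minn l m) -> R) (V : 'M[K]_(m, minn l m)),
  [/\ forall j, 0 <= s j, forall i j : 'I_(minn l m), (i <= j)%N -> s j <= s i,
      adj U *m U = 1%:M /\ adj V *m V = 1%:M, A = U *m rdiag s *m adj V &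
      rank_proj r A = U *m rdiag (fun j => if (j < r)%N then s j else 0) *m adj V].
Proof.
rewrite /rank_proj; case: xgetP => [B -> /= [s [u [v [Asvd ->]]]]|/(_ _) nex].
  have [U [V [UU VV AE ->]]] := svd_matrix Asvd; have [s0 sm _ _ _] := Asvd.
  by exists U, s, V.
have [s [u [v Asvd]]] := svd_exists A.
by case: (nex (\sum_(j : 'I_(minn l m) | (j < r)%N) ofr (s j) *: (u j *m adj (v j)))); exists s, u, v.
Qed.

Lemma moore_penrose_unique l m (A : 'M[K]_(l, m)) (B C : 'M[K]_(m, l)) :
  is_moore_penrose A B -> is_moore_penrose A C -> B = C.
Proof.
move=> [B1 B2 B3 B4] [C1 C2 C3 C4].
have AB : A *m B = A *m C.
  by rewrite -{1}C1 -mulmxA -C3 -B3 -adj_mulmx mulmxA B1 C3.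
have BA : B *m A = C *m A.
  transitivity ((B *m A) *m (C *m A)); first by rewrite -mulmxA (mulmxA A C A) C1.
  by rewrite -{1}B4 -{1}C4 -adj_mulmx -mulmxA (mulmxA A B A) B1 C4.
by rewrite -B2 BA -mulmxA AB mulmxA C2.
Qed.

(** The convention that the inverse of 0 is 0 makes [(s j)^-1] the pseudo-inverse of the scalar
    [s j], so vanishing or truncated singular values are covered. *)
Lemma moore_penrose_svd l m q (U : 'M[K]_(l, q)) (s : 'I_q -> R) (V : 'M[K]_(m, q)) :
  adj U *m U = 1%:M -> adj V *m V = 1%:M ->
  is_moore_penrose (U *m rdiag s *m adj V) (V *m rdiag (fun j => (s j)^-1) *m adj U).
Proof.
move=> UU VV.
have AB : U *m rdiag s *m adj V *m (V *m rdiag (fun j => (s j)^-1) *m adj U) =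
    U *m rdiag (fun j => s j / s j) *m adj U.
  by rewrite !mulmxA -(mulmxA _ (adj V)) VV mulmx1 -(mulmxA U) rdiagM.
have BA : V *m rdiag (fun j => (s j)^-1) *m adj U *m (U *m rdiag s *m adj V) =
    V *m rdiag (fun j => (s j)^-1 * s j) *m adj V.
  by rewrite !mulmxA -(mulmxA _ (adj U)) UU mulmx1 -(mulmxA V) rdiagM.
have id1 j : s j / s j * s j = s j.
  by have [->|sj] := eqVneq (s j) 0; [rewrite mulr0|rewrite divfK].
have id2 j : (s j)^-1 * s j * (s j)^-1 = (s j)^-1.
  by have [->|sj] := eqVneq (s j) 0; [rewrite invr0 !mulr0|rewrite mulVf // mul1r].
split.
- rewrite AB !mulmxA -(mulmxA _ (adj U)) UU mulmx1 -(mulmxA U) rdiagM.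
  by congr (_ *m rdiag _ *m _); apply/funext.
- rewrite BA !mulmxA -(mulmxA _ (adj V)) VV mulmx1 -(mulmxA V) rdiagM.
  by congr (_ *m rdiag _ *m _); apply/funext.
- by rewrite AB !adj_mulmx adj_adj adj_rdiag mulmxA.
- by rewrite BA !adj_mulmx adj_adj adj_rdiag mulmxA.
Qed.

Lemma mpinv_eq l m (A : 'M[K]_(l, m)) B : is_moore_penrose A B -> mpinv A = B.
Proof.
move=> AB; rewrite /mpinv; case: xgetP => [C -> /= AC|/(_ B)//].
exact: moore_penrose_unique AC AB.
Qed.

Lemma mpinvP l m (A : 'M[K]_(l, m)) : is_moore_penrose A (mpinv A).
Proof.
have [U [s [V [_ _ [UU VV] -> _]]]] := rank_proj_svd 0 A.
by rewrite (mpinv_eq (moore_penrose_svd s UU VV)); apply: moore_penrose_svd.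
Qed.

End Svd.

(** * Lipschitz dependence of the rank-r pseudo-inverse *)

Section OuterInverse.
Variables (R : realType) (F : ground) (l m : nat).
Local Notation K := (scalarField R F).
Local Notation nrm := (@nrm R F _ _).

(* [J = G^+ + (J - J G J)], where the second summand is small, as holds for
   [G = J_{rank-r}^+] near a matrix of rank [r]. *)
Definition gap_inverse (b g : R) (J : 'M[K]_(l, m)) (G : 'M[K]_(m, l)) :=
  [/\ G *m J *m G = G, adj (G *m J) = G *m J, adj (J *m G) = J *m G,
      nrm J <= b /\ nrm G <= g & 2 * g * nrm (J - J *m G *m J) <= 1].

(** The products measure how far the ranges of the projections [G J] and [J G] lie outside those of
    [G' J'] and [J' G']. Each equals a term of order [J' - J] plus the other one multiplied by the
    residual [R'] (or its adjoint) and by [G] (or its adjoint). As [2 * g * nrm R' <= 1], the two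
    coupled inequalities can be solved for the sum. *)
Lemma gap_inverse_step b g J G J' G' : gap_inverse b g J G -> gap_inverse b g J' G' ->
  nrm ((1%:M - G' *m J') *m (G *m J)) + nrm ((1%:M - J' *m G') *m (J *m G)) <=
  2 * ((nrm (1%:M : 'M[K]_m) + nrm (1%:M : 'M[K]_l) + 2 * (b * g)) * g) * nrm (J' - J).
Proof.
move=> [GJG P1 Q1 [Jb Gg] _] [GJG' P1' Q1' [Jb' Gg'] Rg].
have b0 : 0 <= b := le_trans (nrm_ge0 _) Jb.
have g0 : 0 <= g := le_trans (nrm_ge0 _) Gg.
set X := (1%:M - G' *m J') *m (G *m J); set Y := (1%:M - J' *m G') *m (J *m G).
pose R' := J' - J' *m G' *m J'.
have JGJ' : J' *m G' *m J' *m G' = J' *m G' by rewrite -!mulmxA (mulmxA G') GJG'.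
have E1 : (1%:M - J' *m G') *m J' = R' by rewrite mulmxBl mul1mx.
have E2 : (1%:M - G' *m J') *m adj J' = adj R'.
  by rewrite -P1' -adj_1mx -adj_sub -adj_mulmx mulmxBr mulmx1 mulmxA.
have E3 : R' *m (1%:M - G' *m J') = R'.
  by rewrite mulmxBr mulmx1 /R' mulmxBl !mulmxA JGJ' subrr subr0.
have E4 : adj R' *m (1%:M - J' *m G') = adj R'.
  rewrite -Q1' -adj_1mx -adj_sub -adj_mulmx; congr adj.
  by rewrite mulmxBl mul1mx /R' mulmxBr !mulmxA JGJ' subrr subr0.
have XE : X = (1%:M - G' *m J') *m adj (J - J') *m adj G + adj R' *m Y *m adj G.
  have -> : adj R' *m Y *m adj G = adj R' *m adj G.
    have QG : J *m G *m adj G = adj G by rewrite -[J *m G]Q1 -adj_mulmx mulmxA GJG.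
    by rewrite /Y mulmxA E4 -mulmxA QG.
  rewrite -E2 adj_sub mulmxBr mulmxBl subrK /X -P1 adj_mulmx mulmxA //.
have YE : Y = (1%:M - J' *m G') *m (J - J') *m G + R' *m X *m G.
  have -> : R' *m X *m G = R' *m G by rewrite /X mulmxA E3 -mulmxA GJG.
  by rewrite -E1 mulmxBr mulmxBl subrK /Y mulmxA.
have gR : 2 * (nrm R' * g) <= 1 by apply: le_trans Rg; rewrite -/R'; lra.
set d := nrm (J' - J); have dE : nrm (J - J') = d by rewrite nrmC.
have d0 : 0 <= d := nrm_ge0 _.
have m1 n1 n2 n3 n4 (A1 : 'M[K]_(n1, n2)) (A2 : 'M[K]_(n2, n3)) (A3 : 'M[K]_(n3, n4)) :
    nrm (A1 *m A2 *m A3) <= nrm A1 * nrm A2 * nrm A3.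
  by apply: le_trans (nrmM _ _) _; apply: ler_wpM2r; [apply: nrm_ge0|apply: nrmM].
have bm : nrm (1%:M - G' *m J') <= nrm (1%:M : 'M[K]_m) + b * g.
  apply: le_trans (nrmB _ _) _; rewrite lerD2l; apply: le_trans (nrmM _ _) _.
  by rewrite mulrC; apply: ler_pM; rewrite ?nrm_ge0.
have bl : nrm (1%:M - J' *m G') <= nrm (1%:M : 'M[K]_l) + b * g.
  apply: le_trans (nrmB _ _) _; rewrite lerD2l; apply: le_trans (nrmM _ _) _.
  by apply: ler_pM; rewrite ?nrm_ge0.
have hX : nrm X <= (nrm (1%:M : 'M[K]_m) + b * g) * d * g + nrm R' * g * nrm Y.
  rewrite {1}XE; apply: le_trans (nrmD _ _) _; apply: lerD.
    apply: le_trans (m1 _ _ _ _ _ _ _) _; rewrite !nrm_adj dE.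
    by apply: ler_pM; rewrite ?mulr_ge0 ?nrm_ge0 //; apply: ler_wpM2r.
  apply: le_trans (m1 _ _ _ _ _ _ _) _; rewrite !nrm_adj mulrAC.
  by apply: ler_wpM2r; [apply: nrm_ge0|apply: ler_wpM2l => //; apply: nrm_ge0].
have hY : nrm Y <= (nrm (1%:M : 'M[K]_l) + b * g) * d * g + nrm R' * g * nrm X.
  rewrite {1}YE; apply: le_trans (nrmD _ _) _; apply: lerD.
    apply: le_trans (m1 _ _ _ _ _ _ _) _; rewrite dE.
    by apply: ler_pM; rewrite ?mulr_ge0 ?nrm_ge0 //; apply: ler_wpM2r.
  apply: le_trans (m1 _ _ _ _ _ _ _) _; rewrite mulrAC.
  by apply: ler_wpM2r; [apply: nrm_ge0|apply: ler_wpM2l => //; apply: nrm_ge0].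
have half Z : 0 <= Z -> 2 * (nrm R' * g * Z) <= Z.
  by move=> Z0; rewrite mulrA -[leRHS]mul1r; apply: ler_wpM2r.
have h1 := half _ (nrm_ge0 X); have h2 := half _ (nrm_ge0 Y).
have -> : 2 * ((nrm (1%:M : 'M[K]_m) + nrm (1%:M : 'M[K]_l) + 2 * (b * g)) * g) * d =
  2 * ((nrm (1%:M : 'M[K]_m) + b * g) * d * g) + 2 * ((nrm (1%:M : 'M[K]_l) + b * g) * d * g) by ring.
lra.
Qed.

(** Wedin's splitting for pseudo-inverses: [G' - G] is a first order term in [J' - J] plus two terms
    containing the projection defects [X] and [Y]. The defect [Y] comes from [gap_inverse_step] with
    the two matrices exchanged. *)
Lemma gap_inverse_lipschitz b g : exists2 C : R, 0 <= C &
  forall J G J' G', gap_inverse b g J G -> gap_inverse b g J' G' ->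
  nrm (G' - G) <= C * nrm (J' - J).
Proof.
pose c := 2 * ((nrm (1%:M : 'M[K]_m) + nrm (1%:M : 'M[K]_l) + 2 * (b * g)) * g).
exists (`|g * g + 2 * (g * c)|) => // J G J' G' h h'.
have [GJG P1 Q1 [Jb Gg] _] := h; have [GJG' P1' Q1' [Jb' Gg'] _] := h'.
have b0 : 0 <= b := le_trans (nrm_ge0 _) Jb.
have g0 : 0 <= g := le_trans (nrm_ge0 _) Gg.
have c0 : 0 <= c by rewrite !mulr_ge0 // !addr_ge0 ?nrm_ge0 // !mulr_ge0.
rewrite ger0_norm; last by apply: addr_ge0; [exact: mulr_ge0|apply: mulr_ge0 => //; exact: mulr_ge0].
have s1 := gap_inverse_step h h'; have s2 := gap_inverse_step h' h.
rewrite -/c in s1 s2; set d := nrm (J' - J) in s1 *; rewrite nrmC -/d in s2.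
have d0 : 0 <= d := nrm_ge0 _.
set X := (1%:M - G' *m J') *m (G *m J) in s1.
set Y := (1%:M - J *m G) *m (J' *m G') in s2.
have E : G' - G = - (G' *m (J' - J) *m G) + G' *m adj Y - X *m G.
  have -> : G' *m adj Y = G' - G' *m J *m G.
    by rewrite /Y adj_mulmx adj_sub Q1 Q1' adj_1mx !mulmxA GJG' mulmxBr mulmx1 mulmxA.
  have -> : X *m G = G - G' *m J' *m G by rewrite /X -mulmxA GJG mulmxBl mul1mx.
  by rewrite mulmxBr mulmxBl !opprB [X in _ = X + _]addrC [X in _ = X + _]addrA subrK addrA subrK.
rewrite E; apply: le_trans (nrmB _ _) _; rewrite mulrDl; apply: le_trans (lerD (nrmD _ _) (lexx _)) _.
rewrite nrmN.
have h1 : nrm (G' *m (J' - J) *m G) <= g * g * d.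
  apply: le_trans (nrmM _ _) _; rewrite mulrAC; apply: ler_pM; rewrite ?nrm_ge0 //.
  by apply: le_trans (nrmM _ _) _; apply: ler_wpM2r.
have h2 : nrm (G' *m adj Y) <= g * (c * d).
  apply: le_trans (nrmM _ _) _; rewrite nrm_adj; apply: ler_pM; rewrite ?nrm_ge0 //.
  by apply: le_trans s2; rewrite lerDr nrm_ge0.
have h3 : nrm (X *m G) <= c * d * g.
  apply: le_trans (nrmM _ _) _; apply: ler_pM; rewrite ?nrm_ge0 //.
  by apply: le_trans s1; rewrite lerDl nrm_ge0.
have -> : 2 * (g * c) * d = g * (c * d) + c * d * g by ring.
by rewrite -addrA; apply: lerD => //; apply: lerD.
Qed.

End OuterInverse.

(** * Perturbation of singular values and of the truncated pseudo-inverse *)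

Section SingularValues.
Variables (R : realType) (F : ground) (l m : nat).
Local Notation K := (scalarField R F).
Local Notation md := (@modulus R F).
Local Notation ofr := (@of_real R F).
Local Notation nrm := (@nrm R F _ _).
Local Notation q := (minn l m).

Lemma nrm_rdiag p (s : 'I_p -> R) : nrm (rdiag F s) = \sum_j `|s j|.
Proof.
apply: eq_bigr => i _; rewrite (bigD1 i) //= big1 ?addr0 => [|j ji].
  by rewrite !mxE eqxx mulr1n modulus_of_real.
by rewrite !mxE eq_sym (negPf ji) mulr0n modulus0.
Qed.

Lemma nrm_orthonormal n p (U : 'M[K]_(n, p)) : adj U *m U = 1%:M -> nrm U <= (n * p)%:R.
Proof.
move=> UU; rewrite -[leRHS]mulr1; apply: nrm_le_entries => i j.
have /matrixP/(_ j j) := UU; rewrite !mxE eqxx.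
have -> : \sum_k (adj U) j k * U k j = ofr (\sum_k md (U k j) ^+ 2).
  rewrite (big_morph ofr (@of_realD R F) (@of_real0 R F)).
  by apply: eq_bigr => k _; rewrite modulus_sqr !mxE.
rewrite -[X in _ = X](of_real1 R F) => /of_real_inj U1.
rewrite -(@ler_pXn2r _ 2) ?nnegrE ?modulus_ge0 ?ler01 // expr1n -U1 (bigD1 i) //= lerDl.
by apply: sumr_ge0 => k _; apply: sqr_ge0.
Qed.

(** Bounds [nrm U * nrm V] for factors with orthonormal columns: the price of the sum norm, which is
    not unitarily invariant. *)
Let kap : R := (l * q)%:R * (m * q)%:R.

Let kap0 : 0 <= kap. Proof. by rewrite mulr_ge0. Qed.

Lemma nrm_svd_le (U : 'M[K]_(l, q)) (s : 'I_q -> R) (V : 'M[K]_(m, q)) :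
  adj U *m U = 1%:M -> adj V *m V = 1%:M ->
  nrm (U *m rdiag F s *m adj V) <= kap * \sum_j `|s j|.
Proof.
move=> UU VV; apply: le_trans (nrmM _ _) _; rewrite nrm_adj.
have := nrmM U (rdiag F s); rewrite nrm_rdiag => h.
have hU := nrm_orthonormal UU; have hV := nrm_orthonormal VV.
rewrite /kap mulrAC; apply: ler_pM; rewrite ?nrm_ge0 //.
apply: le_trans h _; apply: ler_wpM2r => //; exact: sumr_ge0.
Qed.

Lemma pid_mx_rdiag p k : pid_mx k = rdiag F (fun j : 'I_p => (j < k)%:R : R).
Proof.
apply/matrixP => i j; rewrite !mxE -val_eqE /=; case: eqVneq => //= _; rewrite ?mulr0n // mulr1n.
by case: (_ < _)%N; rewrite ?of_real1 ?of_real0.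
Qed.

Variables (A : 'M[K]_(l, m)).

(** Weyl's inequality up to [kap]. The first [j.+1] right singular directions span a space of
    dimension greater than [\rank A], so some nonzero vector in it is killed by [A]. On that vector
    [J] acts as [J - A], and in singular coordinates it stretches by at least [s j]. *)
Lemma singular_value_small (J : 'M[K]_(l, m)) (U : 'M[K]_(l, q)) (s : 'I_q -> R) (V : 'M[K]_(m,
  q)) (j : 'I_q) :
  adj U *m U = 1%:M -> adj V *m V = 1%:M -> (forall j, 0 <= s j) ->
  (forall i j : 'I_q, (i <= j)%N -> s j <= s i) -> J = U *m rdiag F s *m adj V ->
  (\rank A <= j)%N -> s j <= kap * nrm (J - A).
Proof.
move=> UU VV s0 sm JE Aj.
have [|w [Aw Ew]] := @ker_witness R F l q q (A *m V *m pid_mx j.+1) (pid_mx j.+1).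
  rewrite rank_pid_mx // ltnS; apply: leq_trans Aj.
  by rewrite -mulmxA; apply: mxrankM_maxl.
set c := pid_mx j.+1 *m w in Ew.
have sc : rdiag F s *m c = adj U *m (J - A) *m V *m c.
  have Ac : A *m (V *m c) = 0 by rewrite /c !mulmxA.
  rewrite -2!mulmxA mulmxBl Ac subr0.
  by rewrite JE !mulmxA UU mul1mx -(mulmxA _ (adj V)) VV mulmx1.
have c0 (i : 'I_q) : (j < i)%N -> c i 0 = 0.
  move=> ji; rewrite /c !mxE big1 // => k _; rewrite !mxE.
  by rewrite (leqNgt i.+1) ltnS ji andbF mul0r.
have h1 : s j * nrm c <= nrm (rdiag F s *m c).
  rewrite !nrm_col mulr_sumr; apply: ler_sum => i _.
  rewrite /rdiag mul_diag_mx !mxE modulusM modulus_of_real ger0_norm //.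
  have [ij|ji] := leqP i j; first by apply: ler_wpM2r; rewrite ?modulus_ge0 // sm.
  by move: (c0 i ji); rewrite mxE => ->; rewrite modulus0 !mulr0.
rewrite -(ler_pM2r (nrm_gt0 Ew)); apply: le_trans h1 _; rewrite sc.
apply: le_trans (nrmM _ _) _; apply: ler_wpM2r; first exact: nrm_ge0.
apply: le_trans (nrmM _ _) _; apply: (@le_trans _ _ (nrm U * nrm (J - A) * nrm V)).
  by apply: ler_wpM2r; [apply: nrm_ge0|rewrite -(nrm_adj U); apply: nrmM].
rewrite /kap [leRHS]mulrAC; apply: ler_pM; rewrite ?mulr_ge0 ?nrm_ge0 ?nrm_orthonormal //.
by apply: ler_wpM2r; rewrite ?nrm_ge0 ?nrm_orthonormal.
Qed.

(** The truncation [T] of [J] to its first [j] singular values has smaller rank than [A], so there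
    is [w = X A z] with [T w = 0] and [A w != 0]. Then [w = X A w] and
    [A w = (A - J) w + (J - T) w], where [J - T] is of order [s j]; dividing by [nrm w] gives the
    bound. *)
Lemma singular_value_large (X : 'M[K]_(m, l)) (J : 'M[K]_(l, m))
    (U : 'M[K]_(l, q)) (s : 'I_q -> R) (V : 'M[K]_(m, q)) (j : 'I_q) :
  adj U *m U = 1%:M -> adj V *m V = 1%:M -> (forall j, 0 <= s j) ->
  (forall i j : 'I_q, (i <= j)%N -> s j <= s i) -> J = U *m rdiag F s *m adj V ->
  (j < \rank A)%N -> A *m X *m A = A ->
  1 <= nrm X * (nrm (J - A) + kap * q%:R * s j).
Proof.
move=> UU VV s0 sm JE jA AXA.
pose T := U *m rdiag F (fun i => if (i < j)%N then s i else 0) *m adj V.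
have Trank : (\rank T <= j)%N.
  have -> : T = U *m rdiag F s *m pid_mx j *m adj V.
    rewrite /T pid_mx_rdiag -(mulmxA U (rdiag F s)) rdiagM; congr (_ *m rdiag F _ *m _).
    by apply/funext => i; case: (i < j)%N; rewrite ?mulr1 ?mulr0.
  apply: leq_trans (mxrankM_maxl _ _) _; apply: leq_trans (mxrankM_maxr _ _) _.
  by rewrite rank_pid_mx // ltnW.
have [|z [Tz Az]] := @ker_witness R F l l m (T *m X *m A) A.
  apply: leq_ltn_trans jA; apply: leq_trans Trank.
  by rewrite -mulmxA; apply: mxrankM_maxl.
pose w := X *m (A *m z).
have Aw : A *m w = A *m z by rewrite /w !mulmxA AXA.
have Tw : T *m w = 0 by rewrite /w !mulmxA.
have w0 : 0 < nrm w by apply: nrm_gt0; apply: contraNneq Az => w0; rewrite -Aw w0 mulmx0.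
have JT : nrm (J - T) <= kap * q%:R * s j.
  rewrite JE /T -mulmxBl -mulmxBr rdiagB; apply: le_trans (nrm_svd_le _ UU VV) _.
  rewrite -mulrA; apply: ler_wpM2l => //; rewrite -[leRHS]mulr1 -mulrA mulr_natl.
  rewrite -[X in _ *+ X]card_ord -sumr_const mulr1; apply: ler_sum => i _.
  have [ij|ji] := ltnP i j; first by rewrite subrr normr0.
  by rewrite subr0 ger0_norm // sm.
rewrite -(ler_pM2r w0) mul1r.
apply: (@le_trans _ _ (nrm (X *m (A *m w)))); first by rewrite Aw.
rewrite -(mulrA (nrm X)); apply: le_trans (nrmM _ _) _; apply: ler_wpM2l; first exact: nrm_ge0.
have -> : A *m w = (A - J) *m w + (J - T) *m w by rewrite -mulmxDl addrA subrK mulmxBl Tw subr0.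
apply: le_trans (nrmD _ _) _; rewrite mulrDl; apply: lerD.
  by rewrite nrmC; apply: nrmM.
by apply: le_trans (nrmM _ _) _; apply: ler_wpM2r; rewrite ?nrm_ge0.
Qed.

Lemma rank_proj_rank : rank_proj (\rank A) A = A.
Proof.
have [U [s [V [s0 sm [UU VV] AE ->]]]] := rank_proj_svd (\rank A) A.
rewrite [RHS]AE; congr (_ *m rdiag F _ *m _); apply/funext => j.
case: ltnP => // Aj; have := singular_value_small UU VV s0 sm AE Aj.
by rewrite subrr nrm0 mulr0 => sj; apply/eqP; rewrite eq_le s0 sj.
Qed.

Lemma rank_proj_gap_inverse : exists b g rho : R, 0 < rho /\
  forall J, nrm (J - A) < rho -> gap_inverse b g J (mpinv (rank_proj (\rank A) J)).
Proof.
have [AXA _ _ _] := mpinvP A; set X := mpinv A in AXA.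
set r := \rank A; pose x := nrm X + 1; have x0 : 0 < x by rewrite ltr_wpDl ?nrm_ge0.
pose k := kap * q%:R + 1; have k0 : 0 < k by rewrite ltr_wpDl ?mulr_ge0.
(* Below [rho1] the term with [J - A] in [singular_value_large] is at most 1/2, which leaves [c] as
   a lower bound for the first [r] singular values and [g] as a bound for the pseudo-inverse. Below
   [rho2] the discarded part, at most [e * nrm (J - A)], is small against [g]. *)
pose c := 1 / (2 * x * k); have c0 : 0 < c by rewrite divr_gt0 ?mulr_gt0.
pose g := kap * (q%:R / c); have g0 : 0 <= g by apply: mulr_ge0 => //; apply: divr_ge0 => //; exact: ltW.
pose rho1 := 1 / (2 * x); pose e := kap * (q%:R * kap); pose rho2 := 1 / (2 * (g + 1) * (e + 1)).
have rho10 : 0 < rho1 by rewrite divr_gt0 ?mulr_gt0.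
have e0 : 0 <= e by rewrite !mulr_ge0.
have p1 : 0 < e + 1 by rewrite ltr_wpDl.
have p3 : 0 < g + 1 by rewrite ltr_wpDl.
have rho20 : 0 < rho2 by rewrite divr_gt0 ?mulr_gt0.
exists (nrm A + rho1), g, (Num.min rho1 rho2); split; first by rewrite lt_min rho10.
move=> J; rewrite lt_min => /andP[J1 J2].
have [U [s [V [s0 sm [UU VV] JE ->]]]] := rank_proj_svd r J.
pose t (j : 'I_q) := if (j < r)%N then s j else 0.
rewrite (mpinv_eq (moore_penrose_svd t UU VV)); set G := V *m _ *m adj U.
have large (j : 'I_q) : (j < r)%N -> c <= s j.
  move=> jr; have := singular_value_large UU VV s0 sm JE jr AXA => h.
  have h1 : nrm X * (nrm (J - A) + kap * q%:R * s j) <= x * (nrm (J - A) + k * s j).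
    have h2 : kap * q%:R * s j <= k * s j by apply: ler_wpM2r => //; rewrite lerDl.
    apply: ler_pM; rewrite ?nrm_ge0 ?lerDl ?lerD2l // addr_ge0 ?nrm_ge0 //.
    by rewrite mulr_ge0 // mulr_ge0.
  have h3 : x * nrm (J - A) <= 1 / 2.
    apply: (@le_trans _ _ (x * rho1)); first by rewrite ler_pM2l // ltW.
    by rewrite /rho1 le_eqVlt; apply/predU1P; left; field; rewrite gt_eqF.
  rewrite /c ler_pdivrMr ?mulr_gt0 //.
  have -> : s j * (2 * x * k) = 2 * (x * (k * s j)) by ring.
  by rewrite mulrDr in h1; lra.
have st (j : 'I_q) : s j * (t j)^-1 = (j < r)%:R.
  rewrite /t; case: ltnP => [jr|_]; last by rewrite invr0 mulr0.
  by rewrite divff // gt_eqF // (lt_le_trans c0) // large.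
have JG : J *m G = U *m rdiag F (fun j => (j < r)%:R) *m adj U.
  rewrite JE /G !mulmxA -(mulmxA _ (adj V)) VV mulmx1 -(mulmxA U) rdiagM.
  by congr (_ *m rdiag F _ *m _); apply/funext.
have GJ : G *m J = V *m rdiag F (fun j => (j < r)%:R) *m adj V.
  rewrite JE /G !mulmxA -(mulmxA _ (adj U)) UU mulmx1 -(mulmxA V) rdiagM.
  by congr (_ *m rdiag F _ *m _); apply/funext => j; rewrite mulrC.
split.
- rewrite GJ /G !mulmxA -(mulmxA _ (adj V)) VV mulmx1 -(mulmxA V) rdiagM.
  congr (_ *m rdiag F _ *m _); apply/funext => j; rewrite /t.
  by case: ltnP => _; rewrite ?mul1r // mul0r invr0.
- by rewrite GJ !adj_mulmx adj_adj adj_rdiag mulmxA.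
- by rewrite JG !adj_mulmx adj_adj adj_rdiag mulmxA.
- split.
    rewrite -[J](subrK A) addrC; apply: le_trans (nrmD _ _) _; rewrite lerD2l; exact: ltW.
  have -> : nrm G = nrm (U *m rdiag F (fun j => (t j)^-1) *m adj V).
    by rewrite -nrm_adj /G !adj_mulmx adj_adj adj_rdiag mulmxA.
  apply: le_trans (nrm_svd_le _ UU VV) _; apply: ler_wpM2l => //.
  rewrite mulr_natl -[X in _ *+ X]card_ord -sumr_const; apply: ler_sum => j _.
  rewrite /t; case: ltnP => [jr|_]; last by rewrite invr0 normr0 invr_ge0 ltW.
  have sj := large j jr; have sj0 := lt_le_trans c0 sj.
  have sj' : 0 <= (s j)^-1 by rewrite invr_ge0 ltW.
  by rewrite ger0_norm // lef_pV2 ?posrE.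
have JGJ : J *m G *m J = U *m rdiag F t *m adj V.
  rewrite JG JE !mulmxA -(mulmxA _ (adj U)) UU mulmx1 -(mulmxA U) rdiagM.
  congr (_ *m rdiag F _ *m _); apply/funext => j; rewrite /t.
  by case: ltnP => _; rewrite ?mul1r ?mul0r.
have RE : J - J *m G *m J = U *m rdiag F (fun j => s j - t j) *m adj V.
  by rewrite JGJ {1}JE -mulmxBl -mulmxBr rdiagB.
have Rle : nrm (J - J *m G *m J) <= e * nrm (J - A).
  rewrite RE; apply: le_trans (nrm_svd_le _ UU VV) _; rewrite /e -mulrA; apply: ler_wpM2l => //.
  have -> : q%:R * kap * nrm (J - A) = \sum_(j < q) kap * nrm (J - A).
    by rewrite sumr_const card_ord -[RHS]mulr_natl mulrA.
  apply: ler_sum => j _.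
  rewrite /t; case: ltnP => [jr|rj]; first by rewrite subrr normr0 mulr_ge0 ?nrm_ge0.
  by rewrite subr0 ger0_norm // (singular_value_small UU VV s0 sm JE).
have h1 : nrm (J - J *m G *m J) <= (e + 1) * rho2.
  apply: le_trans Rle _; apply: ler_pM => //; [exact: nrm_ge0|lra|exact: ltW].
have h2 : 2 * g <= 2 * (g + 1) by lra.
have h3 : 0 <= 2 * g by lra.
apply: le_trans (ler_pM h3 (nrm_ge0 _) h2 h1) _.
by rewrite /rho2 le_eqVlt; apply/predU1P; left; field; rewrite !gt_eqF.
Qed.

End SingularValues.

(** * The Poincare-Miranda theorem *)

Section CubicalCup.
Variable I : eqType.
Local Notation pt := (I -> nat).
Local Notation F2 := 'F_2.
Local Notation fn := (pt -> F2).

Definition upd (v : pt) (i : I) (t : nat) : pt := fun j => if j == i then t else v j.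
Definition step i (v : pt) : pt := upd v i (v i).+1.
Definition dif i (g : fn) : fn := fun v => g (step i v) - g v.

(* The cup product of the coboundaries of [bs], evaluated on the unit cube
   spanned by the directions [S] at a lattice point. *)
Fixpoint cup (bs : seq fn) (S : seq I) : fn :=
  if bs is b :: bs' then
    fun v => \sum_(j <- S) dif j b v * cup bs' [seq i <- S | i != j] (step j v)
  else fun=> 1.

Lemma updC v i j s t : i != j -> upd (upd v i s) j t = upd (upd v j t) i s.
Proof.
move=> ij; apply/funext => k; rewrite /upd; case: eqVneq => // kj; case: eqVneq => // ki.
by rewrite -kj -ki eqxx in ij.
Qed.

Lemma stepC v i j : i != j -> step i (step j v) = step j (step i v).
Proof.
by move=> ij; rewrite /step updC 1?eq_sym // /upd (negPf ij) eq_sym (negPf ij).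
Qed.

Lemma addFF (x : F2) : x + x = 0.
Proof. exact: (addrr_pchar2 (pchar_Fp (isT : prime 2))). Qed.

Lemma subFF (x y : F2) : x - y = x + y.
Proof. by apply/eqP; rewrite subr_eq -addrA addFF addr0. Qed.

Lemma symmetric_sum0 (A : I -> I -> F2) (S : seq I) : uniq S -> (forall i j, i != j -> A i j = A j i) ->
  \sum_(j <- S) \sum_(i <- S | i != j) A i j = 0.
Proof.
move=> + As; elim: S => [|x S IH] /=; first by rewrite big_nil.
move=> /andP[xS uS]; rewrite big_cons big_cons eqxx /=.
have -> : \sum_(j <- S) \sum_(i <- x :: S | i != j) A i j =
    \sum_(j <- S) A x j + \sum_(j <- S) \sum_(i <- S | i != j) A i j.
  rewrite -big_split; apply: eq_big_seq => j jS /=; rewrite big_cons ifT //.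
  by apply: contraNneq xS => ->.
rewrite (IH uS) addr0 (big_seq_cond) (eq_bigl (fun i => i \in S)) => [|i]; last first.
  by case: (boolP (i \in S)) => //= iS; apply: contraNneq xS => <-.
rewrite -big_seq -[LHS]/(_ + _) (_ : \sum_(i <- S) A i x = \sum_(i <- S) A x i) ?addFF //.
by apply: eq_big_seq => i iS; apply: As; apply: contraNneq xS => <-.
Qed.

Lemma difM i (f g : fn) v : dif i (fun w => f w * g w) v = dif i f v * g (step i v) + f v * dif i g v.
Proof. by rewrite /dif mulrBl mulrBr addrA subrK. Qed.

Lemma dif_sum i (S : seq I) (P : pred I) (f : I -> fn) v :
  dif i (fun w => \sum_(j <- S | P j) f j w) v = \sum_(j <- S | P j) dif i (f j) v.
Proof. by rewrite /dif -sumrB. Qed.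

(** Leibniz rule: the first factor contributes mixed second differences, symmetric in the two
    directions and so cancelling modulo 2; the other factors contribute 0 by induction. Coefficients
    in [F_2] dispense with orientation signs. *)
Lemma cup_closed bs S v : uniq S ->
  \sum_(j <- S) dif j (cup bs [seq i <- S | i != j]) v = 0.
Proof.
elim: bs S v => [|b bs IH] S v uS /=.
  by rewrite big1 // => j _; rewrite /dif subrr.
pose om i j := cup bs [seq k <- S | (k != i) && (k != j)].
have omC i j : om i j = om j i by rewrite /om; congr cup; apply: eq_filter => k; rewrite andbC.
have omE i j : cup bs [seq k <- [seq k <- S | k != j] | k != i] = om i j.
  by rewrite /om -filter_predI.
transitivity (\sum_(j <- S) (\sum_(i <- S | i != j) dif j (dif i b) v * om i j (step i (step j v)) +
   \sum_(i <- S | i != j) dif i b v * dif j (om i j) (step i v))).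
  apply: eq_bigr => j _; rewrite -big_split.
  transitivity (\sum_(i <- S | i != j) dif j (fun w => dif i b w * om i j (step i w)) v).
    rewrite -dif_sum; rewrite /dif; congr (_ - _).
      by rewrite big_filter; apply: eq_bigr => i _; rewrite omE.
    by rewrite big_filter; apply: eq_bigr => i _; rewrite omE.
  apply: eq_bigr => i ij; rewrite difM; congr (_ + _ * _).
  by rewrite /dif stepC.
rewrite big_split /= symmetric_sum0 // => [|i j ij]; last first.
  rewrite omC stepC //; congr (_ * _).
  rewrite /dif !subFF stepC //; ring.
rewrite add0r (exchange_big_dep predT) //= big1_seq // => i /andP[_ iS].
rewrite -mulr_sumr.
have := IH [seq k <- S | k != i] (step i v); rewrite big_filter filter_uniq // => /(_ isT) H.
rewrite (eq_bigl (fun j => j != i)) => [|j]; last by rewrite eq_sym.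
rewrite (eq_bigr (fun j => dif j (cup bs [seq k <- [seq k <- S | k != i] | k != j]) (step i v))) ?H ?mulr0 //.
by move=> j _; rewrite omC -omE.
Qed.

Lemma cup_coboundary b bs S v : uniq S ->
  cup (b :: bs) S v = \sum_(j <- S) dif j (fun w => b w * cup bs [seq i <- S | i != j] w) v.
Proof.
move=> uS; under [RHS]eq_bigr do rewrite difM.
by rewrite big_split /= -mulr_sumr cup_closed // mulr0 addr0.
Qed.

Variable N : nat.

Fixpoint box (S : seq I) (g : fn) : fn :=
  if S is i :: S' then fun v => \sum_(0 <= t < N) box S' g (upd v i t) else g.

Lemma box_sum S (J : Type) (r : seq J) (f : J -> fn) v :
  box S (fun w => \sum_(k <- r) f k w) v = \sum_(k <- r) box S (f k) v.
Proof.
elim: S v => [//|i S IH] v /=; rewrite exchange_big; apply: eq_bigr => t _; exact: IH.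
Qed.

Lemma eq_box S (f g : fn) v : (forall w, f w = g w) -> box S f v = box S g v.
Proof. by move=> fg; congr box; apply/funext. Qed.

Lemma box_upd S g v j t : j \notin S -> box S g (upd v j t) = box S (fun w => g (upd w j t)) v.
Proof.
elim: S v => [//|i S IH] v /=; rewrite inE negb_or => /andP[ji jS].
by apply: eq_bigr => s _; rewrite updC // IH.
Qed.

Lemma box_extract S g v j : uniq S -> j \in S ->
  box S g v = box [seq i <- S | i != j] (fun w => \sum_(0 <= t < N) g (upd w j t)) v.
Proof.
elim: S v => [//|i S IH] v /= /andP[iS uS]; rewrite inE eq_sym; have [<- _|ij /= jS] := eqVneq i j.
  have -> : [seq k <- S | k != i] = S.
    by apply/all_filterP/allP => k kS; apply: contraNneq iS => <-.
  by rewrite box_sum; apply: eq_bigr => t _; rewrite box_upd.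
by apply: eq_bigr => t _; apply: IH.
Qed.

(** Telescoping in direction [j]: the discrete Stokes formula. *)
Lemma box_dif S g v j : uniq S -> j \in S ->
  box S (dif j g) v = box [seq i <- S | i != j] (fun w => g (upd w j N) - g (upd w j 0)) v.
Proof.
move=> uS jS; rewrite (box_extract _ _ uS jS); apply: eq_box => w.
rewrite -(telescope_sumr (fun t => g (upd w j t))) //; apply: eq_bigr => t _.
rewrite /dif /step; congr (g _ - _); apply/funext => k; rewrite /upd eqxx.
by case: eqVneq.
Qed.

(** Steps along [T] never leave the hyperplane where coordinate [i] equals [c], and there every
    difference of [b k] is zero. *)
Lemma cup_const_eq0 (J : eqType) (b : J -> fn) bs T w k i c a : k \in bs -> i \notin T ->
  w i = c -> (forall v : pt, v i = c -> b k v = a) -> cup (map b bs) T w = 0.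
Proof.
move=> + + + bk; elim: bs T w => [//|j bs IH] T w; rewrite inE => /predU1P[<-|kbs] iT wi /=.
  rewrite big1_seq // => e /andP[_ eT]; have ei : e != i by apply: contraNneq iT => <-.
  by rewrite /dif !bk ?subrr ?mul0r // /step /upd eq_sym (negPf ei).
rewrite big1_seq // => e /andP[_ eT]; have ei : e != i by apply: contraNneq iT => <-.
rewrite IH ?mulr0 //; first by rewrite mem_filter negb_and iT orbT.
by rewrite /step /upd eq_sym (negPf ei).
Qed.

Lemma box0 S v : box S (fun=> 0) v = 0.
Proof. by elim: S v => [//|e S IH] v /=; rewrite big1. Qed.

(** A degree computation by induction on the dimension. Written as a coboundary, the cup product
    sums to its values on the faces. On the two faces normal to the head [i] the factor [b i] is 0
    or 1, which leaves the sum of one dimension less; on a face normal to another [j] the label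
    [b j] is constant, so the product vanishes. *)
Lemma box_cup (b : I -> fn) S v : (forall i w, w i = 0%N -> b i w = 0) ->
  (forall i w, w i = N -> b i w = 1) -> uniq S -> box S (cup (map b S) S) v = 1.
Proof.
move=> b0 b1; elim: S v => [//|i S IH] v uS; have /andP[iS uS'] := uS.
have -> : box (i :: S) (cup (map b (i :: S)) (i :: S)) v =
  \sum_(j <- i :: S) box (i :: S) (dif j (fun w => b i w * cup (map b S) [seq k <- i :: S | k != j] w)) v.
  by rewrite -box_sum; apply: eq_box => w; rewrite -cup_coboundary.
have Si : [seq k <- i :: S | k != i] = S.
  by rewrite /= eqxx /=; apply/all_filterP/allP => k kS; apply: contraNneq iS => <-.
rewrite big_cons [X in _ + X]big1_seq ?addr0 => [|j /andP[_ jS]]; last first.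
  rewrite box_dif // ?inE ?jS ?orbT //.
  rewrite (@eq_box _ _ (fun=> 0)) ?box0 // => w.
  have jT : j \notin [seq k <- i :: S | k != j] by rewrite mem_filter eqxx.
  rewrite (cup_const_eq0 jS jT (erefl _) (a := 1)) => [|u]; last first.
    by rewrite /upd eqxx; apply: b1.
  rewrite (cup_const_eq0 jS jT (erefl _) (a := 0)) ?mulr0 ?subrr // => u.
  by rewrite /upd eqxx; apply: b0.
rewrite box_dif ?inE ?eqxx // Si -(IH (upd v i N) uS') box_upd //; apply: eq_box => w.
by rewrite b1 ?mul1r ?b0 ?mul0r ?subr0 // /upd eqxx.
Qed.

Lemma box_neq0 S g v : uniq S -> box S g v != 0 ->
  exists w, [/\ g w != 0, forall i, i \in S -> (w i < N)%N & forall i, i \notin S -> w i = v i].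
Proof.
elim: S v => [|i S IH] v /=; first by exists v.
move=> /andP[iS uS] gv.
have [t tN gt] : exists2 t, (t < N)%N & box S g (upd v i t) != 0.
  apply: contrapT => ng; move: gv; rewrite big_nat big1 ?eqxx // => t /andP[_ tN].
  by apply/eqP; apply: contra_notT ng => gt; exists t.
have [w [gw wN wv]] := IH _ uS gt; exists w; split=> // j.
  by rewrite inE => /predU1P[->|/wN //]; rewrite wv // /upd eqxx.
by rewrite inE negb_or => /andP[ji /wv ->]; rewrite /upd (negPf ji).
Qed.

(** A nonzero term of the product is a path of unit steps along which every label changes at its own
    step; it stays in one unit cube because each direction is used at most once. *)
Lemma cup_neq0 (J : eqType) (b : J -> fn) bs T w : uniq T -> cup (map b bs) T w != 0 ->
  forall k, k \in bs -> exists w1 w2 : pt,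
  [/\ b k w1 != b k w2, forall i, (w i <= w1 i <= w i + 1)%N & forall i, (w i <= w2 i <= w i + 1)%N].
Proof.
move=> uT cw k kbs.
suff [w1 [w2 [bw h1 h2]]] : exists w1 w2 : pt, [/\ b k w1 != b k w2,
    forall i, (w i <= w1 i <= w i + (i \in T))%N & forall i, (w i <= w2 i <= w i + (i \in T))%N].
  exists w1, w2; split=> // i.
    by have /andP[-> /leq_trans] := h1 i; apply; rewrite leq_add2l leq_b1.
  by have /andP[-> /leq_trans] := h2 i; apply; rewrite leq_add2l leq_b1.
elim: bs T w uT cw kbs => [//|j bs IH] T w uT /= cw.
have [e eT ew] : exists2 e, e \in T & dif e (b j) w * cup (map b bs) [seq i <- T | i != e] (step e w) != 0.
  apply: contrapT => ne; move: cw; rewrite big1_seq ?eqxx // => e /andP[_ eT].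
  by apply/eqP; apply: contra_notT ne => ?; exists e.
move: ew; rewrite mulf_eq0 negb_or => /andP[dj cj]; rewrite inE => /predU1P[->|kbs].
  exists (step e w), w; split=> [|i|i]; first by rewrite -subr_eq0.
    by rewrite /step /upd; case: eqVneq => [->|_]; [rewrite eT addn1 leqnSn leqnn|rewrite leqnn leq_addr].
  by rewrite leqnn leq_addr.
have [w1 [w2 [bw h1 h2]]] := IH _ _ (filter_uniq _ uT) cj kbs.
have le u : (forall i, (step e w i <= u i <= step e w i + (i \in [seq i <- T | i != e]))%N) ->
    forall i, (w i <= u i <= w i + (i \in T))%N.
  move=> hu i; have := hu i; rewrite /step /upd mem_filter; case: eqVneq => [->|_] //=.
  by rewrite eT addn0 addn1 => /andP[/ltnW -> ->].
by exists w1, w2; split=> //; apply: le.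
Qed.

End CubicalCup.

(** * Sign changes on a grid and passage to the limit *)

Section PoincareMiranda.
Variables (R : realType) (d : nat) (F : 'rV[R]_d -> 'I_d -> R) (r : R).
Hypothesis r0 : 0 < r.
Let cube : set 'rV[R]_d := [set x | forall i, -r <= x 0 i <= r].
Hypothesis F_continuous : forall (x : 'rV[R]_d) i (e : R), cube x -> 0 < e -> exists2 t : R, 0 < t &
  forall y : 'rV[R]_d, cube y -> (forall j, `|y 0 j - x 0 j| < t) -> `|F y i - F x i| < e.
Hypothesis F_low : forall x i, cube x -> x 0 i = -r -> F x i <= 0.
Hypothesis F_high : forall x i, cube x -> x 0 i = r -> 0 <= F x i.

Let grid N (v : 'I_d -> nat) : 'rV[R]_d := \row_i (- r + (2 * r / N%:R) * (v i)%:R).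

Lemma grid_sign_change N : (0 < N)%N -> exists2 x, cube x & forall i, exists y z,
  [/\ cube y, cube z, F y i <= 0, 0 <= F z i &
      forall j, `|y 0 j - x 0 j| <= 2 * r / N%:R /\ `|z 0 j - x 0 j| <= 2 * r / N%:R].
Proof.
move=> N0; have N0' : (0 : R) < N%:R by rewrite ltr0n.
(* The label is forced on the two extreme faces, because [F] may vanish there and its sign would not
   decide; [F_low] and [F_high] keep the forced labels consistent with weak signs. *)
pose b (i : 'I_d) (v : 'I_d -> nat) : 'F_2 := ((v i == N) || (v i != 0%N) && (0 <= F (grid N v) i))%:R.
have b0 i w : w i = 0%N -> b i w = 0 by rewrite /b => ->; rewrite eqxx /= orbF eq_sym gtn_eqF.
have b1 i w : w i = N -> b i w = 1 by rewrite /b => ->; rewrite eqxx.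
have := box_cup (fun=> 0%N) b0 b1 (enum_uniq 'I_d) => bc.
have [|w [cw wN _]] :=
  @box_neq0 _ N (enum 'I_d) (cup (map b (enum 'I_d)) (enum 'I_d)) (fun=> 0%N) (enum_uniq _).
  by rewrite bc oner_eq0.
have cube_grid v : (forall i, (v i <= N)%N) -> cube (grid N v).
  move=> vN i; rewrite mxE.
  have h0 : 0 <= 2 * r / N%:R * (v i)%:R by rewrite !mulr_ge0 ?invr_ge0 // ltW.
  have h1 : 2 * r / N%:R * (v i)%:R <= 2 * r.
    by rewrite mulrAC ler_pdivrMr // ler_wpM2l ?ler_nat // mulr_ge0 // ltW.
  by apply/andP; split; lra.
have wlt i : (w i < N)%N by apply: wN; rewrite mem_enum.
exists (grid N w); first by apply: cube_grid => i; apply: ltnW.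
move=> i; have [w1 [w2 [bw h1 h2]]] := cup_neq0 (enum_uniq _) cw (mem_enum 'I_d i).
have near u : (forall i, (w i <= u i <= w i + 1)%N) -> cube (grid N u) /\
    forall j, `|grid N u 0 j - grid N w 0 j| <= 2 * r / N%:R.
  move=> hu; split.
    apply: cube_grid => j; have /andP[_ /leq_trans] := hu j; apply; rewrite addn1; exact: wlt.
  move=> j; rewrite !mxE opprD addrACA subrr add0r -mulrBr -natrB; last by have /andP[] := hu j.
  rewrite normrM ger0_norm ?divr_ge0 ?mulr_ge0 //; try exact: ltW.
  rewrite ler_piMr ?divr_ge0 ?mulr_ge0 //; try exact: ltW.
  by rewrite normr_nat (ler_nat _ _ 1) leq_subLR; have /andP[] := hu j.
have [c1 n1] := near _ h1; have [c2 n2] := near _ h2.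
have sg u : cube (grid N u) -> (b i u = 0 -> F (grid N u) i <= 0) /\ (b i u = 1 -> 0 <= F (grid N u) i).
  move=> cu; rewrite /b; case: eqVneq => [uN|uN] /=.
    split; first by move/eqP; rewrite oner_eq0.
    by move=> _; apply: F_high => //; rewrite mxE uN divfK ?gt_eqF //; ring.
  case: eqVneq => [u0|u0] /=.
    split=> [_|/eqP]; last by rewrite eq_sym oner_eq0.
    by apply: F_low => //; rewrite mxE u0 mulr0 addr0.
  case: lerP => [h|/ltW h]; split=> // /eqP; by rewrite ?oner_eq0 // eq_sym oner_eq0.
have b01 u : b i u = 0 \/ b i u = 1 by rewrite /b; case: (_ || _); [right|left].
have [s10 s11] := sg _ c1; have [s20 s21] := sg _ c2.
have [e1|e1] := b01 w1; have [e2|e2] := b01 w2.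
- by move: bw; rewrite e1 e2 eqxx.
- by exists (grid N w1), (grid N w2); split=> //; [exact: s10|exact: s21].
- by exists (grid N w2), (grid N w1); split=> //; [exact: s20|exact: s11].
- by move: bw; rewrite e1 e2 eqxx.
Qed.

Lemma cube_cluster (x_ : nat -> 'rV[R]_d) : (forall N, cube (x_ N)) ->
  exists2 x, cube x & forall (e : R) N, 0 < e -> exists2 M, (N <= M)%N & forall j, `|x_ M 0 j - x 0 j| < e.
Proof.
move=> xc.
have cc : compact cube.
  have -> : cube = [set v : 'rV[R]_d | forall i, `[-r, r]%classic (v ord0 i)].
    by apply/seteqP; split=> x xr i /=; have := xr i; rewrite /= in_itv /=.
  by apply: (rV_compact (A := fun=> `[-r, r]%classic)) => _; apply: segment_compact.
have xF : (x_ @ \oo) cube by exists 0%N => // N _; apply: xc.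
have [x [cx xcl]] := cc (x_ @ \oo) _ xF.
exists x => // e N e0.
have [y [[M NM <-] yM]] : [set y | exists2 M, (N <= M)%N & x_ M = y] `&` ball x e !=set0.
  apply: xcl; last exact: nbhsx_ballx.
  by exists N => // M /= NM; exists M.
exists M => // j; case: yM => _ /(_ 0 j); rewrite /ball /= distrC //.
Qed.

Theorem poincare_miranda : exists2 x, cube x & forall i, F x i = 0.
Proof.
have /choice[x_ xP] : forall N, exists x, cube x /\ forall i, exists y z,
  [/\ cube y, cube z, F y i <= 0, 0 <= F z i &
      forall j, `|y 0 j - x 0 j| <= 2 * r / N.+1%:R /\ `|z 0 j - x 0 j| <= 2 * r / N.+1%:R].
  by move=> N; have [x ? ?] := grid_sign_change (ltn0Sn N); exists x.
have [x cx xcl] := cube_cluster (fun N => (xP N).1).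
(* If [F x i] were nonzero it would keep a strict sign near [x], against the nearby grid points [y]
   and [z] of opposite weak signs. *)
exists x => // i; apply/eqP; rewrite -normr_eq0; apply: contraT => Fx.
have e0 : 0 < `|F x i| by rewrite lt0r Fx normr_ge0.
have [t t0 tP] := F_continuous i cx e0.
have t2 : 0 < t / 2 by rewrite divr_gt0.
pose N := Num.truncn (2 * r / (t / 2)).
have [M NM xM] := xcl (t / 2) N t2.
have Mt : 2 * r / M.+1%:R < t / 2.
  rewrite ltr_pdivrMr ?ltr0n // [X in _ < X]mulrC -ltr_pdivrMr //.
  apply: (@lt_le_trans _ _ N.+1%:R); last by rewrite ler_nat.
  by rewrite /N truncnS_gt.
have [y [z [cy cz Fy Fz yz]]] := (xP M).2 i.
have cl (u : 'rV[R]_d) : (forall j, `|u 0 j - x_ M 0 j| <= 2 * r / M.+1%:R) -> forall j,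
  `|u 0 j - x 0 j| < t.
  move=> h j; apply: le_lt_trans (ler_distD (x_ M 0 j) _ _) _; rewrite [t]splitr.
  by apply: ltrD (xM j); apply: le_lt_trans (h j) Mt.
have := tP y cy (cl y (fun j => (yz j).1)); have := tP z cz (cl z (fun j => (yz j).2)).
have [F0|F0] := lerP 0 (F x i);
  rewrite ?(ger0_norm F0) ?(ltr0_norm F0) !ltr_norml => /andP[h1 h2] /andP[h3 h4]; lra.
Qed.

End PoincareMiranda.

(** * Local surjectivity from an invertible derivative at one point *)

Section OpenImage.
Variables (R : realType) (F : ground) (k : nat).
Local Notation K := (scalarField R F).
Local Notation md := (@modulus R F).
Local Notation ofr := (@of_real R F).
Local Notation nrm := (@nrm R F _ _).

(** The real dimension is [k] or [2 k]; [c j] names the entry and the part that form the [j]-th real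
    coordinate. Over the reals both values of [b] give the same coordinate, so the second clause
    compares values instead of asking for [c j = (i, b)]. *)
Lemma real_coordinates : exists (d : nat) (c : 'I_d -> 'I_k * bool) (mk : 'rV[R]_d -> 'cV[K]_k),
  (forall x j, reim (c j).2 (mk x (c j).1 0) = x 0 j) /\
  (forall i b, exists j, forall v : 'cV[K]_k, reim b (v i 0) = reim (c j).2 (v (c j).1 0)).
Proof.
rewrite /reim; case: F => /=.
  exists k, (fun j => (j, true)), trmx; split=> [x j|i b]; first by rewrite mxE.
  by exists i.
exists (k + k)%N, (fun j : 'I_(k + k) => match fintype.split j with inl i => (i, true) | inr i => (i,
  false) end),
  (fun x => \col_i (x 0 (lshift k i) +i* x 0 (rshift k i))%C); split=> [x j|i b].
  by case: split_ordP => i -> /=; rewrite mxE.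
by case: b; [exists (lshift k i)|exists (rshift k i)]; case: split_ordP => j /eqP;
  rewrite ?(inj_eq (@lshift_inj _ _)) ?(inj_eq (@rshift_inj _ _)) ?eq_lrshift ?eq_rlshift // => /eqP ->.
Qed.

Lemma nrm_reim_le (v : 'cV[K]_k) e : (forall i b, `|reim b (v i 0)| <= e) -> nrm v <= (k * 1)%:R * (2 * e).
Proof.
move=> ve; apply: nrm_le_entries => i j; rewrite ord1; apply: le_trans (modulus_le_reim _) _.
by rewrite mulr2n mulrDl mul1r lerD.
Qed.

Lemma poincare_miranda_scalar (Psi : 'cV[K]_k -> 'cV[K]_k) (r : R) : 0 < r ->
  let cube (x : 'cV[K]_k) := forall i b, `|reim b (x i 0)| <= r in
  (forall x e, cube x -> 0 < e -> exists2 t : R, 0 < t &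
     forall y, cube y -> nrm (y - x) < t -> nrm (Psi y - Psi x) < e) ->
  (forall x i b, cube x -> reim b (x i 0) = - r -> reim b (Psi x i 0) <= 0) ->
  (forall x i b, cube x -> reim b (x i 0) = r -> 0 <= reim b (Psi x i 0)) ->
  exists2 x, cube x & Psi x = 0.
Proof.
move=> r0 cube Pc Pl Ph; have [d [c [mk [mkE cE]]]] := real_coordinates.
have cube_mk (x : 'rV[R]_d) : (forall j, -r <= x 0 j <= r) -> cube (mk x).
  by move=> xr i b; have [j ->] := cE i b; rewrite mkE ler_norml.
have [|||x xr Fx] := @poincare_miranda R d (fun x j => reim (c j).2 (Psi (mk x) (c j).1 0)) r r0.
- move=> x j e xr e0; have [t t0 tP] := Pc _ _ (cube_mk _ xr) e0.
  have k0 : 0 < (k * 1)%:R * 2 + 1 :> R by rewrite ltr_wpDl // mulr_ge0.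
  exists (t / ((k * 1)%:R * 2 + 1)) => [|y yr xy]; first exact: divr_gt0.
  rewrite -reimB; apply: le_lt_trans (reim_le _ _) _.
  have -> : Psi (mk y) (c j).1 0 - Psi (mk x) (c j).1 0 = (Psi (mk y) - Psi (mk x)) (c j).1 0.
    by rewrite !mxE.
  apply: le_lt_trans (modulus_le_nrm _ _ _) _; apply: tP; first exact: cube_mk.
  apply: (@le_lt_trans _ _ ((k * 1)%:R * (2 * (t / ((k * 1)%:R * 2 + 1))))).
    apply: nrm_reim_le => i b; have [j' ->] := cE i b.
    by rewrite !mxE reimB !mkE ltW.
  rewrite !mulrA ltr_pdivrMr // mulrC ltr_pM2l //; lra.
- by move=> x j xr xj; apply: Pl; [apply: cube_mk|rewrite mkE].
- by move=> x j xr xj; apply: Ph; [apply: cube_mk|rewrite mkE].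
exists (mk x); first exact: cube_mk.
apply: nrm_eq0; apply: le_trans (nrm_reim_le (e := 0) _) _; last by rewrite !mulr0.
by move=> i b; have [j ->] := cE i b; rewrite Fx normr0.
Qed.

(** Differentiability at [z] alone keeps [T^-1 (Phi (z + w) - y)] within [3 / 4 * r] of [w] on a
    cube of half-side [r]. It therefore has the signs of [w] on the faces, and the Poincare-Miranda
    theorem gives a zero. *)
Lemma open_image (Phi : 'cV[K]_k -> 'cV[K]_k) z T rho : 0 < rho ->
  (forall w, nrm (w - z) < rho -> {for w, continuous Phi}) ->
  fder Phi z T -> T \in unitmx ->
  exists2 tau : R, 0 < tau & forall y, nrm (y - Phi z) < tau ->
    exists2 w, nrm (w - z) < rho & Phi w = y.
Proof.
move=> rho0 Pc PT Tu; pose S := invmx T; pose s := nrm S + 1.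
have s0 : 0 < s by rewrite ltr_wpDl ?nrm_ge0.
pose kk : R := (k * 1)%:R * 2 + 1; have kk0 : 0 < kk by rewrite ltr_wpDl // mulr_ge0.
(* [kk] converts a bound on real coordinates into one on [nrm]. This error rate contributes [r / 2]
   to the deviation, and the radius [r / (4 * s)] allowed for [y] contributes [r / 4]. *)
have e0 : 0 < 1 / (2 * s * kk) by rewrite divr_gt0 // !mulr_gt0.
have [t t0 tP] := PT _ e0.
pose r := Num.min t rho / (2 * kk).
have r0 : 0 < r by rewrite divr_gt0 ?mulr_gt0 // lt_min t0.
have rk : r * kk < Num.min t rho.
  rewrite /r; have -> : Num.min t rho / (2 * kk) * kk = Num.min t rho / 2 by field; rewrite gt_eqF.
  have : 0 < Num.min t rho by rewrite lt_min t0.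
  lra.
have cube_nrm (w : 'cV[K]_k) : (forall i b, `|reim b (w i 0)| <= r) -> nrm w <= r * kk.
  move=> /nrm_reim_le /le_trans; apply; rewrite /kk; lra.
exists (r / (4 * s)) => [|y yz]; first by rewrite divr_gt0 // mulr_gt0.
pose Psi w := S *m (Phi (z + w) - y).
have PsiE (w : 'cV[K]_k) : (forall i b, `|reim b (w i 0)| <= r) -> nrm (Psi w - w) <= 3 / 4 * r.
  move=> wr; have wk := cube_nrm w wr.
  have wt : nrm w < t by apply: le_lt_trans wk (lt_le_trans rk _); rewrite ge_min lexx.
  have -> : Psi w - w = S *m (Phi (z + w) - Phi z - T *m w) + S *m (Phi z - y).
    rewrite -mulmxDr -[X in _ - X = _](mulKmx Tu w) -mulmxBr; congr (_ *m _).
    by apply/matrixP => i j; rewrite !mxE; ring.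
  apply: le_trans (nrmD _ _) _; have -> : 3 / 4 * r = r / 2 + r / 4 by field.
  have Ss : nrm S <= s by rewrite lerDl.
  apply: lerD.
    apply: le_trans (nrmM _ _) _; apply: (@le_trans _ _ (s * (1 / (2 * s * kk) * (r * kk)))).
      apply: ler_pM; rewrite ?nrm_ge0 //; apply: le_trans (tP _ wt) _.
      by apply: ler_wpM2l => //; exact: ltW.
    by rewrite le_eqVlt; apply/predU1P; left; field; rewrite !gt_eqF.
  apply: le_trans (nrmM _ _) _; apply: (@le_trans _ _ (s * (r / (4 * s)))).
    by apply: ler_pM; rewrite ?nrm_ge0 // nrmC ltW.
  by rewrite le_eqVlt; apply/predU1P; left; field; rewrite !gt_eqF.
have dev (w : 'cV[K]_k) i b : (forall i b,
  `|reim b (w i 0)| <= r) -> `|reim b (Psi w i 0) - reim b (w i 0)| <= 3 / 4 * r.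
  move=> wr; rewrite -reimB; apply: le_trans (reim_le _ _) _; apply: le_trans (PsiE w wr).
  by have := modulus_le_nrm (Psi w - w) i 0; rewrite !mxE.
have in_rho (w : 'cV[K]_k) : (forall i b, `|reim b (w i 0)| <= r) -> nrm (z + w - z) < rho.
  move=> /cube_nrm wk; rewrite addrC addKr; apply: le_lt_trans wk (lt_le_trans rk _).
  by rewrite ge_min lexx orbT.
have [|||w wr Pw] := poincare_miranda_scalar (Psi := Psi) r0.
- move=> x e xr e1.
  have := Pc _ (in_rho x xr) => /(continuous_norm_equiv _ _ (norm_equiv_nrm R F _ _) (norm_equiv_nrm R F _ _)).
  move=> /(_ (e / s) (divr_gt0 e1 s0))[u u0 uP]; exists u => // v vr xv.
  have -> : Psi v - Psi x = S *m (Phi (z + v) - Phi (z + x)).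
    by rewrite -mulmxBr; congr (_ *m _); apply/matrixP => i j; rewrite !mxE; ring.
  apply: le_lt_trans (nrmM _ _) _.
  have := uP (z + v); rewrite opprD addrACA subrr add0r => /(_ xv).
  rewrite ltr_pdivlMr // mulrC; apply: le_lt_trans; apply: ler_wpM2r; first exact: nrm_ge0.
  by rewrite lerDl.
- by move=> x i b xr xi; have := dev x i b xr; rewrite xi ler_norml => /andP[_]; have := r0; lra.
- by move=> x i b xr xi; have := dev x i b xr; rewrite xi ler_norml => /andP[+ _]; have := r0; lra.
exists (z + w); first exact: in_rho.
apply/eqP; rewrite -subr_eq0 -(mulKVmx Tu (Phi (z + w) - y)); apply/eqP.
by rewrite -/S -/(Psi w) Pw mulmx0.
Qed.

End OpenImage.

(** * Contracting iterations, the chain rule, balls of the sum norm *)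

Section Iteration.
Variables (R : realType) (F : ground).
Local Notation K := (scalarField R F).
Local Notation md := (@modulus R F).
Local Notation ofr := (@of_real R F).
Local Notation nrm := (@nrm R F _ _).

(** The contraction is assumed only while both [x] and [T x] lie in the ball, so the induction
    carries the distance to [c] along with the step length; all steps together have length at most
    [2 * nrm (T x0 - x0)]. *)
Lemma halving_iteration m (T : 'cV[K]_m -> 'cV[K]_m) c x0 rho :
  (forall x, nrm (x - c) < rho -> nrm (T x - c) < rho ->
     nrm (T (T x) - T x) <= 1 / 2 * nrm (T x - x)) ->
  nrm (x0 - c) + 2 * nrm (T x0 - x0) < rho ->
  (forall k, nrm (iter k T x0 - c) < rho) /\
  exists xt, forall k, nrm (iter k T x0 - xt) <= 2 * nrm (T x0 - x0) * (1 / 2) ^+ k.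
Proof.
move=> Th x0r; set a := nrm (T x0 - x0) in x0r *.
have a0 : 0 <= a := nrm_ge0 _.
have q0 k : 0 < (1 / 2 : R) ^+ k by rewrite exprn_gt0.
have sum k : nrm (iter k T x0 - c) <= nrm (x0 - c) + 2 * a * (1 - (1 / 2) ^+ k) /\
     nrm (iter k.+1 T x0 - iter k T x0) <= a * (1 / 2) ^+ k.
  have bd j : nrm (x0 - c) + 2 * a * (1 - (1 / 2) ^+ j) < rho.
    apply: le_lt_trans x0r; rewrite lerD2l; have := mulr_ge0 a0 (ltW (q0 j)); lra.
  elim: k => [|k [IH1 IH2]]; first by rewrite expr0 subrr mulr0 addr0 mulr1.
  have IH3 : nrm (iter k.+1 T x0 - c) <= nrm (x0 - c) + 2 * a * (1 - (1 / 2) ^+ k.+1).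
    apply: le_trans (nrm_tri (iter k T x0) _ _) _; rewrite addrC.
    by apply: le_trans (lerD IH1 IH2) _; rewrite exprS; lra.
  split=> //; apply: le_trans (Th (iter k T x0) _ _) _.
  - exact: le_lt_trans IH1 (bd k).
  - exact: le_lt_trans IH3 (bd k.+1).
  by rewrite exprS mulrCA ler_pM2l ?divr_gt0.
split=> [k|].
  apply: le_lt_trans (sum k).1 (le_lt_trans _ x0r).
  by rewrite lerD2l; have := mulr_ge0 a0 (ltW (q0 k)); lra.
have q01 : 0 <= (1 / 2 : R) < 1 by apply/andP; split; lra.
have [xt xtP] := geometric_cvg q01 (fun k => (sum k).2).
exists xt => k; apply: le_trans (xtP k) _.
by rewrite le_eqVlt; apply/predU1P; left; field.
Qed.

Lemma fder_comp k m l (phi : 'cV[K]_k -> 'cV[K]_m) (g : 'cV[K]_m -> 'cV[K]_l) z M A :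
  fder phi z M -> fder g (phi z) A -> fder (g \o phi) z (A *m M).
Proof.
move=> phiM gA e e0; pose a := nrm A + 1; pose b := nrm M + 1.
have a0 : 0 < a by rewrite ltr_wpDl ?nrm_ge0.
have b0 : 0 < b by rewrite ltr_wpDl ?nrm_ge0.
have [s s0 sP] := gA (e / 2 / b) (divr_gt0 (divr_gt0 e0 (ltr0Sn _ 1)) b0).
have e1 : 0 < Num.min 1 (e / 2 / a) by rewrite lt_min ltr01 !divr_gt0.
have [t t0 tP] := phiM _ e1.
exists (Num.min t (s / b)); first by rewrite lt_min t0 divr_gt0.
move=> h; rewrite lt_min => /andP[ht hs]; have h0 := nrm_ge0 h.
set u := phi (z + h) - phi z; set v := u - M *m h.
have vle : nrm v <= Num.min 1 (e / 2 / a) * nrm h := tP h ht.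
have v1 : nrm v <= nrm h.
  by apply: le_trans vle _; rewrite -[leRHS]mul1r; apply: ler_wpM2r => //; rewrite ge_min lexx.
have v2 : nrm v <= e / 2 / a * nrm h.
  by apply: le_trans vle _; apply: ler_wpM2r => //; rewrite ge_min lexx orbT.
have ub : nrm u <= b * nrm h.
  have -> : u = M *m h + v by rewrite /v addrC subrK.
  apply: le_trans (nrmD _ _) _; rewrite /b mulrDl mul1r; apply: lerD => //; exact: nrmM.
have us : nrm u < s by apply: le_lt_trans ub _; rewrite mulrC -ltr_pdivlMr.
have := sP u us; rewrite /u [phi z + _]addrC subrK -/u => gu.
have -> : (g \o phi) (z + h) - (g \o phi) z - A *m M *m h =
   (g (phi (z + h)) - g (phi z) - A *m u) + A *m v.
  by clearbody u; rewrite /v mulmxBr mulmxA addrA subrK.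
apply: le_trans (nrmD _ _) _; have -> : e * nrm h = e / 2 * nrm h + e / 2 * nrm h by field.
apply: lerD.
  apply: le_trans gu _; apply: (@le_trans _ _ (e / 2 / b * (b * nrm h))).
    by apply: ler_wpM2l => //; rewrite !divr_ge0 // ltW.
  by rewrite mulrA divfK // gt_eqF.
apply: le_trans (nrmM _ _) _; apply: (@le_trans _ _ (a * (e / 2 / a * nrm h))).
  by apply: ler_pM; rewrite ?nrm_ge0 // lerDl.
by rewrite mulrA mulrCA divff ?mulr1 // gt_eqF.
Qed.

Lemma fder_locally_cst k l (G : 'cV[K]_k -> 'cV[K]_l) z B rho : 0 < rho ->
  (forall h, nrm h < rho -> G (z + h) = G z) -> fder G z B -> B = 0.
Proof.
move=> rho0 G0 /fder_differentiable[_ <-].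
suff /fder_differentiable[_ ->] : fder G z 0 by [].
move=> e e0; exists rho => // h hr.
by rewrite G0 // subrr mul0mx subrr nrm0 mulr_ge0 ?nrm_ge0 // ltW.
Qed.

Lemma fder_continuous k l (G : 'cV[K]_k -> 'cV[K]_l) z B : fder G z B -> {for z, continuous G}.
Proof. by move=> /fder_differentiable[dG _]; apply: differentiable_continuous. Qed.

Lemma nbhs_nrm m (x : 'cV[K]_m) (A : set 'cV[K]_m) :
  nbhs x A <-> exists2 e : R, 0 < e & forall y, nrm (y - x) < e -> A y.
Proof. exact: nbhs_norm_equiv (norm_equiv_nrm R F m 1) x A. Qed.

Lemma nrm_ball_open m (c : 'cV[K]_m) e : open [set x | nrm (x - c) < e].
Proof.
rewrite openE => x /= xe; apply/nbhs_nrm; exists (e - nrm (x - c)); first by rewrite subr_gt0.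
move=> y yx /=; apply: le_lt_trans (nrm_tri x _ _) _; rewrite -ltrBrDr //.
Qed.

Lemma open_nbhs_nrm_ball m (c : 'cV[K]_m) e : 0 < e -> open_nbhs c [set x | nrm (x - c) < e].
Proof. by move=> e0; split; [exact: nrm_ball_open|rewrite /= subrr nrm0]. Qed.

Lemma nrm_ball_connected m e : 0 < e -> connected [set x : 'cV[K]_m | nrm x < e].
Proof.
move=> e0.
have -> : [set x : 'cV[K]_m | nrm x < e] =
    \bigcup_(a in [set a | nrm a < e]) ((fun t : R => ofr t *: a) @` `[0, 1]).
  apply/seteqP; split=> [x xe|x [a ae [t + <-]]] /=.
    by exists x => //; exists 1; rewrite ?of_real1 ?scale1r //= in_itv /= ler01 lexx.
  rewrite /= in_itv /= => /andP[t0 t1]; rewrite nrmZ modulus_of_real ger0_norm //.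
  by apply: le_lt_trans (_ : nrm a < e) => //; rewrite ler_piMl ?nrm_ge0.
apply: bigcup_connected.
  by exists 0 => a _; exists 0; rewrite ?of_real0 ?scale0r //= in_itv /= lexx ler01.
move=> a _; apply: connected_continuous_connected; first exact: segment_connected.
apply: continuous_subspaceT => t A /nbhs_nrm[d d0 dA].
have a0 : 0 < nrm a + 1 by rewrite ltr_wpDl ?nrm_ge0.
apply/nbhs_normP; exists (d / (nrm a + 1)) => /= [|s]; first exact: divr_gt0.
rewrite /= ltr_pdivlMr // => ts; apply: dA; rewrite -scalerBl -of_realB nrmZ modulus_of_real.
rewrite distrC; apply: le_lt_trans ts; apply: ler_wpM2l => //; by rewrite lerDl.
Qed.

End Iteration.

(** * The zeros near a semiregular zero *)

Section Branch.
Variables (R : realType) (F : ground) (m l : nat).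
Local Notation K := (scalarField R F).
Local Notation nrm := (@nrm R F _ _).
Variables (Om : set 'cV[K]_m) (g : 'cV[K]_m -> 'cV[K]_l) (xs : 'cV[K]_m) (rho C : R).
Hypotheses (rho0 : 0 < rho) (C0 : 0 <= C).
Hypothesis Om_ball : forall x, nrm (x - xs) < rho -> Om x.
Hypothesis g_diff : forall x, nrm (x - xs) < rho -> differentiable g x.
Hypothesis g_taylor : forall x x', nrm (x - xs) < rho -> nrm (x' - xs) < rho ->
  nrm (g x' - g x - jac g x *m (x' - x)) <= C * nrm (x' - x) ^+ 2.
Hypothesis jac_lip : forall x x', nrm (x - xs) < rho -> nrm (x' - xs) < rho ->
  nrm (jac g x - jac g x') <= C * nrm (x - x').
Hypothesis gxs : g xs = 0.

Let A := jac g xs.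
Let X := mpinv A.
(** The orthogonal projection onto the kernel of [B]. *)
Definition kernel_proj l' m' (B : 'M[K]_(l', m')) : 'M[K]_m' := 1%:M - mpinv B *m B.
Let Pi := kernel_proj A.
(* By the choice of [A^+], the derivative of this map at [xs] is the identity. *)
Definition straighten x := Pi *m (x - xs) + X *m g x.
Let H := straighten.

Lemma kernel_proj_rank l' m' (B : 'M[K]_(l', m')) : (\rank (kernel_proj B) + \rank B = m')%N.
Proof.
have [BXB _ _ _] := mpinvP B.
apply/eqP; rewrite eqn_leq; apply/andP; split.
  rewrite addnC; apply: mulmx0_rank_max.
  by rewrite mulmxBr mulmx1 mulmxA BXB subrr.
rewrite -[X in (X <= _)%N](mxrank1 K m').
have -> : 1%:M = kernel_proj B + mpinv B *m B by rewrite subrK.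
by apply: leq_trans (mxrank_add _ _) _; rewrite leq_add2l mxrankM_maxr.
Qed.

(** The derivative of [H] at [x] is [Pi + X *m jac g x]. The radius [1 / (6 * k)] makes the Taylor
    remainder at most 1/3 and the change of the Jacobian at most 1/6 of the displacement, together
    the contraction factor 1/2. *)
Lemma straighten_near_id : exists2 r, 0 < r <= rho & forall x x',
  nrm (x - xs) < r -> nrm (x' - xs) < r ->
  nrm (H x' - H x - (x' - x)) <= 1 / 2 * nrm (x' - x) /\
  nrm (Pi + X *m jac g x - 1%:M) <= 1 / 2.
Proof.
pose k := nrm X * C + 1; have k0 : 0 < k by rewrite ltr_wpDl ?mulr_ge0 ?nrm_ge0.
pose r := Num.min rho (1 / (6 * k)).
have r0 : 0 < r by rewrite lt_min rho0 divr_gt0 // mulr_gt0.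
exists r => [|x x' xr x'r]; first by rewrite r0 ge_min lexx.
have rr : r <= rho by rewrite ge_min lexx.
have rk : nrm X * C * r <= 1 / 6.
  apply: (@le_trans _ _ (k * (1 / (6 * k)))).
    by apply: ler_pM; rewrite ?mulr_ge0 ?nrm_ge0 ?lerDl ?ge_min ?lexx ?orbT // ltW.
  by rewrite le_eqVlt; apply/predU1P; left; field; rewrite gt_eqF.
have xrho := lt_le_trans xr rr; have x'rho := lt_le_trans x'r rr.
have xsrho : nrm (xs - xs) < rho by rewrite subrr nrm0.
have JA : nrm (X *m (jac g x - A)) <= 1 / 6.
  apply: le_trans (nrmM _ _) _; apply: le_trans rk; rewrite -mulrA; apply: ler_wpM2l; first exact: nrm_ge0.
  apply: le_trans (jac_lip xrho xsrho) _; apply: ler_wpM2l => //; exact: ltW.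
split; last first.
  have -> : Pi + X *m jac g x - 1%:M = X *m (jac g x - A).
    by rewrite mulmxBr /Pi /kernel_proj addrAC [1%:M - _]addrC addrK addrC.
  by apply: le_trans JA _; lra.
have -> : H x' - H x - (x' - x) = X *m (g x' - g x - jac g x *m (x' - x)) + X *m (jac g x - A) *m (x' - x).
  have -> : H x' - H x = Pi *m (x' - x) + (X *m g x' - X *m g x).
    rewrite /H /straighten opprD addrACA -(mulmxBr Pi); congr (_ *m _ + _).
    by apply/matrixP => i i'; rewrite !mxE; ring.
  move: (x' - x) => d; rewrite /Pi /kernel_proj mulmxBl mul1mx -/X -/A !mulmxBr mulmxBl mulmxA.
  by rewrite addrAC [d - _]addrC addrK addrC addrA subrK.
have dx := nrm_ge0 (x' - x).
apply: le_trans (nrmD _ _) _;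
  have -> : 1 / 2 * nrm (x' - x) = 1 / 3 * nrm (x' - x) + 1 / 6 * nrm (x' - x) by field.
apply: lerD; last by apply: le_trans (nrmM _ _) _; apply: ler_wpM2r.
apply: le_trans (nrmM _ _) _; apply: (@le_trans _ _ (nrm X * (C * nrm (x' - x) ^+ 2))).
  by apply: ler_wpM2l; rewrite ?nrm_ge0 ?g_taylor.
have -> : nrm X * (C * nrm (x' - x) ^+ 2) = nrm X * C * nrm (x' - x) * nrm (x' - x) by ring.
apply: ler_wpM2r => //; apply: (@le_trans _ _ (nrm X * C * (2 * r))); last by lra.
apply: ler_wpM2l; first by rewrite mulr_ge0 ?nrm_ge0.
by apply: le_trans (nrm_tri xs _ _) _; rewrite (nrmC xs); lra.
Qed.

Lemma straighten_xs : H xs = 0.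
Proof. by rewrite /H /straighten subrr mulmx0 gxs mulmx0 addr0. Qed.

Section Param.
Variable r : R.
Hypothesis r0 : 0 < r.
Hypothesis r_rho : r <= rho.
Hypothesis H_near : forall x x', nrm (x - xs) < r -> nrm (x' - xs) < r ->
  nrm (H x' - H x - (x' - x)) <= 1 / 2 * nrm (x' - x) /\
  nrm (Pi + X *m jac g x - 1%:M) <= 1 / 2.

Lemma straighten_expand x x' : nrm (x - xs) < r -> nrm (x' - xs) < r ->
  nrm (x' - x) <= 2 * nrm (H x' - H x).
Proof.
move=> xr x'r; have [h _] := H_near xr x'r.
have : nrm (x' - x) <= nrm (H x' - H x) + nrm (H x' - H x - (x' - x)).
  have E : x' - x = H x' - H x - (H x' - H x - (x' - x)) by rewrite subKr.
  by rewrite {1}E; apply: nrmB.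
lra.
Qed.

(* [Pi = V W] with [W V = 1]: the columns of [V] are a basis of the kernel of
   [A], and [W] takes coordinates in it. *)
Variables (k : nat) (V : 'M[K]_(m, k)) (W : 'M[K]_(k, m)).
Hypotheses (VW : Pi = V *m W) (WV : W *m V = 1%:M).

Lemma coordinates_facts : [/\ W *m Pi = W, W *m X = 0 & A *m Pi = 0].
Proof.
have [AXA XAX _ _] := mpinvP A.
have WPi : W *m Pi = W by rewrite VW mulmxA WV mul1mx.
split=> //.
  by rewrite -WPi -mulmxA /Pi /kernel_proj mulmxBl mul1mx -/X XAX subrr mulmx0.
by rewrite /Pi /kernel_proj mulmxBr mulmx1 mulmxA AXA subrr.
Qed.

Lemma coordinates_straighten x : W *m H x = W *m (x - xs).
Proof.
have [WPi WX _] := coordinates_facts.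
by rewrite /H /straighten mulmxDr !mulmxA WPi WX mul0mx addr0.
Qed.

(* [phi] is only differentiable, of full rank at one point; the classical
   inverse function theorem does not apply and [open_image] is used instead. *)
Lemma zero_set_is_graph (Lam : set 'cV[K]_k) phi z : zero_param Om g xs Lam phi z ->
  exists2 tau : R, 0 < tau & forall t, nrm t < tau ->
    exists x, [/\ nrm (x - xs) < r, H x = V *m t & g x = 0].
Proof.
move=> [[oLam _] dphi _ [Lz phiz rkz] [Del [[oDel Dxs] DelOm DelE]]].
have [WPi WX APi] := coordinates_facts.
have gphi w : Lam w -> g (phi w) = 0.
  move=> Lw; have : (Del `&` zeros Om g) (phi w) by rewrite DelE; exists w.
  by move=> [_ [_ ]].
have [d1 d10 d1P] := (nbhs_nrm z Lam).1 (open_nbhs_nbhs (conj oLam Lz)).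
have phiM := differentiable_fder (dphi z Lz).
set M := jac phi z in phiM rkz.
(* As [g] vanishes along [phi], the range of [M] lies in the kernel of [A]. *)
have AM : A *m M = 0.
  have gA : fder g (phi z) A by rewrite phiz; apply: differentiable_fder; apply: g_diff; rewrite subrr nrm0.
  apply: (fder_locally_cst d10 _ (fder_comp phiM gA)) => h hd /=.
  by rewrite !gphi //; apply: d1P; rewrite addrC addKr.
have Mk : M = V *m (W *m M).
  by rewrite mulmxA -VW /Pi /kernel_proj mulmxBl mul1mx -mulmxA AM mulmx0 subr0.
(* Semiregularity enters here: [M] has rank [k], which is also the dimension of the kernel, so the
   kernel coordinates of its columns form an invertible matrix. *)
have Tu : W *m M \in unitmx.
  rewrite -row_full_unit /row_full eqn_leq rank_leq_row -{1}rkz {1}Mk.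
  exact: mxrankM_maxr.
have phic : {for z, continuous phi} := fder_continuous phiM.
have [d2 d20 d2P] :=
  (continuous_norm_equiv phi z (norm_equiv_nrm R F _ _) (norm_equiv_nrm R F _ _)).1 phic r r0.
pose Phi w := W *m (phi w - xs).
have PhiT : fder Phi z (W *m M).
  move=> e e0; have W0 : 0 < nrm W + 1 by rewrite ltr_wpDl ?nrm_ge0.
  have [d d0 dP] := phiM _ (divr_gt0 e0 W0); exists d => // h hd.
  have -> : Phi (z + h) - Phi z - W *m M *m h = W *m (phi (z + h) - phi z - M *m h).
    rewrite /Phi -mulmxA -!mulmxBr; congr (_ *m _).
    by generalize (M *m h) => a; apply/matrixP => i j; rewrite !mxE; ring.
  apply: le_trans (nrmM _ _) _; apply: (@le_trans _ _ ((nrm W + 1) * (e / (nrm W + 1) * nrm h))).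
    by apply: ler_pM; rewrite ?nrm_ge0 ?lerDl ?dP.
  by rewrite mulrA mulrCA divff ?mulr1 // gt_eqF.
have d12 : 0 < Num.min d1 d2 by rewrite lt_min d10.
have [w wd|tau tau0 tauP] := open_image d12 _ PhiT Tu.
  have Lw : Lam w by apply: d1P; apply: lt_le_trans wd _; rewrite ge_min lexx.
  apply: (continuous_comp (f := fun w => phi w - xs) (g := mulmx W)); last exact: mulmx_continuous.
  by apply: continuousB; [apply: differentiable_continuous; apply: dphi|apply: cst_continuous].
exists tau => // t tt; have [|w wd Pw] := tauP t.
  by rewrite /Phi phiz subrr mulmx0 subr0.
have Lw : Lam w by apply: d1P; apply: lt_le_trans wd _; rewrite ge_min lexx.
exists (phi w); split; last exact: gphi.
  by rewrite -phiz; apply: d2P; apply: lt_le_trans wd _; rewrite ge_min lexx orbT.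
by rewrite /H /straighten (gphi w Lw) mulmx0 addr0 VW -mulmxA -/(Phi w) Pw.
Qed.

(** * The chart of the zeros by kernel coordinates *)

Section Chart.
Variables (tau : R) (phi : 'cV[K]_k -> 'cV[K]_m).
Hypothesis phiP : forall t, nrm t < tau ->
  [/\ nrm (phi t - xs) < r, H (phi t) = V *m t & g (phi t) = 0].

Lemma chart_coordinates t : nrm t < tau -> W *m (phi t - xs) = t.
Proof. by move=> /phiP[_ Ht _]; rewrite -coordinates_straighten Ht mulmxA WV mul1mx. Qed.

Lemma straighten_derivative_unit x : nrm (x - xs) < r -> Pi + X *m jac g x \in unitmx.
Proof.
move=> xr; have [_ h] := H_near xr xr.
rewrite -row_full_unit /row_full eqn_leq rank_leq_row /= leqNgt; apply/negP => rk.
have [|w [Bw w0]] := @ker_witness R F m m m (Pi + X *m jac g x) 1%:M; first by rewrite mxrank1.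
rewrite mul1mx in w0; have w1 := nrm_gt0 w0.
have : nrm w <= 1 / 2 * nrm w.
  have {1}-> : w = - ((Pi + X *m jac g x - 1%:M) *m w) by rewrite mulmxBl Bw mul1mx sub0r opprK.
  by rewrite nrmN; apply: le_trans (nrmM _ _) _; apply: ler_wpM2r; rewrite ?nrm_ge0.
lra.
Qed.

(** Implicit differentiation of [H (phi t) = V *m t]: the derivative [B] of [H] at [phi t] is
    invertible, which gives [M = invmx B *m V]. The rank follows from [W *m M = 1], and the last
    clause from [g] vanishing along [phi]. *)
Lemma chart_derivative t : nrm t < tau -> exists M, [/\ fder phi t M, \rank M = k & jac g (phi t) *m M = 0].
Proof.
move=> tt; have [pr Ht gt] := phiP tt; have [WPi WX APi] := coordinates_facts.
have Bu := straighten_derivative_unit pr.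
set J := jac g (phi t) in Bu; pose B := Pi + X *m J; pose M := invmx B *m V.
have tau0 : 0 < tau - nrm t by rewrite subr_gt0.
have prho := lt_le_trans pr r_rho.
pose c := nrm (invmx B) * (nrm X * (C * (2 * nrm V) ^+ 2)).
have c0 : 0 <= c by rewrite !mulr_ge0 ?nrm_ge0 // exprn_ge0 // mulr_ge0 ?nrm_ge0.
have c1 : 0 < c + 1 by rewrite ltr_wpDl.
have phiM : fder phi t M.
  move=> e e0; exists (Num.min (tau - nrm t) (e / (c + 1))) => [|h].
    by rewrite lt_min tau0 divr_gt0.
  rewrite lt_min => /andP[h1 h2].
  have th : nrm (t + h) < tau by apply: le_lt_trans (nrmD _ _) _; lra.
  have [pr' Ht' gt'] := phiP th.
  set d := phi (t + h) - phi t.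
  have Hd : H (phi (t + h)) - H (phi t) = V *m h by rewrite Ht Ht' -mulmxBr addrC addKr.
  have dle : nrm d <= 2 * nrm V * nrm h.
    apply: le_trans (straighten_expand pr pr') _; rewrite Hd -mulrA ler_pM2l //; exact: nrmM.
  (* Since [H] is affine apart from [X *m g], its linearization error is [X] times the Taylor
     remainder of [g], quadratic in [d] and so in [h]. *)
  have E : V *m h - B *m d = X *m (g (phi (t + h)) - g (phi t) - J *m d).
    rewrite -Hd gt gt' subrr sub0r mulmxN /H /straighten gt gt' mulmx0 !addr0 -mulmxBr.
    have -> : phi (t + h) - xs - (phi t - xs) = d.
      by rewrite opprB addrA subrK.
    have -> : B *m d = Pi *m d + X *m J *m d by rewrite /B mulmxDl.
    by rewrite opprD addrA subrr sub0r mulmxA.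
  have -> : d - M *m h = - (invmx B *m (V *m h - B *m d)).
    by rewrite mulmxBr mulKmx // mulmxA opprB.
  rewrite nrmN E; apply: le_trans (nrmM _ _) _.
  have h0 := nrm_ge0 h.
  apply: (@le_trans _ _ (c * nrm h * nrm h)).
    rewrite /c -!mulrA; apply: ler_wpM2l; first exact: nrm_ge0.
    apply: le_trans (nrmM _ _) _; apply: ler_wpM2l; first exact: nrm_ge0.
    apply: le_trans (g_taylor prho (lt_le_trans pr' r_rho)) _; apply: ler_wpM2l => //.
    have := ler_pM (nrm_ge0 d) (nrm_ge0 d) dle dle; rewrite -/d expr2 => /le_trans; apply.
    by rewrite le_eqVlt; apply/predU1P; left; ring.
  apply: ler_wpM2r => //; apply: (@le_trans _ _ ((c + 1) * (e / (c + 1)))).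
    by apply: ler_pM => //; rewrite ?lerDl ?ltW.
  by rewrite mulrCA divff ?mulr1 // gt_eqF.
exists M; split=> //.
  have WM : W *m M = 1%:M.
    have WB : W *m B = W by rewrite /B mulmxDr WPi mulmxA WX mul0mx addr0.
    by rewrite /M mulmxA -{1}WB mulmxK.
  apply/eqP; rewrite eqn_leq rank_leq_col /= -{1}(mxrank1 K k) -WM.
  exact: mxrankM_maxr.
have gJ : fder g (phi t) J by apply: differentiable_fder; apply: g_diff.
apply: (fder_locally_cst tau0 _ (fder_comp phiM gJ)) => h hd /=.
have th : nrm (t + h) < tau by apply: le_lt_trans (nrmD _ _) _; lra.
by have [_ _ ->] := phiP th.
Qed.

Lemma chart_zero_param t : nrm t < tau ->
  zero_param Om g (phi t) [set u | nrm u < tau] phi t.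
Proof.
move=> tt; have tau0 : 0 < tau := le_lt_trans (nrm_ge0 t) tt.
have oL : open [set u : 'cV[K]_k | nrm u < tau].
  have -> : [set u : 'cV[K]_k | nrm u < tau] = [set u : 'cV[K]_k | nrm (u - 0) < tau].
    by apply/seteqP; split=> u /=; rewrite subr0.
  exact: nrm_ball_open.
split.
- by split=> //; apply: nrm_ball_connected.
- by move=> u /chart_derivative[M [/fder_differentiable[]]].
- move=> u v /set_mem uu /set_mem vv uv.
  by rewrite -(chart_coordinates uu) -(chart_coordinates vv) uv.
- split=> //; have [M [/fder_differentiable[_ ->]]] := chart_derivative tt; by [].
(* A zero [x] in this set has the same value under [H] as the chart point with its kernel
   coordinates, and [H] is injective there, so every such zero lies on the chart. *)
exists [set x | nrm (x - xs) < r /\ nrm (W *m (x - xs)) < tau].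
have [pr Ht gt] := phiP tt.
have DelO x : nrm (x - xs) < r -> Om x by move=> xr; apply: Om_ball; apply: lt_le_trans xr r_rho.
split.
- split; last by split=> //; rewrite chart_coordinates.
  rewrite openE => x /= [xr xt]; apply/nbhs_nrm.
  have W0 : 0 < nrm W + 1 by rewrite ltr_wpDl ?nrm_ge0.
  exists (Num.min (r - nrm (x - xs)) ((tau - nrm (W *m (x - xs))) / (nrm W + 1))).
    by rewrite lt_min subr_gt0 xr divr_gt0 ?subr_gt0.
  move=> y; rewrite lt_min => /andP[y1 y2]; split.
    by apply: le_lt_trans (nrm_tri x _ _) _; rewrite -ltrBrDr.
  have -> : W *m (y - xs) = W *m (y - x) + W *m (x - xs) by rewrite -mulmxDr addrA subrK.
  apply: le_lt_trans (nrmD _ _) _; rewrite -ltrBrDr; move: y2; rewrite ltr_pdivlMr // mulrC.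
  apply: le_lt_trans; apply: le_trans (nrmM _ _) _; apply: ler_wpM2r; rewrite ?nrm_ge0 ?lerDl //.
- by move=> x [/DelO].
apply/seteqP; split=> [x [[xr xt] [_ /= gx]]|x [u /= uu <-]].
  exists (W *m (x - xs)) => //; have [pr' Ht' _] := phiP xt.
  apply/eqP; rewrite -subr_eq0; apply/eqP; apply: nrm_eq0.
  apply: le_trans (straighten_expand xr pr') _.
  by rewrite Ht' /H /straighten gx mulmx0 addr0 VW mulmxA subrr nrm0 mulr0.
have [pr' Ht' gu] := phiP uu; split; first by split; rewrite ?chart_coordinates.
by split=> //; apply: DelO.
Qed.

(** The nullity of [jac g (phi t)] is at least [k] because it kills the range of the chart
    derivative, and at most [k] because [Pi + X *m jac g (phi t)] is invertible while [Pi] has rank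
    at most [k]. *)
Lemma chart_semiregular t : (0 < k)%N -> nrm t < tau -> semiregular_zero Om g (phi t).
Proof.
move=> k0 tt; exists k; split.
  by right; split=> //; exists [set u | nrm u < tau], phi, t; apply: chart_zero_param.
have [pr _ _] := phiP tt; have [M [_ rM JM]] := chart_derivative tt.
apply/eqP; rewrite eqn_leq; apply/andP; split.
  by rewrite addnC -{1}rM; apply: mulmx0_rank_max.
have := mxrank_unit (straighten_derivative_unit pr) => rB.
rewrite -[X in (X <= _)%N]rB; apply: leq_trans (mxrank_add _ _) _; apply: leq_add.
  by rewrite VW; apply: leq_trans (mxrankM_maxl _ _) _; apply: rank_leq_col.
exact: mxrankM_maxr.
Qed.

Lemma chart_same_branch t : (0 < k)%N -> nrm t < tau -> same_branch Om g xs (phi t).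
Proof.
move=> k0 tt; have tau0 : 0 < tau := le_lt_trans (nrm_ge0 t) tt.
have z0 : nrm (0 : 'cV[K]_k) < tau by rewrite nrm0.
have p0 : phi 0 = xs.
  have [pr Ht _] := phiP z0; have xr : nrm (xs - xs) < r by rewrite subrr nrm0.
  apply/eqP; rewrite -subr_eq0; apply/eqP; apply: nrm_eq0.
  by apply: le_trans (straighten_expand xr pr) _; rewrite Ht mulmx0 straighten_xs subrr nrm0 mulr0.
have zp := chart_zero_param z0.
rewrite -[X in same_branch _ _ X _]p0.
apply: (same_branch_local (Lam := [set u | nrm u < tau]) (Lams := [set u | nrm u < tau]) (z := 0)) => //.
  by have [[oL _] _ _ _ _] := zp; split.
by move=> u /chart_derivative[M [/fder_differentiable[_ ->]]].
Qed.

End Chart.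

End Param.

Lemma semiregular_nearby (r' : R) : 0 < r' -> semiregular_zero Om g xs ->
  exists2 r, 0 < r & forall x, nrm (x - xs) < r -> exists xh,
    [/\ nrm (xh - xs) < r', Pi *m (x - xh) = 0, g xh = 0,
        semiregular_zero Om g xh & same_branch Om g xs xh].
Proof.
move=> r'0 sreg; have [k [dimk kA]] := sreg.
have rkPi : \rank Pi = k.
  by have := kernel_proj_rank A; rewrite -/Pi => PiA; apply/eqP; rewrite -(eqn_add2r (\rank A)) PiA kA.
case: dimk => [[k_eq0 iso]|[k0 [Lam [phi0 [z zp]]]]].
  (* For an isolated zero the kernel is trivial and [Pi = 0], so [xs] serves for every [x] and the
     radius is arbitrary. *)
  exists 1 => // x _; exists xs; split=> //; first by rewrite subrr nrm0.
    by have /eqP := rkPi; rewrite k_eq0 mxrank_eq0 => /eqP ->; rewrite mul0mx.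
  exact: same_branch_isolated.
have [s /andP[s0 srho] sH] := straighten_near_id.
pose r := Num.min s r'; have r0 : 0 < r by rewrite lt_min s0.
have rrho : r <= rho by apply: le_trans srho; rewrite ge_min lexx.
have rr' : r <= r' by rewrite ge_min lexx orbT.
have rH x x' : nrm (x - xs) < r -> nrm (x' - xs) < r ->
    nrm (H x' - H x - (x' - x)) <= 1 / 2 * nrm (x' - x) /\
    nrm (Pi + X *m jac g x - 1%:M) <= 1 / 2.
  by move=> xr x'r; apply: sH; [apply: lt_le_trans xr _|apply: lt_le_trans x'r _]; rewrite ge_min lexx.
(* Full-rank factorization of [Pi]; cancelling the two factors in [Pi *m Pi = Pi] gives
   [W *m V = 1]. *)
have [V [W [VW WV]]] : exists (V : 'M[K]_(m, k)) (W : 'M[K]_(k, m)), Pi = V *m W /\ W *m V = 1%:M.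
  rewrite -rkPi; exists (col_base Pi), (row_base Pi); split; first by rewrite mulmx_base.
  have PiPi : Pi *m Pi = Pi.
    have [AXA _ _ _] := mpinvP A.
    by rewrite {1}/Pi /kernel_proj mulmxBl mul1mx /Pi /kernel_proj mulmxBr mulmx1 -!mulmxA (mulmxA A) AXA subrr subr0.
  apply: (row_full_inj (col_base_full Pi)); apply: (row_free_inj (row_base_free Pi)).
  have CR := mulmx_base Pi; rewrite /= mulmx1.
  by rewrite (mulmxA (col_base Pi)) -(mulmxA _ (col_base Pi)) !CR PiPi.
have [tau tau0 tauP] := zero_set_is_graph r0 VW WV zp.
have /choice[phi phiP] : forall t, exists x, nrm t < tau -> [/\ nrm (x - xs) < r, H x = V *m t & g x = 0].
  move=> t; have [tt|nt] := pselect (nrm t < tau); last by exists 0 => tt; case: nt.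
  by have [x xP] := tauP t tt; exists x.
have W0 : 0 < nrm W + 1 by rewrite ltr_wpDl ?nrm_ge0.
exists (tau / (nrm W + 1)) => [|x]; first exact: divr_gt0.
rewrite ltr_pdivlMr // mulrC => xW; pose t := W *m (x - xs).
have tt : nrm t < tau.
  by apply: le_lt_trans xW; apply: le_trans (nrmM _ _) _; apply: ler_wpM2r; rewrite ?nrm_ge0 ?lerDl.
(* The zero with the same kernel coordinates as [x]. *)
have [pr Ht gt] := phiP t tt; exists (phi t); split.
- exact: lt_le_trans pr rr'.
- have -> : x - phi t = (x - xs) - (phi t - xs) by rewrite opprB addrA subrK.
  rewrite mulmxBr.
  have -> : Pi *m (phi t - xs) = Pi *m (x - xs); last by rewrite subrr.
  by rewrite VW -!mulmxA (chart_coordinates VW WV phiP tt).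
- exact: gt.
- exact: (chart_semiregular rrho rH VW WV phiP k0 tt).
- exact: (chart_same_branch r0 rrho rH VW WV phiP k0 tt).
Qed.

End Branch.

(** * The rank-r Newton iteration *)

Section SpectralNorm.
Variables (R : realType) (F : ground).
Local Notation K := (scalarField R F).
Local Notation md := (@modulus R F).
Local Notation nrm := (@nrm R F _ _).

Lemma norm2_le_nrm p (v : 'cV[K]_p) : norm2 v <= nrm v.
Proof.
rewrite -(@ler_pXn2r _ 2) ?nnegrE ?sqrtr_ge0 ?nrm_ge0 // sqr_sqrtr; last first.
  by apply: sumr_ge0 => i _; apply: sqr_ge0.
apply: (@le_trans _ _ (\sum_i md (v i 0) * nrm v)).
  by apply: ler_sum => i _; rewrite expr2 ler_wpM2l ?modulus_ge0 ?modulus_le_nrm.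
by rewrite -mulr_suml -nrm_col expr2.
Qed.

Lemma modulus_le_norm2 p (v : 'cV[K]_p) i : md (v i 0) <= norm2 v.
Proof.
rewrite -(@ler_pXn2r _ 2) ?nnegrE ?sqrtr_ge0 ?modulus_ge0 // sqr_sqrtr; last first.
  by apply: sumr_ge0 => j _; apply: sqr_ge0.
by rewrite (bigD1 i) //= lerDl; apply: sumr_ge0 => j _; apply: sqr_ge0.
Qed.

Lemma nrm_le_norm2 p (v : 'cV[K]_p) : nrm v <= p%:R * norm2 v.
Proof.
by rewrite -[X in X%:R](muln1 p); apply: nrm_le_entries => i j; rewrite ord1 modulus_le_norm2.
Qed.

Lemma mxnorm2_gt0 p q (B : 'M[K]_(p, q)) : B != 0 -> 0 < mxnorm2 B.
Proof.
move=> /matrix0Pn[i [j Bij]]; pose v : 'cV[K]_q := delta_mx j 0.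
have v1 : norm2 v <= 1.
  rewrite /norm2 (bigD1 j) //= big1 ?addr0 => [|k kj].
    by rewrite mxE !eqxx modulus1 expr1n sqrtr1.
  by rewrite mxE (negPf kj) modulus0 expr0n.
apply: (@lt_le_trans _ _ (norm2 (B *m v))).
  apply: lt_le_trans (modulus_le_norm2 _ i); rewrite -colE mxE.
  by rewrite lt0r modulus_eq0 Bij modulus_ge0.
apply: ub_le_sup; last by exists v.
exists (nrm B * q%:R) => _ [w /= w1 <-]; apply: le_trans (norm2_le_nrm _) _.
apply: le_trans (nrmM _ _) _; apply: ler_wpM2l; first exact: nrm_ge0.
apply: le_trans (nrm_le_norm2 _) _; rewrite -[leRHS]mulr1; exact: ler_wpM2l.
Qed.

Lemma quadratic_fder m l (g : 'cV[K]_m -> 'cV[K]_l) x M (C d : R) : 0 <= C -> 0 < d ->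
  (forall h, nrm h < d -> nrm (g (x + h) - g x - M *m h) <= C * nrm h ^+ 2) -> fder g x M.
Proof.
move=> C0 d0 gC e e0; have C1 : 0 < C + 1 by rewrite ltr_wpDl.
exists (Num.min d (e / (C + 1))) => [|h]; first by rewrite lt_min d0 divr_gt0.
rewrite lt_min => /andP[hd he]; apply: le_trans (gC h hd) _; have h0 := nrm_ge0 h.
rewrite expr2 mulrA; apply: ler_wpM2r => //.
apply: (@le_trans _ _ ((C + 1) * (e / (C + 1)))).
  by apply: ler_pM => //; rewrite ?lerDl ?ltW.
by rewrite mulrCA divff ?mulr1 // gt_eqF.
Qed.

Lemma semiregular_zeroP m l Om (g : 'cV[K]_m -> 'cV[K]_l) x : semiregular_zero Om g x -> g x = 0.
Proof.
move=> [k [[[_ [U [_ Ux]]]|[_ [Lam [phi [z [_ _ _ [Lz pz _] [Del [_ _ De]]]]]]]] _]].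
  by have [_ []] : (U `&` zeros Om g) x by rewrite Ux.
by have [_ []] : (Del `&` zeros Om g) x by rewrite De; exists z.
Qed.

End SpectralNorm.

(** With [u] and [u'] the residuals before and after the step [- G u], the next step consists of a
    Taylor remainder and of the change of [G] applied to [u - J G u], the part of the residual that
    [G] annihilates. *)
Lemma newton_identity (K : pzRingType) m l (G G' : 'M[K]_(m, l)) (J : 'M[K]_(l, m))
    (u u' : 'cV[K]_l) : G *m J *m G = G ->
  G' *m u' = G' *m (u' - u - J *m - (G *m u)) + (G' - G) *m (u - J *m G *m u).
Proof.
move=> GJG; have G0 : G *m (u - J *m G *m u) = 0 by rewrite mulmxBr !mulmxA GJG subrr.
rewrite mulmxBl G0 subr0 -mulmxDr mulmxN opprK mulmxA; congr (_ *m _).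
by rewrite addrA [_ + _ + u]addrAC subrK addrK.
Qed.

Lemma mulmx_variation (K : pzRingType) m l (G G' : 'M[K]_(m, l)) (u u' : 'cV[K]_l) :
  G' *m u' = G' *m (u' - u) + (G' - G) *m u + G *m u.
Proof. by rewrite mulmxBr mulmxBl addrA subrK subrK. Qed.

(** Splits the error [e] into one term governed by the change of parameter, through [u - v], and
    three that will be small multiples of [e]: a Taylor remainder, a change of Jacobian and a change
    of pseudo-inverse. *)
Lemma stationary_identity (K : pzRingType) m l (P X : 'M[K]_(m, l)) (A J : 'M[K]_(l, m))
    (u v : 'cV[K]_l) (e : 'cV[K]_m) : e = P *m A *m e -> X *m v = 0 ->
  e = X *m (u - v) - X *m (u - J *m e) + X *m ((A - J) *m e) + (P - X) *m (A *m e).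
Proof.
move=> eE Xv; rewrite !mulmxBr !mulmxBl !mulmxBr Xv subr0 (mulmxA P) -eE.
move: (X *m u) (X *m (J *m e)) (X *m (A *m e)) => a b c.
by rewrite subKr [b + _]addrC subrK addrC subrK.
Qed.

(** * Step halving, the limit equation, the distance to the zeros *)

Section Newton.
Variables (R : realType) (F : ground) (m n l : nat).
Local Notation K := (scalarField R F).
Local Notation nrm := (@nrm R F _ _).
Variables (f : 'cV[K]_m * 'cV[K]_n -> 'cV[K]_l) (xs : 'cV[K]_m) (ys : 'cV[K]_n).
Variables (r : nat) (b g L C E rho : R).
Local Notation J x y := (jac_x f (x, y)).
Local Notation G x y := (mpinv (rank_proj r (jac_x f (x, y)))).
Local Notation near x y := (nrm (x - xs) < rho /\ nrm (y - ys) < rho).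
Hypotheses (g0 : 0 <= g) (b0 : 0 <= b) (L0 : 0 <= L) (C0 : 0 <= C) (E0 : 0 <= E) (rho0 : 0 < rho).
Hypothesis gapG : forall x y, near x y -> gap_inverse b g (J x y) (G x y).
Hypothesis lipG : forall x y x' y', near x y -> near x' y' ->
  nrm (G x' y' - G x y) <= L * nrm (J x' y' - J x y).
Hypothesis taylor : forall x x' y, near x y -> near x' y ->
  nrm (f (x', y) - f (x, y) - J x y *m (x' - x)) <= C * nrm (x' - x) ^+ 2.
Hypothesis lipJ : forall x y x' y', near x y -> near x' y' ->
  nrm (J x y - J x' y') <= C * (nrm (x - x') + nrm (y - y')).
Hypothesis lipf : forall x y y', near x y -> near x y' ->
  nrm (f (x, y) - f (x, y')) <= C * nrm (y - y').
Hypothesis f_small : forall s x y, s <= rho -> nrm (x - xs) < s -> nrm (y - ys) < s ->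
  nrm (f (x, y)) <= E * s.
Hypothesis rho_small : (5 * g * C + L * C * (1 + b * g) * E + 2 * L * C * b) * rho <= 1 / 2.

(** The first inequality is the contraction factor in [newton_halving], the second the absorption in
    [stationary_bound]; the coefficient in [rho_small] is the sum of both demands. *)
Lemma rho_small_parts : 2 * (g * C * rho) + L * C * (1 + b * g) * E * rho <= 1 / 2 /\
  3 * (g * C * rho) + 2 * (L * C * b * rho) <= 1 / 2.
Proof.
have r0 := ltW rho0; have bg : 0 <= 1 + b * g by rewrite addr_ge0 // mulr_ge0.
have s1 : 0 <= g * C * rho by rewrite !mulr_ge0.
have s2 : 0 <= L * C * (1 + b * g) * E * rho by rewrite !mulr_ge0.
have s3 : 0 <= L * C * b * rho by rewrite !mulr_ge0.
move: rho_small; have -> : (5 * g * C + L * C * (1 + b * g) * E + 2 * L * C * b) * rho =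
  5 * (g * C * rho) + L * C * (1 + b * g) * E * rho + 2 * (L * C * b * rho) by ring.
move: s1 s2 s3; move: (g * C * rho) (L * C * (1 + b * g) * E * rho) (L * C * b * rho) => u v w.
by lra.
Qed.

Lemma near_small x y : near x y -> nrm (f (x, y)) <= E * rho.
Proof. by case; apply: f_small. Qed.

Lemma near_dist x y x' y' : near x y -> near x' y' -> nrm (x' - x) <= 2 * rho.
Proof.
by move=> [h _] [h' _]; apply: le_trans (nrm_tri xs _ _) _; rewrite (nrmC xs) mulr_natl mulr2n;
  apply: lerD; apply: ltW.
Qed.

Lemma newton_halving x y : near x y -> nrm (newton_step f r y x - xs) < rho ->
  nrm (newton_step f r y (newton_step f r y x) - newton_step f r y x) <=
  1 / 2 * nrm (newton_step f r y x - x).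
Proof.
move=> xy x'r; set x' := newton_step f r y x in x'r *.
have x'y : near x' y by case: xy.
have [GJG _ _ [Jb Gg] _] := gapG xy; have [_ _ _ [_ Gg'] _] := gapG x'y.
set d := x' - x; have dE : d = - (G x y *m f (x, y)) by rewrite /d /x' /newton_step addrC addKr.
have d0 := nrm_ge0 d.
have d2 : nrm d <= 2 * rho := near_dist xy x'y.
set u := f (x, y) - J x y *m G x y *m f (x, y).
have -> : newton_step f r y x' - x' =
    - (G x' y *m (f (x', y) - f (x, y) - J x y *m d) + (G x' y - G x y) *m u).
  by rewrite dE -newton_identity // /newton_step addrC addKr.
have lipd : nrm (J x' y - J x y) <= C * nrm d.
  by apply: le_trans (lipJ x'y xy) _; rewrite subrr nrm0 addr0.
have uE : nrm u <= (1 + b * g) * (E * rho).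
  apply: le_trans (nrmB _ _) _; rewrite mulrDl mul1r; apply: lerD; first exact: near_small.
  apply: le_trans (nrmM _ _) _; apply: ler_pM (near_small xy); rewrite ?nrm_ge0 //.
  by apply: le_trans (nrmM _ _) _; apply: ler_pM Jb Gg; apply: nrm_ge0.
have tay := taylor xy x'y; rewrite -/d in tay.
clearbody u d x'.
rewrite nrmN; apply: le_trans (nrmD _ _) _.
have h1 : nrm (G x' y *m (f (x', y) - f (x, y) - J x y *m d)) <= 2 * (g * C * rho) * nrm d.
  apply: le_trans (nrmM _ _) _; apply: (@le_trans _ _ (g * (C * nrm d ^+ 2))).
    by apply: ler_pM; rewrite ?nrm_ge0.
  have -> : g * (C * nrm d ^+ 2) = g * C * nrm d * nrm d by ring.
  apply: ler_wpM2r => //; have -> : 2 * (g * C * rho) = g * C * (2 * rho) by ring.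
  by apply: ler_wpM2l => //; apply: mulr_ge0.
have h3 : nrm ((G x' y - G x y) *m u) <= L * C * (1 + b * g) * E * rho * nrm d.
  apply: le_trans (nrmM _ _) _; apply: (@le_trans _ _ (L * (C * nrm d) * ((1 + b * g) * (E * rho)))).
    apply: ler_pM; rewrite ?nrm_ge0 //; by apply: le_trans (lipG xy x'y) _; apply: ler_wpM2l.
  by rewrite le_eqVlt; apply/predU1P; left; ring.
apply: le_trans (lerD h1 h3) _; have [s5 _] := rho_small_parts.
by have := ler_wpM2r d0 s5; rewrite [leLHS]mulrDl.
Qed.

(** At an iterate [G f] is the difference of consecutive iterates, hence of order [(1 / 2) ^+ k];
    the Lipschitz bounds on [G] and [f] carry this over to [xt]. *)
Lemma newton_limit x0 y xt (a : R) : nrm (y - ys) < rho ->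
  (forall k, nrm (iter k (newton_step f r y) x0 - xs) < rho) ->
  (forall k, nrm (iter k (newton_step f r y) x0 - xt) <= a * (1 / 2) ^+ k) ->
  nrm (xt - xs) < rho -> G xt y *m f (xt, y) = 0.
Proof.
have half_le q : 0 <= q -> q + 1 / 2 * q <= 2 * q :> R by lra.
move=> yr xr xa xtr; have xty : near xt y by [].
have [_ _ _ [Jb Gg] _] := gapG xty.
pose c := g * (C * (2 * rho) + b) + L * C * (E * rho) + 2.
apply: nrm_eq0; apply/ler_addgt0Pr => e e0; rewrite add0r.
have q01 : 0 <= (1 / 2 : R) < 1 by apply/andP; split; lra.
have [k ke] := expr_small (c * a) q01 e0; apply: le_trans (ltW ke).
have hk := xa k; have hk1 := xa k.+1; rewrite iterS in hk1.
have xy : near (iter k (newton_step f r y) x0) y by split=> //; apply: xr.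
move: (iter k (newton_step f r y) x0) hk hk1 xy => x hk hk1 xy.
have [_ _ _ [Jb' Gg'] _] := gapG xy.
set q : R := a * (1 / 2) ^+ k in hk *; have q0 : 0 <= q := le_trans (nrm_ge0 _) hk.
have dq : nrm (xt - x) <= q by rewrite nrmC.
have d2 : nrm (xt - x) <= 2 * rho := near_dist xy xty.
have fd : nrm (f (xt, y) - f (x, y)) <= (C * (2 * rho) + b) * q.
  rewrite -[f (xt, y) - f (x, y)](subrK (J x y *m (xt - x))); apply: le_trans (nrmD _ _) _.
  rewrite mulrDl; apply: lerD.
    apply: le_trans (taylor xy xty) _; rewrite -mulrA expr2; apply: ler_wpM2l => //.
    by apply: ler_pM; rewrite ?nrm_ge0.
  by apply: le_trans (nrmM _ _) _; apply: ler_pM; rewrite ?nrm_ge0.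
rewrite (mulmx_variation (G x y) _ (f (x, y))).
have -> : c * a * (1 / 2) ^+ k = g * ((C * (2 * rho) + b) * q) + L * (C * q) * (E * rho) + 2 * q.
  by rewrite /c /q; ring.
apply: le_trans (nrmD _ _) _; apply: lerD; first apply: le_trans (nrmD _ _) _; first apply: lerD.
- exact: le_trans (nrmM _ _) (ler_pM (nrm_ge0 _) (nrm_ge0 _) Gg fd).
- apply: le_trans (nrmM _ _) (ler_pM (nrm_ge0 _) (nrm_ge0 _) _ (near_small xy)).
  apply: le_trans (lipG xy xty) (ler_wpM2l L0 _).
  by apply: le_trans (lipJ xty xy) _; rewrite subrr nrm0 addr0; apply: ler_wpM2l.
have -> : G x y *m f (x, y) = x - xt - (newton_step f r y x - xt).
  by rewrite /newton_step opprB addrA subrK subKr.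
rewrite exprS mulrCA -/q in hk1; apply: le_trans (nrmB _ _) (le_trans (lerD hk hk1) _).
exact: half_le.
Qed.

(** Within the starting radius [t] the residual is at most [E * t] and the first step at most
    [g * E * t], so the whole trajectory stays within [t * (1 + 2 * (g * E)) <= s / 2] of [xs]. *)
Lemma newton_converges s x0 y : 0 < s -> s <= rho ->
  nrm (x0 - xs) < s / (2 * (1 + 2 * (g * E))) -> nrm (y - ys) < s / (2 * (1 + 2 * (g * E))) ->
  (forall k, nrm (iter k (newton_step f r y) x0 - xs) < s) /\
  exists xt a, [/\ 0 <= a, forall k, nrm (iter k (newton_step f r y) x0 - xt) <= a * (1 / 2) ^+ k,
    nrm (xt - xs) < s & G xt y *m f (xt, y) = 0].
Proof.
have radius_le u t : 0 <= u -> 0 < t -> t / (2 * (1 + 2 * u)) * (1 + 2 * u) <= t / 2 :> R.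
  by move=> u0 t0; rewrite invfM mulrA mulfVK // gt_eqF //; lra.
have radius_lt p q u t : p < t -> q <= u * t -> t * (1 + 2 * u) <= s / 2 -> 0 < s -> p + 2 * q < s by lra.
move=> s0 s_rho; have gE : 0 <= g * E := mulr_ge0 g0 E0.
have := radius_le _ _ gE s0; set t := s / _ => tE x0t yt.
have ts : t <= s.
  apply: le_trans (_ : t * (1 + 2 * (g * E)) <= _); last by apply: le_trans tE _; lra.
  by apply: ler_peMr; [apply: le_trans (nrm_ge0 _) (ltW x0t)|lra].
have x0y : near x0 y by split; [apply: lt_le_trans x0t _|apply: lt_le_trans yt _]; apply: le_trans ts _.
have yr : nrm (y - ys) < rho by case: x0y.
have [_ _ _ [_ Gg] _] := gapG x0y.
have d0 : nrm (newton_step f r y x0 - x0) <= g * E * t.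
  rewrite /newton_step addrC addKr nrmN -mulrA.
  apply: le_trans (nrmM _ _) (ler_pM (nrm_ge0 _) (nrm_ge0 _) Gg (f_small _ x0t yt)).
  exact: le_trans ts _.
have start := radius_lt _ _ _ _ x0t d0 tE s0.
have half x : nrm (x - xs) < s -> nrm (newton_step f r y x - xs) < s ->
    nrm (newton_step f r y (newton_step f r y x) - newton_step f r y x) <=
    1 / 2 * nrm (newton_step f r y x - x).
  move=> xr x'r; apply: newton_halving; last exact: lt_le_trans x'r s_rho.
  by split=> //; apply: lt_le_trans xr s_rho.
have [iter_s [xt xtE]] := halving_iteration half start.
have xts : nrm (xt - xs) < s.
  apply: le_lt_trans start; apply: le_trans (nrm_tri x0 _ _) _; rewrite addrC; apply: lerD => //.
  by have := xtE 0%N; rewrite /= expr0 mulr1 nrmC.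
split=> //; exists xt, (2 * nrm (newton_step f r y x0 - x0)); split=> //.
  by rewrite mulr_ge0 ?nrm_ge0.
apply: (newton_limit yr _ xtE); last exact: lt_le_trans xts s_rho.
by move=> k; apply: lt_le_trans (iter_s k) s_rho.
Qed.

(** The last three terms of [stationary_identity] amount to at most half of [nrm e] and are absorbed
    on the left, which doubles the first. *)
Lemma stationary_bound (P X : 'M[K]_(m, l)) (A Jh : 'M[K]_(l, m)) (u v : 'cV[K]_l) (e : 'cV[K]_m) (D : R) :
  e = P *m A *m e -> X *m v = 0 -> nrm X <= g -> nrm A <= b -> nrm e <= 2 * rho ->
  nrm (A - Jh) <= C * rho -> nrm (P - X) <= L * (C * (2 * rho)) ->
  nrm (u - Jh *m e) <= C * nrm e ^+ 2 -> nrm (u - v) <= C * D -> nrm e <= 2 * g * C * D.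
Proof.
have absorb u1 w d t s : u1 + 2 * w * t + w * t + 2 * s * t = d -> 3 * w + 2 * s <= 1 / 2 ->
    0 <= t -> t <= d -> t <= 2 * u1 :> R by nra.
move=> eE Xv Xg Ab dist LJ LG T Lf.
have E1 := stationary_identity Jh u eE Xv.
have e0 := nrm_ge0 e; have [_ s] := rho_small_parts.
have -> : 2 * g * C * D = 2 * (g * (C * D)) by ring.
apply: (absorb _ _ _ _ _ erefl s e0).
rewrite {1}E1.
have t1 : nrm (X *m (u - v)) <= g * (C * D).
  exact: le_trans (nrmM _ _) (ler_pM (nrm_ge0 _) (nrm_ge0 _) Xg Lf).
have t2 : nrm (X *m (u - Jh *m e)) <= 2 * (g * C * rho) * nrm e.
  apply: le_trans (nrmM _ _) (le_trans (ler_pM (nrm_ge0 _) (nrm_ge0 _) Xg T) _).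
  have -> : 2 * (g * C * rho) * nrm e = g * (C * (2 * rho * nrm e)) by ring.
  by rewrite expr2; apply: ler_wpM2l => //; apply: ler_wpM2l => //; apply: ler_wpM2r.
have t3 : nrm (X *m ((A - Jh) *m e)) <= g * C * rho * nrm e.
  apply: le_trans (nrmM _ _) _; rewrite -!mulrA; apply: ler_pM (nrm_ge0 _) (nrm_ge0 _) Xg _.
  by apply: le_trans (nrmM _ _) _; rewrite mulrA; apply: ler_wpM2r.
have t4 : nrm ((P - X) *m (A *m e)) <= 2 * (L * C * b * rho) * nrm e.
  have -> : 2 * (L * C * b * rho) * nrm e = L * (C * (2 * rho)) * (b * nrm e) by ring.
  apply: le_trans (nrmM _ _) _; apply: ler_pM (nrm_ge0 _) (nrm_ge0 _) LG _.
  by apply: le_trans (nrmM _ _) _; apply: ler_wpM2r.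
apply: le_trans (nrmD _ _) (lerD _ t4); apply: le_trans (nrmD _ _) (lerD _ t3).
exact: le_trans (nrmB _ _) (lerD t1 t2).
Qed.

Lemma stationary_error xt yt xh : near xt yt -> near xh ys -> near xs ys ->
  G xt yt *m f (xt, yt) = 0 -> f (xh, ys) = 0 -> kernel_proj (J xs ys) *m (xt - xh) = 0 ->
  G xs ys = mpinv (J xs ys) -> nrm (xt - xh) <= 2 * g * C * nrm (yt - ys).
Proof.
move=> xyt xyh xys Gf fh Pe GA.
have [_ _ _ [_ Gg] _] := gapG xyt; have [_ _ _ [Ab _] _] := gapG xys.
have xty : near xt ys by split; [case: xyt|case: xys].
have dist := near_dist xyh xyt.
have dx : nrm (xs - xt) <= rho by rewrite nrmC; case: xyt => /ltW.
have dy : nrm (ys - yt) <= rho by rewrite nrmC; case: xyt => _ /ltW.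
have dh : nrm (xs - xh) <= rho by rewrite nrmC; case: xyh => /ltW.
have T := taylor xyh xty; rewrite fh subr0 in T.
have LJ : nrm (J xs ys - J xh ys) <= C * rho.
  apply: le_trans (lipJ xys xyh) (ler_wpM2l C0 _).
  by rewrite subrr nrm0 addr0.
have LG : nrm (G xs ys - G xt yt) <= L * (C * (2 * rho)).
  apply: le_trans (lipG xyt xys) (ler_wpM2l L0 _).
  apply: le_trans (lipJ xys xyt) (ler_wpM2l C0 _).
  by rewrite mulr_natl mulr2n; apply: lerD.
have Lf := lipf xty xyt; rewrite (nrmC ys) in Lf.
move: (nrm (yt - ys)) Lf => D Lf.
have eE : xt - xh = G xs ys *m J xs ys *m (xt - xh).
  by apply/eqP; rewrite GA -subr_eq0 -{1}(mul1mx (xt - xh)) -mulmxBl; apply/eqP.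
(* Here [X] is the pseudo-inverse at [(xt, yt)], [Jh] the Jacobian at the zero [xh], [u] is
   [f (xt, ys)] and [v] is [f (xt, yt)]. *)
exact: (stationary_bound eE Gf Gg Ab dist LJ LG T Lf).
Qed.

End Newton.

(** * Choice of constants and assembly *)

Lemma large_constant (R : realType) (c a : R) : 0 < a ->
  exists2 h : R, 0 < h < 1 & c <= 8 / (1 - h) * a.
Proof.
move=> a0; have c1 : 0 < `|c| + 1 by rewrite ltr_wpDl.
pose u := Num.min (1 / 2) (8 * a / (`|c| + 1)).
have u0 : 0 < u by rewrite lt_min; apply/andP; split; [lra|rewrite divr_gt0 // mulr_gt0].
have u2 : u <= 1 / 2 by rewrite ge_min lexx.
exists (1 - u); first by apply/andP; split; lra.
rewrite opprB addrC subrK mulrAC ler_pdivlMr //.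
apply: (@le_trans _ _ ((`|c| + 1) * u)).
  by apply: ler_wpM2r; [apply: ltW|apply: le_trans (ler_norm c) _; rewrite lerDl].
by rewrite mulrC -ler_pdivlMr // ge_min lexx orbT.
Qed.

Lemma small_radius (R : realType) (a b c K : R) : 0 < a -> 0 < b -> 0 <= c -> 0 <= K ->
  exists2 s, 0 < s & [/\ s <= a, s <= 1, c * (2 * s) < b & K * s <= 1 / 2].
Proof.
move=> a0 b0 c0 K0; have c1 : 0 < 2 * c + 1 by lra. have K1 : 0 < 2 * K + 1 by lra.
pose s := Num.min (Num.min a 1) (Num.min (b / (2 * c + 1)) (1 / (2 * K + 1))).
have s0 : 0 < s by rewrite !lt_min a0 ltr01 !divr_gt0.
exists s => //; split.
- by rewrite !ge_min lexx.
- by rewrite !ge_min lexx orbT.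
- have : s <= b / (2 * c + 1) by rewrite !ge_min lexx !orbT.
  rewrite ler_pdivlMr // => h; apply: lt_le_trans h; rewrite mulrDr mulr1.
  have -> : c * (2 * s) = s * (2 * c) by ring.
  by rewrite ltrDl.
- have : s <= 1 / (2 * K + 1) by rewrite !ge_min lexx !orbT.
  rewrite ler_pdivlMr // mulrDr mulr1 => h.
  have -> : K * s = s * (2 * K) / 2 by field.
  by rewrite ler_pM2r ?invr_gt0 //; apply: le_trans h; rewrite lerDl ltW.
Qed.

Lemma mpinv_neq0 (R : realType) (F : ground) l m (A : 'M[scalarField R F]_(l, m)) :
  (0 < \rank A)%N -> mpinv A != 0.
Proof.
have [AXA _ _ _] := mpinvP A; apply: contraTneq => X0.
by rewrite -AXA X0 mulmx0 mul0mx mxrank0.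
Qed.

Theorem theorem5p1 (R : realType) (F : ground) (m n l : nat)
    (D : set ('cV[scalarField R F]_m * 'cV[scalarField R F]_n))
    (f : 'cV[scalarField R F]_m * 'cV[scalarField R F]_n -> 'cV[scalarField R F]_l)
    (xs : 'cV[scalarField R F]_m) (ys : 'cV[scalarField R F]_n) (r : nat)
    (D_open : open D)
    (f_smooth : smooth_on D f)
    (Dxys : D (xs, ys))
    (xs_semiregular :
      semiregular_zero [set x | D (x, ys)] (fun x => f (x, ys)) xs)
    (rank_fx : \rank (jac_x f (xs, ys)) = r)
    (r_gt0 : (0 < r)%N)
    (fy_gt0 : 0 < mxnorm2 (jac_y f (xs, ys))) :
  exists (Oms : set 'cV[scalarField R F]_m) (Sigs : set 'cV[scalarField R F]_n)
         (Om0 : set 'cV[scalarField R F]_m) (h M : R),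
    [/\ open_nbhs xs Oms, open_nbhs ys Sigs, Oms `*` Sigs `<=` D,
        open_nbhs xs Om0 & 0 < h < 1] /\
    forall (yt : 'cV[scalarField R F]_n) (x0 : 'cV[scalarField R F]_m),
      Sigs yt -> Om0 x0 ->
      exists xt xh : 'cV[scalarField R F]_m,
        [/\ forall k, D (iter k (newton_step f r yt) x0, yt),
            linearly_converges (fun k => iter k (newton_step f r yt) x0) xt,
            Oms xt /\ mpinv (rank_proj r (jac_x f (xt, yt))) *m f (xt, yt) = 0,
            semiregular_zero [set x | D (x, ys)] (fun x => f (x, ys)) xh /\
            same_branch [set x | D (x, ys)] (fun x => f (x, ys)) xs xh &
            norm2 (xt - xh) <=
              8 / (1 - h) * mxnorm2 (mpinv (jac_x f (xs, ys)))
                * mxnorm2 (jac_y f (xs, ys)) * norm2 (yt - ys)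
              + M * norm2 (yt - ys) ^+ 2].
Proof.
have [rho [C [rho0 C0 D_near est]]] := smooth_estimates D_open Dxys f_smooth.
have fs : f (xs, ys) = 0 := semiregular_zeroP xs_semiregular.
have [b [g [rhoJ [rhoJ0]]]] := rank_proj_gap_inverse (jac_x f (xs, ys)).
rewrite rank_fx => gap.
have gapA := gap (jac_x f (xs, ys)); rewrite subrr nrm0 in gapA.
have [_ _ _ [bA gA] _] := gapA rhoJ0.
have b0 : 0 <= b := le_trans (nrm_ge0 _) bA.
have g0 : 0 <= g := le_trans (nrm_ge0 _) gA.
have [L L0 lipG] := @gap_inverse_lipschitz R F l m b g.
(* The change of parameter and the Taylor remainder contribute one [C] each, the linear term [b];
   the remainder is bounded linearly thanks to [s <= 1]. *)
pose E := 2 * C + b; have E0 : 0 <= E by rewrite addr_ge0 // mulr_ge0.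
have K0 : 0 <= 5 * g * C + L * C * (1 + b * g) * E + 2 * L * C * b.
  by rewrite !addr_ge0 ?mulr_ge0 // addr_ge0 ?mulr_ge0.
have [s s0 [s_rho s1 s_gap s_small]] := small_radius rho0 rhoJ0 C0 K0.
have in_rho (t : R) : t < s -> t < rho by move=> ts; apply: lt_le_trans ts s_rho.
have lipJ x y x' y' : nrm (x - xs) < s /\ nrm (y - ys) < s -> nrm (x' - xs) < s /\ nrm (y' - ys) < s ->
    nrm (jac_x f (x, y) - jac_x f (x', y')) <= C * (nrm (x - x') + nrm (y - y')).
  by move=> [h1 h2] [h3 h4];
    have [] := est x x' y y' (in_rho _ h1) (in_rho _ h3) (in_rho _ h2) (in_rho _ h4).
have taylor x x' y : nrm (x - xs) < s /\ nrm (y - ys) < s -> nrm (x' - xs) < s /\ nrm (y - ys) < s ->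
    nrm (f (x', y) - f (x, y) - jac_x f (x, y) *m (x' - x)) <= C * nrm (x' - x) ^+ 2.
  by move=> [h1 h2] [h3 h4];
    have [] := est x x' y y (in_rho _ h1) (in_rho _ h3) (in_rho _ h2) (in_rho _ h4).
have lipf x y y' : nrm (x - xs) < s /\ nrm (y - ys) < s -> nrm (x - xs) < s /\ nrm (y' - ys) < s ->
    nrm (f (x, y) - f (x, y')) <= C * nrm (y - y').
  by move=> [h1 h2] [h3 h4];
    have [] := est x x y y' (in_rho _ h1) (in_rho _ h3) (in_rho _ h2) (in_rho _ h4).
have xys : nrm (xs - xs) < s /\ nrm (ys - ys) < s by rewrite !subrr !nrm0.
have gapG x y : nrm (x - xs) < s /\ nrm (y - ys) < s ->
    gap_inverse b g (jac_x f (x, y)) (mpinv (rank_proj r (jac_x f (x, y)))).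
  move=> xy; apply: gap; apply: le_lt_trans s_gap; apply: le_trans (lipJ _ _ _ _ xy xys) (ler_wpM2l C0 _).
  by rewrite mulr_natl mulr2n; case: xy => h1 h2; apply: lerD; apply: ltW.
have lipG' x y x' y' : nrm (x - xs) < s /\ nrm (y - ys) < s -> nrm (x' - xs) < s /\ nrm (y' - ys) < s ->
    nrm (mpinv (rank_proj r (jac_x f (x', y'))) - mpinv (rank_proj r (jac_x f (x, y)))) <=
    L * nrm (jac_x f (x', y') - jac_x f (x, y)).
  by move=> h1 h2; apply: lipG; apply: gapG.
have f_small t x y : t <= s -> nrm (x - xs) < t -> nrm (y - ys) < t -> nrm (f (x, y)) <= E * t.
  move=> ts xt yt; have t0 : 0 <= t := le_trans (nrm_ge0 _) (ltW xt).
  have xy : nrm (x - xs) < s /\ nrm (y - ys) < s by split; apply: lt_le_trans ts.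
  have xy' : nrm (x - xs) < s /\ nrm (ys - ys) < s by split; [case: xy|case: xys].
  have T := taylor _ _ _ xys xy'; rewrite fs subr0 in T.
  rewrite -[f (x, y)](subrK (f (x, ys))); apply: le_trans (nrmD _ _) _.
  have -> : E * t = C * t + (C * t + b * t) by rewrite /E; ring.
  apply: lerD; first by apply: le_trans (lipf _ _ _ xy xy') (ler_wpM2l C0 (ltW yt)).
  rewrite -[f (x, ys)](subrK (jac_x f (xs, ys) *m (x - xs))); apply: le_trans (nrmD _ _) (lerD _ _).
    apply: le_trans T (ler_wpM2l C0 _); rewrite expr2 -[leRHS]mul1r.
    by apply: ler_pM; rewrite ?nrm_ge0 // ltW // (lt_le_trans xt) // (le_trans ts).
  exact: le_trans (nrmM _ _) (ler_pM (nrm_ge0 _) (nrm_ge0 _) bA (ltW xt)).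
have [r2 r20 nearby] : exists2 r2, 0 < r2 & forall x, nrm (x - xs) < r2 -> exists xh,
    [/\ nrm (xh - xs) < s, kernel_proj (jac_x f (xs, ys)) *m (x - xh) = 0, f (xh, ys) = 0,
        semiregular_zero [set x | D (x, ys)] (fun x => f (x, ys)) xh &
        same_branch [set x | D (x, ys)] (fun x => f (x, ys)) xs xh].
  have near_ys x : nrm (x - xs) < s -> nrm (x - xs) < s /\ nrm (ys - ys) < s by case: xys.
  apply: (@semiregular_nearby R F m l _ _ xs s C s0 C0 _ _ _ _ fs s s0 xs_semiregular).
  - by move=> x xr; have [] := D_near x ys (in_rho _ xr); rewrite // subrr nrm0.
  - move=> x xr; have [] // := @fder_differentiable R F m l (fun x => f (x, ys)) x (jac_x f (x, ys)) _.
    have d0 : 0 < s - nrm (x - xs) by rewrite subr_gt0.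
    apply: (quadratic_fder C0 d0) => h hd.
    have xh : nrm (x + h - xs) < s.
      rewrite addrAC; by apply: le_lt_trans (nrmD _ _) _; rewrite -ltrBrDl.
    by have := taylor _ _ _ (near_ys _ xr) (near_ys _ xh); rewrite (addrC x h) addrK.
  - by move=> x x' xr x'r; apply: taylor; apply: near_ys.
  - move=> x x' xr x'r; apply: le_trans (lipJ _ _ _ _ (near_ys _ xr) (near_ys _ x'r)) _.
    by rewrite subrr nrm0 addr0.
(* Iterates and limit are kept within [r2] as well, where [nearby] supplies a zero for the limit. *)
pose s' := Num.min s r2.
have s'0 : 0 < s' by rewrite lt_min s0.
have s's : s' <= s by rewrite ge_min lexx.
have s'r2 : s' <= r2 by rewrite ge_min lexx orbT.
pose t := s' / (2 * (1 + 2 * (g * E))).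
have t0 : 0 < t by rewrite divr_gt0 // mulr_gt0 // ltr_wpDr // !mulr_ge0.
have ts : t <= s.
  apply: le_trans s's; rewrite ler_pdivrMr ?mulr_gt0 // ?ltr_wpDr ?mulr_ge0 //.
  apply: ler_peMr; first exact: ltW.
  by rewrite mulrDr mulr1; apply: le_trans (_ : 2 <= _); rewrite ?lerDl ?mulr_ge0 // ler1n.
have a0 : 0 < mxnorm2 (mpinv (jac_x f (xs, ys))) * mxnorm2 (jac_y f (xs, ys)).
  by rewrite mulr_gt0 // mxnorm2_gt0 // mpinv_neq0 // rank_fx.
(* The factor [n] is the cost of [nrm] against [norm2] on the parameter space. *)
have [h h01 hE] := large_constant (2 * g * C * n%:R) a0.
exists [set x | nrm (x - xs) < s], [set y | nrm (y - ys) < t], [set x | nrm (x - xs) < t], h, 0.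
split.
  split; [exact: open_nbhs_nrm_ball|exact: open_nbhs_nrm_ball| |exact: open_nbhs_nrm_ball|exact: h01].
  move=> [x y] [/= xr yr]; have [] // := D_near x y (in_rho _ xr) (in_rho _ _).
  exact: lt_le_trans yr ts.
move=> yt x0 yr xr.
have [iter_s [xt [c [c0 lin xts stat]]]] :=
  newton_converges g0 b0 L0 C0 E0 s0 gapG lipG' taylor lipJ f_small s_small s'0 s's xr yr.
have [xh [xhs Pe fxh sxh bxh]] := nearby xt (lt_le_trans xts s'r2).
have yts : nrm (yt - ys) < s := lt_le_trans yr ts.
exists xt, xh; split.
- move=> k; have [] // := D_near (iter k (newton_step f r yt) x0) yt (in_rho _ _) (in_rho _ yts).
  exact: lt_le_trans (iter_s k) s's.
- exists c, (1 / 2); split; [exact: c0|by rewrite divr_gt0 // ltr_pdivrMr // mul1r ltr1n|].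
  by move=> k; apply: le_trans (norm2_le_nrm _) (lin k).
- by split=> //; apply: lt_le_trans xts s's.
- by [].
have GA : mpinv (rank_proj r (jac_x f (xs, ys))) = mpinv (jac_x f (xs, ys)).
  by rewrite -rank_fx rank_proj_rank.
have xyt : nrm (xt - xs) < s /\ nrm (yt - ys) < s by split=> //; apply: lt_le_trans xts s's.
have xyh : nrm (xh - xs) < s /\ nrm (ys - ys) < s by split=> //; case: xys.
have := stationary_error g0 b0 L0 C0 E0 s0 gapG lipG' taylor lipJ lipf s_small xyt xyh xys stat fxh Pe GA.
move=> err; apply: le_trans (norm2_le_nrm _) _; apply: le_trans err _.
rewrite mul0r addr0 -(mulrA (8 / (1 - h))); apply: le_trans (ler_wpM2r (sqrtr_ge0 _) hE).
rewrite -(mulrA _ n%:R); apply: ler_wpM2l; first by rewrite !mulr_ge0.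
exact: nrm_le_norm2.
Qed.
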